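(* Let $F$ be a field, $d,l\geq1$ integers, and $\mathbf q=(q_1,\dots,q_l)\in F^l$. For $\mathbf i\in X_d^{\mathbf q}$, the dimension over $F$ of the center of the block $b(\mathbf i)H_d^{\mathbf q}$ is equal to the number of $l$-multipartitions $\lambda$ of $d$ such that $\mathbf i^{\mathbf q}_\lambda=\mathbf i$ (as elements of $X_d$).
   Context: The degenerate affine Hecke algebra $H_d$ over $F$ is the $F$-algebra which equals $F[x_1,\dots,x_d]\otimes_F FS_d$ as a vector space, with multiplication such that $F[x_1,\dots,x_d]$ and $FS_d$ are subalgebras and $s_ix_{i+1}=x_is_i+1$, $s_ix_j=x_js_i$ for $j\ne i,i+1$, where $s_i=(i\ i{+}1)$. Its center $Z(H_d)$ consists of all symmetric polynomials in $x_1,\dots,x_d$. $H_d^{\mathbf q}$ is the quotient of $H_d$ by the two-sided ideal generated by $(x_1-q_1)\cdots(x_1-q_l)$; the quotient map sends $Z(H_d)$ onto $Z(H_d^{\mathbf q})$. For $\mathbf i=(i_1,\dots,i_d)\in F^d$, let $\chi(\mathbf i):Z(H_d)\to F$ be the homomorphism sending a symmetric polynomial $g(x_1,\dots,x_d)$ to $g(i_1,\dots,i_d)$. Write $\mathbf i\sim\mathbf j$ if $\mathbf j$ is obtained from $\mathbf i$ by permuting entries; $\chi(\mathbf i)=\chi(\mathbf j)$ iff $\mathbf i\sim\mathbf j$. $X_d$ is the set of $\sim$-equivalence classes in $F^d$, and $X_d^{\mathbf q}$ is the set of $\mathbf i\in X_d$ such that $\chi(\mathbf i)$ factors through the quotient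 $Z(H_d^{\mathbf q})$; thus $X_d^{\mathbf q}$ parametrizes the central characters of $H_d^{\mathbf q}$. For $\mathbf i\in X_d^{\mathbf q}$, $b(\mathbf i)\in Z(H_d^{\mathbf q})$ is the primitive central idempotent that acts as one on irreducible modules of central character $\chi(\mathbf i)$ and as zero on all other irreducible modules. An $l$-multipartition of $d$ is a tuple $\lambda=(\lambda^{(1)},\dots,\lambda^{(l)})$ of partitions with $\sum_r|\lambda^{(r)}|=d$. For a partition $\kappa$ and $q\in F$, the residue of the box in row $i$, column $j$ of the Young diagram of $\kappa$ is $q+j-i$, and $\mathbf i^q_\kappa$ is the tuple of all residues of boxes of $\kappa$, read in some order. Then $\mathbf i^{\mathbf q}_\lambda\in X_d$ is the class of the concatenation of $\mathbf i^{q_1}_{\lambda^{(1)}},\dots,\mathbf i^{q_l}_{\lambda^{(l)}}$. *)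

(* Defs.v *)
From HB Require Import structures.
From mathcomp Require Import all_boot all_order all_fingroup all_algebra.
From mathcomp Require Import mpoly.

Set Implicit Arguments.
Unset Strict Implicit.
Unset Printing Implicit Defensive.

Import GRing.Theory.
Local Open Scope ring_scope.

(* A structure of degenerate affine Hecke algebra on the F-algebra H: the
   embeddings of F[x_1..x_d] and of the group S_d, the PBW decomposition
   H = F[x_1..x_d] (x) F S_d and the mixed relations. These data determine H up
   to unique isomorphism. Indices are 0-based, and s_i = tperm i j with j = i+1.
   MathComp composes permutations from left to right; since the s_i are
   involutions, w |-> w^-1 translates to the opposite convention without
   affecting the relations. *)
Record dAHA (F : fieldType) (d : nat) (H : algType F) := DAHA {
  dA_pol : {lrmorphism {mpoly F[d]} -> H};
  dA_perm : 'S_d -> H;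
  dA_perm1 : dA_perm 1%g = 1;
  dA_permM : forall u w : 'S_d, dA_perm (u * w)%g = dA_perm u * dA_perm w;
  dA_PBW : forall h : H, exists! c : {ffun 'S_d -> {mpoly F[d]}},
    h = \sum_(w : 'S_d) dA_pol (c w) * dA_perm w;
  dA_sx : forall i j : 'I_d, j = i.+1 :> nat ->
    dA_perm (tperm i j) * dA_pol 'X_j = dA_pol 'X_i * dA_perm (tperm i j) + 1;
  dA_sx_far : forall i j k : 'I_d, j = i.+1 :> nat -> k != i -> k != j ->
    dA_perm (tperm i j) * dA_pol 'X_k = dA_pol 'X_k * dA_perm (tperm i j)
}.

Definition in_ideal (R : pzRingType) (g h : R) : Prop :=
  exists s : seq (R * R), h = \sum_(ab <- s) ab.1 * g * ab.2.

Definition cyclotomic_poly (F : fieldType) (d l : nat) (hd : (0 < d)%N)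
    (q : l.-tuple F) : {mpoly F[d]} :=
  \prod_(r < l) ('X_(Ordinal hd) - (tnth q r)%:MP).

(* pi : H -> A exhibits A as the quotient of H by the two-sided ideal generated
   by (x_1 - q_1) ... (x_1 - q_l). *)
Definition is_cyclotomic_quotient (F : fieldType) (d l : nat) (hd : (0 < d)%N)
    (q : l.-tuple F) (H : algType F) (HH : dAHA d H)
    (A : algType F) (pi : {lrmorphism H -> A}) : Prop :=
  (forall a : A, exists h : H, pi h = a) /\
  (forall h : H, pi h = 0 <-> in_ideal (dA_pol HH (cyclotomic_poly hd q)) h).

Definition central (F : fieldType) (A : algType F) (z : A) : Prop :=
  forall a : A, z * a = a * z.

(* The F-algebra homomorphisms Z(A) -> F, as functions on A of which only the
   restriction to the center is relevant. *)
Definition is_central_hom (F : fieldType) (A : algType F) (chi : A -> F) : Prop :=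
  [/\ chi 1 = 1,
      forall (c : F) (y z : A), central y -> central z ->
        chi (c *: y + z) = c * chi y + chi z
    & forall y z : A, central y -> central z -> chi (y * z) = chi y * chi z].

(* The class of the tuple i lies in X_d^q: the character g |-> g(i) of Z(H),
   the algebra of symmetric polynomials, factors through Z(A). *)
Definition factors_through (F : fieldType) (d : nat) (H : algType F)
    (HH : dAHA d H) (A : algType F) (pi : {lrmorphism H -> A})
    (i : d.-tuple F) : Prop :=
  exists2 chi : A -> F, is_central_hom chi &
    forall g : {mpoly F[d]}, g \is symmetric -> chi (pi (dA_pol HH g)) = g.@[tnth i].

Definition is_submodule (R : pzRingType) (V : lmodType R) (W : V -> Prop) : Prop :=
  W 0 /\ forall (a : R) (v w : V), W v -> W w -> W (a *: v + w).

Definition irreducible_module (R : pzRingType) (V : lmodType R) : Prop :=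
  (exists v : V, v <> 0) /\
  forall W : V -> Prop, is_submodule W ->
    (forall v, W v -> v = 0) \/ (forall v, W v).

Definition has_central_character (F : fieldType) (d : nat) (H : algType F)
    (HH : dAHA d H) (A : algType F) (pi : {lrmorphism H -> A})
    (i : d.-tuple F) (V : lmodType A) : Prop :=
  forall g : {mpoly F[d]}, g \is symmetric ->
    forall v : V, pi (dA_pol HH g) *: v = (g.@[tnth i])%:A *: v.

Definition central_idempotent (F : fieldType) (A : algType F) (e : A) : Prop :=
  central e /\ e * e = e.

Definition primitive_central_idempotent (F : fieldType) (A : algType F)
    (b : A) : Prop :=
  [/\ central_idempotent b, b <> 0
    & forall e : A, central_idempotent e -> b * e = e -> e = 0 \/ e = b].

(* b = b(i); these conditions determine b. *)
Definition is_block_idempotent (F : fieldType) (d : nat) (H : algType F)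
    (HH : dAHA d H) (A : algType F) (pi : {lrmorphism H -> A})
    (i : d.-tuple F) (b : A) : Prop :=
  [/\ primitive_central_idempotent b,
      forall V : lmodType A, irreducible_module V ->
        has_central_character HH pi i V -> forall v : V, b *: v = v
    & forall V : lmodType A, irreducible_module V ->
        ~ has_central_character HH pi i V -> forall v : V, b *: v = 0].

Definition in_block (F : fieldType) (A : algType F) (b a : A) : Prop :=
  exists h : A, a = b * h.

Definition in_block_center (F : fieldType) (A : algType F) (b z : A) : Prop :=
  in_block b z /\ forall a : A, in_block b a -> z * a = a * z.

(* The set P is an F-subspace of V having a basis with n elements. *)
Definition has_dim (F : fieldType) (V : lmodType F) (P : V -> Prop) (n : nat) : Prop :=
  exists v : 'I_n -> V,
    (forall c : {ffun 'I_n -> F}, P (\sum_(k < n) c k *: v k)) /\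
    (forall z : V, P z -> exists! c : {ffun 'I_n -> F}, z = \sum_(k < n) c k *: v k).

Definition is_partition (s : seq nat) : bool := sorted geq s && (0%N \notin s).

Definition residues (F : fieldType) (q : F) (s : seq nat) : seq F :=
  [seq q + j%:R - i%:R | i <- iota 0 (size s), j <- iota 0 (nth 0%N s i)].

(* Partitions occurring in a multipartition of d have at most d parts, each at
   most d, hence all multipartitions of d live in the following finite type. *)
Definition multiseq (l d : nat) : finType := {ffun 'I_l -> {bseq d of 'I_d.+1}}.

Definition component (l d : nat) (la : multiseq l d) (r : 'I_l) : seq nat :=
  [seq nat_of_ord k | k <- la r].

Definition is_multipartition (l d : nat) (la : multiseq l d) : bool :=
  [forall r, is_partition (component la r)]
  && (\sum_(r < l) sumn (component la r) == d)%N.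

Definition multiresidues (F : fieldType) (l d : nat) (q : l.-tuple F)
    (la : multiseq l d) : seq F :=
  flatten [seq residues (tnth q r) (component la r) | r <- enum 'I_l].

Definition multipartitions_in_class (F : fieldType) (l d : nat) (q : l.-tuple F)
    (i : d.-tuple F) : {set multiseq l d} :=
  [set la | is_multipartition la & perm_eq (multiresidues q la) i].

(* Main.v *)
From HB Require Import structures.
From Stdlib Require Import ClassicalEpsilon.
From mathcomp Require Import all_boot all_order all_fingroup all_algebra.
From mathcomp Require Import ssrcomplements mpoly zify ring.
Require Import Defs.

Set Implicit Arguments.
Unset Strict Implicit.
Unset Printing Implicit Defensive.

Import Order.TTheory GRing.Theory.
Local Open Scope ring_scope.

(* By the cyclotomic relation, [A] is spanned by the l^d d! products x^a w with all exponents
   less than l. In the top degree part of a central element the coefficients are class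
   functions, and one unit of exponent may be moved along the cycles of w; so they are
   determined by one coefficient for each l-multipartition of d, whence an upper bound for the
   dimension of the center over any field.
   For generic charges, that is over the fraction field K of Z[q_1, .., q_l], Young's seminormal
   form on standard multitableaux realizes l^d d! matrix units. Hence the products x^a w are
   independent over K and, by base change, in [A]; and the matrices that are constant on every
   shape are central.
   Let g be a symmetric polynomial over Z[q_1, .., q_l] that vanishes at the residues of the
   multipartitions outside the class of i, but takes a value gamma <> 0 at i, and let n be the
   number of multipartitions in the class. Then g (g - gamma)^n = 0 in [A], because the
   corresponding relation holds over K. Ranks can only drop under specialization from K to F, so
   inside the center the kernel of (g - gamma)^n has dimension at least n, and the kernel of g
   at least the number of the other multipartitions. As these kernels intersect trivially, the
   upper bound forces equalities. Finally b(i) = 1 - (1 - g / gamma)^n, since no irreducible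
   module separates these central idempotents, and its block has the former kernel as center. *)

(** * Reduction modulo the cyclotomic relation *)

(** The charges may coincide and the characteristic is arbitrary, so the quotient need not be
    semisimple and its center cannot be read off its modules. The upper bound knows only the total
    number of multipartitions, not the classes; it becomes sharp on a class because two
    complementary kernels, each bounded from below, must fit into one center. No integral form of
    [A] is constructed. Relations pass from K to F inside the product of [A] with a matrix ring over
    K, viewed over R = Z[q_1, .., q_l]: the R-span of the pairs of basis elements is a subring, and
    the coordinates of its elements are common to both components. The exponent n arises as follows:
    over R the polynomial g may take different values at the n members of the class, but all of them
    specialize to gamma, so the product of the differences g - g(la) becomes (g - gamma)^n. The
    relations are stated for maps into any ring, with scalars entering through constant polynomials.
    The same reduction then serves the affine algebra, its quotient, matrices and products of
    these. *)

Record hecke_datum (R : comNzRingType) (E : pzRingType) (d : nat)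
    (P : {mpoly R[d]} -> E) (W : 'S_d -> E) : Prop := HeckeDatum {
  hd_central : forall c e, P c%:MP * e = e * P c%:MP;
  hd_perm1 : W 1%g = 1;
  hd_permM : forall u w : 'S_d, W (u * w)%g = W u * W w;
  hd_sx : forall i j : 'I_d, j = i.+1 :> nat ->
    W (tperm i j) * P 'X_j = P 'X_i * W (tperm i j) + 1;
  hd_sx_far : forall i j k : 'I_d, j = i.+1 :> nat -> k != i -> k != j ->
    W (tperm i j) * P 'X_k = P 'X_k * W (tperm i j)
}.

(** The exponents of a monomial after [W w] has passed it from left to right, up to lower degree:
    x_k turns into x_(w^-1 k). *)
Definition mact (d : nat) (w : 'S_d) (m : 'X_{1..d}) : 'X_{1..d} :=
  [multinom m (w i) | i < d].

(** A transposition of distant entries is a shorter one conjugated by an adjacent one, so the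
    adjacent ones generate the group. *)
Lemma adjacent_tperm_ind (d : nat) (Q : 'S_d -> Prop) :
  Q 1%g ->
  (forall (i j : 'I_d) w, j = i.+1 :> nat -> Q w -> Q (tperm i j * w)%g) ->
  forall w, Q w.
Proof.
move=> Q1 Qs.
pose T := [set tperm ij.1 ij.2 | ij : 'I_d * 'I_d & ij.2 == ij.1.+1 :> nat].
have genT (w : 'S_d) : w \in <<T>>%g -> Q w.
  move=> /gen_prodgP [n [c cT ->]].
  elim: n c cT => [|n IH] c cT; first by rewrite big_ord0.
  rewrite big_ord_recl; have /imsetP[[i j] /[!inE] /= /eqP ij ->] := cT ord0.
  by apply: Qs => //; apply: IH.
have tT n (i j : 'I_d) : j = (i + n).+1 :> nat -> tperm i j \in <<T>>%g.
  elim: n i j => [|n IH] i j ij.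
    apply: mem_gen; apply/imsetP; exists (i, j) => //.
    by rewrite inE /= ij addn0.
  have lt : (i.+1 < d)%N by have := ltn_ord j; lia.
  pose k := Ordinal lt.
  have ik : tperm i k \in <<T>>%g.
    by apply: mem_gen; apply/imsetP; exists (i, k) => //; rewrite inE /=.
  have kj : tperm k j \in <<T>>%g by apply: IH; rewrite /= ij; lia.
  suff -> : tperm i j = (tperm k j ^ tperm i k)%g by rewrite groupJ.
  by rewrite tpermJ tpermR tpermD // -val_eqE /= ?ij; lia.
have tT' (i j : 'I_d) : tperm i j \in <<T>>%g.
  case: (ltngtP i j) => [lt|lt|/val_inj ->]; last by rewrite tperm1 group1.
    by apply: (tT (j - i).-1); lia.
  by rewrite tpermC; apply: (tT (i - j).-1); lia.
move=> w; apply: genT; have [ts -> _] := prod_tpermP w.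
by apply: group_prod => t _; apply: tT'.
Qed.

Section Span.
Variables (R : comNzRingType) (E : pzRingType) (d : nat).
Variables (P : {rmorphism {mpoly R[d]} -> E}) (W : 'S_d -> E).
Hypothesis HD : hecke_datum P W.

(** [msize] exceeds the degree by one, so this is the filtration step with coefficients of degree
    less than [m]; for [m = 1] they are constants. *)
Definition pbw_span (m : nat) (e : E) : Prop :=
  exists2 c : {ffun 'S_d -> {mpoly R[d]}},
    (forall w, (msize (c w) <= m)%N) & e = \sum_w P (c w) * W w.

Lemma pbw_span0 m : pbw_span m 0.
Proof.
exists [ffun=> 0]; first by move=> w; rewrite ffunE mmeasure0.
by rewrite big1 // => w _; rewrite ffunE rmorph0 mul0r.
Qed.

Lemma pbw_spanD m e f : pbw_span m e -> pbw_span m f -> pbw_span m (e + f).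
Proof.
move=> [c hc ->] [c' hc' ->]; exists [ffun w => c w + c' w].
  move=> w; rewrite ffunE (leq_trans (msizeD_le _ _)) //.
  by rewrite geq_max hc hc'.
by rewrite -big_split; apply: eq_bigr => w _; rewrite ffunE rmorphD mulrDl.
Qed.

Lemma pbw_spanN m e : pbw_span m e -> pbw_span m (- e).
Proof.
move=> [c hc ->]; exists [ffun w => - c w].
  by move=> w; rewrite ffunE msizeN.
by rewrite -sumrN; apply: eq_bigr => w _; rewrite ffunE rmorphN mulNr.
Qed.

Lemma pbw_span_sum m (I : Type) (r : seq I) (Q : pred I) (G : I -> E) :
  (forall i, Q i -> pbw_span m (G i)) -> pbw_span m (\sum_(i <- r | Q i) G i).
Proof.
by move=> h; elim/big_ind: _ => //; [exact: pbw_span0 | exact: pbw_spanD].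
Qed.

Lemma pbw_span_leq m n e : (m <= n)%N -> pbw_span m e -> pbw_span n e.
Proof. by move=> mn [c hc ->]; exists c => // w; apply: leq_trans mn. Qed.

Lemma pbw_span_term m p w : (msize p <= m)%N -> pbw_span m (P p * W w).
Proof.
move=> pm; exists [ffun v => if v == w then p else 0].
  by move=> v; rewrite ffunE; case: ifP => // _; rewrite mmeasure0.
rewrite (bigD1 w) //= ffunE eqxx big1 ?addr0 // => v /negbTE vw.
by rewrite ffunE vw rmorph0 mul0r.
Qed.

Lemma pbw_span_ind (Q : E -> Prop) m :
  Q 0 -> (forall e f, Q e -> Q f -> Q (e + f)) ->
  (forall c mu w, (mdeg mu < m)%N -> Q (P c%:MP * P 'X_[mu] * W w)) ->
  forall e, pbw_span m e -> Q e.
Proof.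
move=> Q0 QD Qt e [c hc ->]; elim/big_ind: _ => // w _.
rewrite [c w]mpolyE rmorph_sum mulr_suml big_seq.
elim/big_ind: _ => // mu mus.
by rewrite -mul_mpolyC rmorphM; apply: Qt; apply: leq_trans (msize_mdeg_lt mus) _.
Qed.

Lemma pbw_spanMPl m c e : pbw_span m e -> pbw_span m (P c%:MP * e).
Proof.
move=> [a ha ->]; exists [ffun w => c *: a w].
  by move=> w; rewrite ffunE (leq_trans (mmeasureZ_le _ _ _)).
by rewrite mulr_sumr; apply: eq_bigr => w _; rewrite ffunE mulrA -rmorphM mul_mpolyC.
Qed.

Lemma pbw_spanXl m mu e : pbw_span m e -> pbw_span (mdeg mu + m) (P 'X_[mu] * e).
Proof.
move: e; apply: pbw_span_ind.
- by rewrite mulr0; exact: pbw_span0.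
- by move=> e f he hf; rewrite mulrDr; apply: pbw_spanD.
move=> c nu w nm; rewrite !mulrA -[P _ * P c%:MP](hd_central HD) -!mulrA.
apply: pbw_spanMPl; rewrite mulrA -rmorphM -mpolyXD; apply: pbw_span_term.
by rewrite msizeX mdegD ltn_add2l.
Qed.

Lemma pbw_spanWr m v e : pbw_span m e -> pbw_span m (e * W v).
Proof.
move: e; apply: pbw_span_ind.
- by rewrite mul0r; exact: pbw_span0.
- by move=> e f he hf; rewrite mulrDl; apply: pbw_spanD.
move=> c nu w nm; rewrite -mulrA -(hd_permM HD) -mulrA.
by apply: pbw_spanMPl; apply: pbw_span_term; rewrite msizeX.
Qed.

Lemma adjacent_tpermX (i j k : 'I_d) : j = i.+1 :> nat ->
  exists z : R, W (tperm i j) * P 'X_k = P 'X_(tperm i j k) * W (tperm i j) + P z%:MP.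
Proof.
move=> ij; have ss : W (tperm i j) * W (tperm i j) = 1.
  by rewrite -(hd_permM HD) tperm2 (hd_perm1 HD).
case: tpermP => [->|->|/eqP ki /eqP kj].
(* Multiplying the relation by s on both sides exchanges the roles of x_i and x_j; hence the sign of
   the correction. *)
- exists (-1); have /(congr1 (fun e => W (tperm i j) * e * W (tperm i j))) := hd_sx HD ij.
  rewrite !mulrDr !mulrDl !mulrA ss !mul1r mulr1 ss -[_ * P 'X_i * _ * _]mulrA ss mulr1.
  move=> ->; by rewrite mpolyCN mpolyC1 rmorphN rmorph1 addrK.
- by exists 1; rewrite mpolyC1 rmorph1 (hd_sx HD).
by exists 0; rewrite mpolyC0 rmorph0 addr0 (hd_sx_far HD).
Qed.

Lemma pbw_spanWl1 w e : pbw_span 1 e -> pbw_span 1 (W w * e).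
Proof.
move: e; apply: pbw_span_ind.
- by rewrite mulr0; exact: pbw_span0.
- by move=> e f he hf; rewrite mulrDr; apply: pbw_spanD.
move=> c nu v; rewrite ltnS leqn0 mdeg_eq0 => /eqP ->.
rewrite mpolyX0 rmorph1 mulr1 mulrA -(hd_central HD) -mulrA -(hd_permM HD).
by apply: pbw_spanMPl; rewrite -[W _]mul1r -(rmorph1 P); apply: pbw_span_term; rewrite msize1.
Qed.

Lemma perm_commX w k : pbw_span 1 (W w * P 'X_k - P 'X_((w^-1)%g k) * W w).
Proof.
elim/adjacent_tperm_ind: w => [|i j w ij IH].
  by rewrite (hd_perm1 HD) invg1 perm1 mul1r mulr1 subrr; exact: pbw_span0.
rewrite (hd_permM HD) invMg permM tpermV.
set k' := (w^-1)%g k in IH *.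
have [z hz] := adjacent_tpermX k' ij.
have -> : W (tperm i j) * W w * P 'X_k - P 'X_(tperm i j k') * (W (tperm i j) * W w)
   = W (tperm i j) * (W w * P 'X_k - P 'X_k' * W w) + P z%:MP * W w.
  rewrite mulrBr !mulrA hz mulrDl opprD addrA.
  by rewrite addrNK.
apply: pbw_spanD; first exact: pbw_spanWl1.
by apply: pbw_span_term; rewrite msizeC; case: (z != 0).
Qed.

Lemma mdeg_mact w mu : mdeg (@mact d w mu) = mdeg mu.
Proof. exact: mdeg_mperm. Qed.

Lemma mactD w mu nu : @mact d w (mu + nu) = (mact w mu + mact w nu)%MM.
Proof. by apply/mnmP=> i; rewrite !(mnmE, mnmDE). Qed.

Lemma mact1 w k : @mact d w U_(k) = U_((w^-1)%g k)%MM.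
Proof.
apply/mnmP=> i; rewrite !(mnmE, mnm1E).
by rewrite -(inj_eq (@perm_inj _ (w^-1)%g)) permK.
Qed.

Lemma mnm_ind (Q : 'X_{1..d} -> Prop) :
  Q 0%MM -> (forall k mu, Q mu -> Q (U_(k) + mu)%MM) -> forall mu, Q mu.
Proof.
move=> Q0 QS mu; have [n] := ubnP (mdeg mu); elim: n mu => // n IH mu ltn.
have [->//|] := eqVneq mu 0%MM; rewrite -mdeg_eq0 => mu0.
have [k hk] : exists k, mu k != 0%N.
  apply/existsP; apply: contraNT mu0; rewrite negb_exists => /forallP h.
  by rewrite mdegE big1 // => i _; have := h i; rewrite negbK => /eqP.
have le : (U_(k) <= mu)%MM by rewrite lep1mP.
rewrite -(submK le) addmC; apply: QS; apply: IH.
by have := congr1 mdeg (submK le); rewrite mdegD mdeg1; lia.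
Qed.

(** Each passage of a variable costs only constant coefficients, by [perm_commX]; so in the
    associated graded ring the group just permutes the variables. *)
Lemma perm_commXm w mu :
  pbw_span (mdeg mu) (W w * P 'X_[mu] - P 'X_[mact w mu] * W w).
Proof.
elim/mnm_ind: mu w => [|k mu IH] w.
  have -> : @mact d w 0%MM = 0%MM by apply/mnmP=> i; rewrite mnmE !mnm0E.
  by rewrite mpolyX0 rmorph1 mul1r mulr1 subrr; exact: pbw_span0.
rewrite mactD mact1 !mpolyXD !rmorphM mdegD mdeg1.
set x := P 'X_(_ k); set y := P 'X_[mu].
have -> : W w * (P 'X_k * y) - x * P 'X_[mact w mu] * W w =
  (W w * P 'X_k - x * W w) * y + x * (W w * y - P 'X_[mact w mu] * W w).
  by rewrite mulrBl mulrBr !mulrA addrA addrNK.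
apply: pbw_spanD; last by rewrite -(mdeg1 ((w^-1)%g k)); apply: pbw_spanXl; exact: IH.
have := perm_commX w k; rewrite -/x; move: (_ - _).
apply: pbw_span_ind.
- by rewrite mul0r; exact: pbw_span0.
- by move=> e f he hf; rewrite mulrDl; apply: pbw_spanD.
move=> c nu v; rewrite ltnS leqn0 mdeg_eq0 => /eqP ->.
rewrite mpolyX0 rmorph1 mulr1 -mulrA; apply: pbw_spanMPl.
rewrite -[W v * y](subrK (P 'X_[mact v mu] * W v)); apply: pbw_spanD.
  exact: pbw_span_leq (IH v).
by apply: pbw_span_term; rewrite msizeX mdeg_mact.
Qed.

Lemma pbw_spanWl m w e : pbw_span m e -> pbw_span m (W w * e).
Proof.
move: e; apply: pbw_span_ind.
- by rewrite mulr0; exact: pbw_span0.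
- by move=> e f he hf; rewrite mulrDr; apply: pbw_spanD.
move=> c nu v ltm; rewrite !mulrA -(hd_central HD) -!mulrA; apply: pbw_spanMPl.
rewrite mulrA -[W w * P _](subrK (P 'X_[mact w nu] * W w)) mulrDl.
apply: pbw_spanD; first by apply/pbw_spanWr/(pbw_span_leq _ (perm_commXm w nu))/ltnW.
by rewrite -mulrA -(hd_permM HD); apply: pbw_span_term; rewrite msizeX mdeg_mact.
Qed.

Lemma pbw_spanM m n e f : pbw_span m e -> pbw_span n f -> pbw_span (m + n) (e * f).
Proof.
move=> he hf; move: e he; apply: pbw_span_ind.
- by rewrite mul0r; exact: pbw_span0.
- by move=> e g he hg; rewrite mulrDl; apply: pbw_spanD.
move=> c nu v ltm; rewrite -!mulrA; apply: pbw_spanMPl.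
apply: pbw_span_leq (pbw_spanXl _ (pbw_spanWl v hf)).
by rewrite leq_add2r ltnW.
Qed.

End Span.

Definition basis_index (d l : nat) : finType := ({ffun 'I_d -> 'I_l} * 'S_d)%type.

Definition expo (d l : nat) (a : {ffun 'I_d -> 'I_l}) : 'X_{1..d} :=
  [multinom (a i : nat) | i < d].

Lemma card_basis_index d l : #|basis_index d l| = (l ^ d * d`!)%N.
Proof. by rewrite card_prod card_ffun !card_ord card_Sn. Qed.

Definition cyclo (R : comNzRingType) (d l : nat) (hd : (0 < d)%N) (q : 'I_l -> R) :
    {mpoly R[d]} := \prod_(r < l) ('X_(Ordinal hd) - (q r)%:MP).

Lemma msizeM_leq (R : nzRingType) n (p q : {mpoly R[n]}) :
  (msize (p * q) <= (msize p + msize q).-1)%N.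
Proof.
rewrite [X in (X <= _)%N]msizeE big_seq; apply/bigmax_leqP_seq => m ms _.
have /allpairsP [[m1 m2] /= [/msize_mdeg_lt h1 /msize_mdeg_lt h2 ->]] := msuppM_le ms.
by rewrite mdegD; lia.
Qed.

Lemma cyclo_lead (R : comNzRingType) (d l : nat) (hd : (0 < d)%N) (q : 'I_l -> R) :
  (msize (cyclo hd q - 'X_(Ordinal hd) ^+ l) <= l)%N.
Proof.
rewrite /cyclo; set x := 'X_(Ordinal hd).
rewrite -(big_map q xpredT (fun c => x - c%:MP)).
have sz : size [seq q i | i <- index_enum 'I_l] = l.
  by rewrite size_map [index_enum _]unlock -enumT size_enum_ord.
rewrite -[in X in _ ^+ X]sz -[in X in (_ <= X)%N]sz.
elim: [seq _ | _ <- _] => [|c s IH]; first by rewrite big_nil expr0 subrr mmeasure0.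
rewrite big_cons /= exprS.
set Q := \prod_(_ <- _) _ in IH *; set n := size s in IH *.
have -> : (x - c%:MP) * Q - x * x ^+ n = (x - c%:MP) * (Q - x ^+ n) - c *: x ^+ n.
  rewrite -mul_mpolyC; ring.
have sx : (msize (x ^+ n) <= n.+1)%N.
  by rewrite mpolyXn msizeX mdegMn mdeg1 mul1n.
rewrite (leq_trans (msizeD_le _ _)) // geq_max msizeN.
rewrite (leq_trans (mmeasureZ_le _ _ _)) // andbT.
rewrite (leq_trans (msizeM_leq _ _)) //.
have : (msize (x - c%:MP) <= 2)%N.
  rewrite (leq_trans (msizeD_le _ _)) // geq_max msizeN msizeX mdeg1 msizeC.
  by case: (c != 0).
by move: (msize _) (msize _) IH => u v; lia.
Qed.

(** * Straightening to exponents less than l *)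

Section Reduced.
Variables (R : comNzRingType) (E : pzRingType) (d l : nat).
Variables (P : {rmorphism {mpoly R[d]} -> E}) (W : 'S_d -> E).
Hypothesis HD : hecke_datum P W.
Variables (hd : (0 < d)%N) (q : 'I_l -> R).
Hypothesis Pq : P (cyclo hd q) = 0.

Local Notation B := (basis_index d l).

Definition bas (b : B) : E := P 'X_[expo b.1] * W b.2.

Definition bdeg (b : B) : nat := mdeg (expo b.1).

Definition lincomb (c : {ffun B -> R}) : E := \sum_b P (c b)%:MP * bas b.

Definition red_span (m : nat) (e : E) : Prop :=
  exists2 c : {ffun B -> R}, (forall b, c b != 0 -> (bdeg b < m)%N) & e = lincomb c.

Lemma lincombD c c' : lincomb (c + c') = lincomb c + lincomb c'.
Proof.
rewrite -big_split; apply: eq_bigr => b _.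
by rewrite ffunE mpolyCD rmorphD mulrDl.
Qed.

Lemma lincomb0 : lincomb 0 = 0.
Proof. by apply: big1 => b _; rewrite ffunE mpolyC0 rmorph0 mul0r. Qed.

Lemma lincombZ r (c : {ffun B -> R}) : lincomb [ffun b => r * c b] = P r%:MP * lincomb c.
Proof.
rewrite mulr_sumr; apply: eq_bigr => b _.
by rewrite ffunE mpolyCM rmorphM mulrA.
Qed.

Lemma lincombB c c' : lincomb (c - c') = lincomb c - lincomb c'.
Proof. by apply/eqP; rewrite eq_sym subr_eq -lincombD subrK. Qed.

Lemma lincomb_delta b : lincomb [ffun b' => (b' == b)%:R] = bas b.
Proof.
rewrite /lincomb (bigD1 b) //= ffunE eqxx mpolyC1 rmorph1 mul1r.
by rewrite big1 ?addr0 // => b' /negbTE nb; rewrite ffunE nb mpolyC0 rmorph0 mul0r.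
Qed.

Lemma red_span_pbw m e : red_span m e -> pbw_span P W m e.
Proof.
move=> [c hc ->]; apply: pbw_span_sum => b _.
have [->|/hc lt] := eqVneq (c b) 0.
  by rewrite mpolyC0 rmorph0 mul0r; exact: pbw_span0.
by apply: pbw_spanMPl; apply: pbw_span_term; rewrite msizeX.
Qed.

(** The cyclotomic relation lowers the degree of x_1^l; conjugation by the transposition of [k] and
    the first index carries this over to x_k^l, again up to lower degree. *)
Lemma pbw_span_pow (k : 'I_d) : pbw_span P W l (P ('X_k ^+ l)).
Proof.
have h0 : pbw_span P W l (P ('X_(Ordinal hd) ^+ l)).
  have -> : P ('X_(Ordinal hd) ^+ l) = - (P (cyclo hd q - 'X_(Ordinal hd) ^+ l) * W 1%g).
    by rewrite (hd_perm1 HD) mulr1 rmorphB Pq sub0r opprK.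
  by apply/pbw_spanN/pbw_span_term/cyclo_lead.
pose w := tperm k (Ordinal hd).
have := perm_commXm HD w (U_(Ordinal hd) *+ l)%MM.
rewrite mdegMn mdeg1 mul1n.
have -> : mact w (U_(Ordinal hd) *+ l)%MM = (U_(k) *+ l)%MM.
  apply/mnmP=> i; rewrite mnmE !mulmnE !mnm1E; congr ((_ : bool) * _)%N.
  by rewrite -[RHS](inj_eq (@perm_inj _ w)) tpermL.
rewrite -!mpolyXn => h.
have -> : P ('X_k ^+ l) = - ((W w * P ('X_(Ordinal hd) ^+ l) - P ('X_k ^+ l) * W w) * W w)
   + W w * P ('X_(Ordinal hd) ^+ l) * W w.
  rewrite -mulNr -mulrDl opprB subrK -mulrA -(hd_permM HD) tperm2 (hd_perm1 HD).
  by rewrite mulr1.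
apply: pbw_spanD; first by apply/pbw_spanN/(pbw_spanWr HD).
by apply/(pbw_spanWr HD)/(pbw_spanWl HD).
Qed.

Lemma pbw_span_nonreduced (mu : 'X_{1..d}) w k : (l <= mu k)%N ->
  pbw_span P W (mdeg mu) (P 'X_[mu] * W w).
Proof.
move=> lk; have le2 : (U_(k) *+ l <= mu)%MM.
  apply/mnm_lepP => i; rewrite mulmnE mnm1E.
  by case: eqP => [<-|_]; rewrite ?mul1n ?mul0n.
have dm := congr1 mdeg (submK le2); rewrite mdegD mdegMn mdeg1 mul1n in dm.
rewrite -dm -(submK le2) mpolyXD rmorphM -mpolyXn -mulrA.
rewrite submK //; apply: (pbw_spanXl HD); apply: (pbw_spanWr HD); exact: pbw_span_pow.
Qed.

Lemma red_span0 m : red_span m 0.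
Proof. by exists 0; rewrite ?lincomb0 // => b; rewrite ffunE eqxx. Qed.

Lemma red_spanD m e f : red_span m e -> red_span m f -> red_span m (e + f).
Proof.
move=> [c hc ->] [c' hc' ->]; exists (c + c'); last by rewrite lincombD.
move=> b; rewrite ffunE; have [z|/hc //] := eqVneq (c b) 0.
by rewrite z add0r => /hc'.
Qed.

Lemma red_spanMPl m r e : red_span m e -> red_span m (P r%:MP * e).
Proof.
move=> [c hc ->]; exists [ffun b => r * c b]; last by rewrite lincombZ.
move=> b; rewrite ffunE => nz; apply: hc; apply: contraNneq nz => ->.
by rewrite mulr0.
Qed.

Lemma red_spanW m n e : (m <= n)%N -> red_span m e -> red_span n e.
Proof. by move=> mn [c hc ->]; exists c => // b /hc lt; apply: leq_trans mn. Qed.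

Lemma red_span_bas b : red_span (bdeg b).+1 (bas b).
Proof.
exists [ffun b' => (b' == b)%:R]; last by rewrite lincomb_delta.
by move=> b'; rewrite ffunE; have [->|_] := eqVneq b' b; rewrite ?eqxx.
Qed.

(* A monomial with an exponent [>= l] is rewritten into monomials of smaller degree
   by means of the conjugates of the cyclotomic relation. *)
Lemma pbw_span_red m e : pbw_span P W m e -> red_span m e.
Proof.
elim: m e => [|m IH] e.
  move: e; apply: pbw_span_ind => //; first exact: red_span0.
  by move=> e f; exact: red_spanD.
move: e; apply: pbw_span_ind => //; first exact: red_span0.
  by move=> e f; exact: red_spanD.
move=> c mu w; rewrite ltnS => le; rewrite -mulrA; apply: red_spanMPl.
have [/forallP lt|] := boolP [forall k, mu k < l]%N.
  pose a := [ffun k => Ordinal (lt k)].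
  have -> : P 'X_[mu] * W w = bas (a, w).
    congr (P 'X_[_] * _); apply/mnmP=> k.
    by rewrite mnmE ffunE.
  apply: red_spanW (red_span_bas _); rewrite ltnS.
  suff -> : bdeg (a, w) = mdeg mu by [].
  by rewrite /bdeg; congr mdeg; apply/mnmP=> k; rewrite mnmE ffunE.
rewrite negb_forall => /existsP[k]; rewrite -leqNgt => lk.
apply: red_spanW (leqnSn m) _; apply: IH.
by apply: pbw_span_leq le _; apply: pbw_span_nonreduced lk.
Qed.

(** By [reducibleP] this is the union of the filtration, hence closed under products. *)
Definition reducible (e : E) : Prop := exists c, e = lincomb c.

Lemma reducibleP e : reducible e <-> exists m, pbw_span P W m e.
Proof.
split=> [[c ->]|[m /pbw_span_red [c _ ->]]]; last by exists c.
exists (\max_b (bdeg b)).+1; apply: red_span_pbw; exists c => // b _.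
by rewrite ltnS; apply: leq_bigmax.
Qed.

Lemma reducible0 : reducible 0.
Proof. by exists 0; rewrite lincomb0. Qed.

Lemma reducibleD e f : reducible e -> reducible f -> reducible (e + f).
Proof. by move=> [c ->] [c' ->]; exists (c + c'); rewrite lincombD. Qed.

Lemma reducibleB e f : reducible e -> reducible f -> reducible (e - f).
Proof. by move=> [c ->] [c' ->]; exists (c - c'); rewrite lincombB. Qed.

Lemma reducibleM e f : reducible e -> reducible f -> reducible (e * f).
Proof.
move=> /reducibleP[m he] /reducibleP[n hf]; apply/reducibleP; exists (m + n)%N.
exact: (pbw_spanM HD).
Qed.

Lemma reducible_term p w : reducible (P p * W w).
Proof. by apply/reducibleP; exists (msize p); apply: pbw_span_term. Qed.

Lemma reducible_pol p : reducible (P p).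
Proof. by have := reducible_term p 1%g; rewrite (hd_perm1 HD) mulr1. Qed.

Lemma reducible_perm w : reducible (W w).
Proof. by have := reducible_term 1 w; rewrite rmorph1 mul1r. Qed.

Lemma reducible_sum (I : Type) (r : seq I) (Q : pred I) (G : I -> E) :
  (forall i, Q i -> reducible (G i)) -> reducible (\sum_(i <- r | Q i) G i).
Proof. by move=> h; elim/big_ind: _ => //; [exact: reducible0|exact: reducibleD]. Qed.

End Reduced.

(** * Central elements and cycle types *)

(* The relations satisfied by the coefficients of the top degree part of a central
   element: one unit of exponent may be moved along the cycles of the permutation, and
   the coefficients are invariant under simultaneous conjugation. *)
Record central_symbol (R : zmodType) (d l : nat) (c : basis_index d l -> R) : Prop := {
  cs_move : forall (a a' : {ffun 'I_d -> 'I_l}) (w : 'S_d) j,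
    (forall i, a' i + (i == w j) = a i + (i == j))%N -> c (a, w) = c (a', w);
  cs_vanish : forall (a : {ffun 'I_d -> 'I_l}) (w : 'S_d) j,
    j != w j -> ((a j).+1 < l)%N -> a (w j) = 0%N :> nat -> c (a, w) = 0;
  cs_conj : forall (a : {ffun 'I_d -> 'I_l}) (w v : 'S_d),
    c (a, w) = c ([ffun i => a ((v^-1)%g i)], (v^-1 * w * v)%g)
}.

(** * The top degree part of a central element *)

Section TopDegree.
Variables (R : comNzRingType) (E : pzRingType) (d l : nat).
Variables (P : {rmorphism {mpoly R[d]} -> E}) (W : 'S_d -> E).
Hypothesis HD : hecke_datum P W.
Variables (hd : (0 < d)%N) (q : 'I_l -> R).
Hypothesis Pq : P (cyclo hd q) = 0.
Local Notation B := (basis_index d l).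
Local Notation lc := (lincomb (l := l) P W).
(** A coordinate function, arbitrary outside the span; therefore reducibility accompanies the rules
    for sums below. *)
Variable co : E -> {ffun B -> R}.
Hypothesis coK : forall c, co (lc c) = c.

Lemma coD e f : reducible l P W e -> reducible l P W f -> co (e + f) = co e + co f.
Proof. by move=> [c ->] [c' ->]; rewrite -lincombD !coK. Qed.

Lemma coB e f : reducible l P W e -> reducible l P W f -> co (e - f) = co e - co f.
Proof. by move=> [c ->] [c' ->]; rewrite -lincombB !coK. Qed.

Lemma co_lincomb (c : {ffun B -> R}) (G : B -> E) b :
  (forall b', reducible l P W (G b')) ->
  co (\sum_b' P (c b')%:MP * G b') b = \sum_b' c b' * co (G b') b.
Proof.
move=> hG; suff [_ ->] : reducible l P W (\sum_b' P (c b')%:MP * G b') /\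
   co (\sum_b' P (c b')%:MP * G b') b = \sum_b' c b' * co (G b') b by [].
elim/big_rec2: _ => [|b' e y _ [ry hy]].
  split; first exact: reducible0.
  by rewrite -(lincomb0 l P W) coK ffunE.
have [c' hc'] := hG b'.
have rG : reducible l P W (P (c b')%:MP * G b').
  by exists [ffun b => c b' * c' b]; rewrite lincombZ -hc'.
split; first exact: reducibleD.
rewrite coD // ffunE hy; congr (_ + _).
by rewrite hc' -lincombZ !coK ffunE.
Qed.

Lemma co_small m e (b : B) : pbw_span P W m e -> (m <= bdeg b)%N -> co e b = 0.
Proof.
move=> /(pbw_span_red HD Pq) [c hc ->] mb; rewrite coK.
by apply/eqP; apply: contraTT mb => /hc; rewrite -ltnNge.
Qed.

Lemma co_bas b : co (bas P W b) = [ffun b' => (b' == b)%:R].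
Proof. by rewrite -lincomb_delta coK. Qed.

Lemma expo_inj : injective (@expo d l).
Proof.
move=> a a' /mnmP h; apply/ffunP => i; apply/val_inj.
by have := h i; rewrite !mnmE.
Qed.

(** A monomial that is not reduced straightens into lower degree, so it leaves no trace in its own
    degree. *)
Lemma co_monom mu w (b : B) : (mdeg mu <= bdeg b)%N ->
  co (P 'X_[mu] * W w) b = ((expo b.1 == mu) && (b.2 == w))%:R.
Proof.
move=> mb; have [/forallP lt|] := boolP [forall k, mu k < l]%N.
  pose a := [ffun k => Ordinal (lt k)].
  have mua : mu = expo a by apply/mnmP => k; rewrite mnmE ffunE.
  rewrite {1}mua (co_bas (a, w)) ffunE -pair_eqE /= /pair_eq /=.
  by rewrite mua (inj_eq expo_inj).
rewrite negb_forall => /existsP[k]; rewrite -leqNgt => lk.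
rewrite (co_small (pbw_span_nonreduced HD Pq w lk)) //.
case: eqP => //= mub; exfalso; move: lk; rewrite -mub mnmE.
by rewrite leqNgt ltn_ord.
Qed.

Lemma reducible_bas (b : B) : reducible l P W (bas P W b).
Proof. by exists [ffun b' => (b' == b)%:R]; rewrite lincomb_delta. Qed.

Section Central.
Variables (c : {ffun B -> R}) (m : nat).
Hypothesis cX : forall k, P 'X_k * lc c = lc c * P 'X_k.
Hypothesis cW : forall w, W w * lc c = lc c * W w.
Hypothesis cm : forall b, c b != 0 -> (bdeg b <= m)%N.

(** Both sides of x_k z = z x_k are compared in degree m + 1. On the right, x_k reaches the left of
    the permutation w as x_(w^-1 k). *)
Lemma central_topX k (b : B) : bdeg b = m.+1 ->
  \sum_b' c b' * ((expo b.1 == U_(k) + expo b'.1)%MM && (b.2 == b'.2))%:R =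
  \sum_b' c b' * ((expo b.1 == U_((b'.2^-1)%g k) + expo b'.1)%MM && (b.2 == b'.2))%:R.
Proof.
move=> bm; have := congr1 (fun e => co e b) (cX k); rewrite /lincomb mulr_sumr mulr_suml.
under eq_bigr => b' _ do rewrite mulrA -(hd_central HD) -mulrA.
under [X in _ = co X b -> _]eq_bigr => b' _ do rewrite -mulrA.
have rX j : reducible l P W (P 'X_j) by exact: (reducible_pol HD Pq).
rewrite !co_lincomb; first last.
- by move=> b'; apply: (reducibleM HD Pq) => //; exact: reducible_bas.
- by move=> b'; apply: (reducibleM HD Pq) => //; exact: reducible_bas.
move=> hh; have h : forall b' (e : E) mu w,
  pbw_span P W m.+1 (e - P 'X_[mu] * W w) -> reducible l P W e ->
  (mdeg mu <= m.+1)%N -> c b' * co e b = c b' * ((expo b.1 == mu) && (b.2 == w))%:R.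
  move=> b' e mu w he re le; congr (_ * _).
  rewrite -co_monom ?bm //; apply/eqP; rewrite -subr_eq0.
  have := @co_small _ _ b he; rewrite bm => /(_ (leqnn _)).
  rewrite coB //; last exact: (reducible_term HD Pq).
  by rewrite !ffunE => ->.
rewrite (_ : \sum_b' _ = \sum_b' c b' * co (P 'X_k * bas P W b') b); last first.
  apply: eq_bigr => b' _; have [->|/cm le] := eqVneq (c b') 0; first by rewrite !mul0r.
  rewrite (h b' _ (U_(k) + expo b'.1)%MM b'.2) //.
  - by rewrite /bas mpolyXD rmorphM mulrA subrr; exact: pbw_span0.
  - by apply: (reducibleM HD Pq) => //; exact: reducible_bas.
  by rewrite mdegD mdeg1 add1n ltnS.
rewrite hh; apply: eq_bigr => b' _.
have [->|/cm le] := eqVneq (c b') 0; first by rewrite !mul0r.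
rewrite (h b' _ (U_((b'.2^-1)%g k) + expo b'.1)%MM b'.2) //.
- rewrite /bas addmC mpolyXD rmorphM -!mulrA -mulrBr.
  apply: pbw_span_leq (pbw_spanXl HD _ (perm_commX HD _ _)).
  by rewrite addn1 ltnS.
- by apply: (reducibleM HD Pq) => //; exact: reducible_bas.
by rewrite mdegD mdeg1 add1n ltnS.
Qed.

(** The coordinates of both sides of [W v] z = z [W v] are compared at the basis element with
    exponents [a] and permutation [w * v]. *)
Lemma central_topW (a : {ffun 'I_d -> 'I_l}) (w v : 'S_d) : bdeg (a, w) = m ->
  c (a, w) = c ([ffun i => a ((v^-1)%g i)], (v^-1 * w * v)%g).
Proof.
move=> bm; pose b : B := (a, (w * v)%g).
have := congr1 (fun e => co e b) (cW v); rewrite /lincomb mulr_sumr mulr_suml.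
under eq_bigr => b' _ do rewrite mulrA -(hd_central HD) -mulrA.
under [X in _ = co X b -> _]eq_bigr => b' _ do rewrite -mulrA.
have rW u : reducible l P W (W u) by exact: (reducible_perm HD Pq).
have rbW (b' : B) u : reducible l P W (bas P W b' * W u).
  by apply: (reducibleM HD Pq) => //; exact: reducible_bas.
have rWb (b' : B) u : reducible l P W (W u * bas P W b').
  by apply: (reducibleM HD Pq) => //; exact: reducible_bas.
rewrite !co_lincomb // => h.
have {h} : \sum_b' c b' * ((expo b.1 == mact v (expo b'.1)) && (b.2 == v * b'.2)%g)%:R =
   \sum_b' c b' * ((expo b.1 == expo b'.1) && (b.2 == b'.2 * v)%g)%:R.
  transitivity (\sum_b' c b' * co (W v * bas P W b') b).
    apply: eq_bigr => b' _; have [->|/cm le] := eqVneq (c b') 0; first by rewrite !mul0r.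
    congr (_ * _); rewrite -co_monom; last by rewrite mdeg_mact [bdeg b]bm.
    apply/esym/eqP; rewrite -subr_eq0.
    have -> : P 'X_[mact v (expo b'.1)] * W (v * b'.2)%g =
       W v * bas P W b' - (W v * P 'X_[expo b'.1] - P 'X_[mact v (expo b'.1)] * W v) * W b'.2.
      by rewrite mulrBl /bas (hd_permM HD) !mulrA opprB addrC subrK.
    set e := (_ - _) * _.
    have se : pbw_span P W m e.
      by apply: (pbw_spanWr HD); apply: pbw_span_leq (perm_commXm HD _ _).
    have re : reducible l P W e by apply/(reducibleP HD Pq); exists m.
    have e0 : co e b = 0 by apply: co_small se _; rewrite [bdeg b]bm.
    by rewrite coB // !ffunE e0 subr0 subrr.
  rewrite h; apply: eq_bigr => b' _; have [->|/cm le] := eqVneq (c b') 0.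
    by rewrite !mul0r.
  by rewrite /bas -mulrA -(hd_permM HD) co_monom // [bdeg b]bm.
pose b1 : B := ([ffun i => a ((v^-1)%g i)], (v^-1 * w * v)%g).
rewrite (bigD1 b1) //= big1 ?addr0; last first.
  case=> a' w' nb /=; case: eqP => //= ha; last by rewrite mulr0.
  case: eqP => //= hw; last by rewrite mulr0.
  case/negP: nb; rewrite -pair_eqE /= /pair_eq /= -!mulgA hw mulKg eqxx andbT.
  apply/eqP/ffunP => i; rewrite ffunE; apply: val_inj => /=.
  by have /mnmP/(_ ((v^-1)%g i)) := ha; rewrite !mnmE permKV => ->.
rewrite !mulgA mulgV mul1g eqxx andbT.
have -> : expo a == mact v (expo [ffun i => a ((v^-1)%g i)]).
  by apply/eqP/mnmP => i; rewrite !mnmE ffunE permK.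
rewrite mulr1 => ->; rewrite (bigD1 (a, w)) //= !eqxx mulr1 big1 ?addr0 //.
case=> a' w' nb /=; case: eqP => [/expo_inj ha|_]; last by rewrite mulr0.
case: eqP => [/mulIg hw|_]; last by rewrite mulr0.
by move: nb; rewrite ha hw eqxx.
Qed.

Lemma bdegE (a : {ffun 'I_d -> 'I_l}) w : bdeg (a, w) = (\sum_i a i)%N.
Proof. by rewrite /bdeg mdegE; apply: eq_bigr => i _; rewrite mnmE. Qed.

Lemma top_symbolP : central_symbol (fun b => if bdeg b == m then c b else 0).
Proof.
(* The relation [central_topX] for k = w j, at x_j x^a: one side is the single coefficient at (a,
   w), the other runs over the a' with x_j x^a = x_(w j) x^a'. The bound on [a j] keeps x_j x^a
   reduced. *)
have key (a : {ffun 'I_d -> 'I_l}) (w : 'S_d) j (lt : ((a j).+1 < l)%N) : bdeg (a, w) = m ->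
  c (a, w) = \sum_b' c b' * ((U_(j) + expo a == U_(w j) + expo b'.1)%MM && (w == b'.2))%:R.
  move=> am; pose a' := [ffun i => if i == j then Ordinal lt else a i].
  have ea' : expo a' = (U_(j) + expo a)%MM.
    by apply/mnmP => i; rewrite mnmDE !mnmE ffunE eq_sym; case: ifP => [/eqP <-|_] /=; rewrite ?add1n.
  have bm : bdeg (a', w) = m.+1 by rewrite /bdeg /= ea' mdegD mdeg1 -am.
  rewrite -ea' (central_topX (w j) bm) /=.
  rewrite (bigD1 (a, w)) //= permK ea' !eqxx mulr1 big1 ?addr0 // => -[a1 w1] /= nb.
  have [ww|_] := eqVneq w w1; last by rewrite andbF mulr0.
  rewrite -ww permK eqm_add2l (inj_eq expo_inj).
  by case: eqP => [aa|_]; [case/eqP: nb; rewrite -aa ww | rewrite mulr0].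
split=> [a a' w j h|a w j jw lt a0|a w v].
- have [jw|jw] := eqVneq j (w j).
    suff -> : a' = a by [].
    by apply/ffunP => i; apply/val_inj; have := h i; rewrite -jw => /addIn.
  have -> : bdeg (a', w) = bdeg (a, w).
    rewrite !bdegE; have : (\sum_i (a' i + (i == w j)) = \sum_i (a i + (i == j)))%N.
      by apply: eq_bigr => i _; exact: h.
    rewrite !big_split /=.
    have s1 (k : 'I_d) : (\sum_(i < d) (i == k) = 1)%N.
      by rewrite (bigD1 k) //= eqxx big1 // => i /negbTE ->.
    by rewrite !s1 => /addIn.
  case: eqP => // am; have lt : ((a j).+1 < l)%N.
    have := h j; rewrite (negbTE jw) eqxx addn0 addn1 => <-.
    exact: ltn_ord.
  rewrite (key _ _ _ lt am) (bigD1 (a', w)) //= eqxx andbT.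
  have e : (U_(j) + expo a == U_(w j) + expo a')%MM.
    apply/eqP/mnmP => i; rewrite !mnmDE !mnmE ![_ == i]eq_sym addnC -h addnC.
    by rewrite eq_sym.
  rewrite e mulr1 big1 ?addr0 // => -[a1 w1] /= nb.
  have [ww|_] := eqVneq w w1; last by rewrite andbF mulr0.
  rewrite (eqP e) eqm_add2l (inj_eq expo_inj).
  by case: eqP => [aa|_]; [case/eqP: nb; rewrite -aa ww | rewrite mulr0].
- case: eqP => // am; rewrite (key _ _ _ lt am) big1 // => -[a1 w1] _ /=.
  case: eqP => [/mnmP/(_ (w j))|]; last by rewrite mulr0.
  by rewrite !mnmDE !mnmE a0 (negbTE jw) eqxx.
have -> : bdeg ([ffun i => a ((v^-1)%g i)], (v^-1 * w * v)%g) = bdeg (a, w).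
  rewrite !bdegE (reindex_inj (@perm_inj _ v)) /=; apply: eq_bigr => i _.
  by rewrite ffunE permK.
by case: eqP => // am; apply: central_topW.
Qed.
End Central.
End TopDegree.

(** * Exponents along the cycles of a permutation *)

Section Cycles.
Variables (d l : nat).
Implicit Types (a : {ffun 'I_d -> 'I_l}) (w v : 'S_d).

Definition deficit a i : nat := (l.-1 - a i)%N.

(** Invariant under the moves. Where the coefficient is nonzero it turns out to be less than l, so
    it can name the component of a multipartition to which the cycle contributes its length. *)
Definition cycle_deficit a w i : nat := (\sum_(x | fconnect w i x) deficit a x)%N.

Lemma deficitK a i : (deficit a i + a i)%N = l.-1.
Proof. by rewrite /deficit subnK // -ltnS prednK ?ltn_ord //; case: l a => [a|//]; case: (a i). Qed.

Lemma perm_fconnect_sym w : connect_sym (frel w).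
Proof. exact/fconnect_sym/perm_inj. Qed.

(** Makes the potential of [symbol_concentrate] decrease. *)
Lemma findex_step w i : i != froot w i ->
  (findex w (w i) (froot w i) < findex w i (froot w i))%N.
Proof.
move=> ir; have cr : fconnect w i (froot w i) by exact: connect_root.
have lt := findex_max cr; have it := iter_findex cr.
case E: (findex w i (froot w i)) it lt => [|n] it lt.
  by rewrite /= in it; rewrite {1}it eqxx in ir.
rewrite iterSr in it; rewrite -{1}it findex_iter ?leqnn //.
suff -> : fingraph.order w (w i) = fingraph.order w i by exact: ltn_trans lt.
apply: eq_card => x; rewrite !inE; apply/esym/same_connect => //.
  exact: perm_fconnect_sym.
exact: fconnect1.
Qed.

Section Symbol.
Variables (R : zmodType) (c : basis_index d l -> R).
Hypothesis cs : central_symbol c.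

(** A unit of deficit at i moves on to w i, towards the root of the cycle; the potential is the
    total way still to go. Only a zero exponent at w i blocks the move. Then the deficit is l - 1 at
    w i and at least 1 at i, and the coefficient vanishes by [cs_vanish]. *)
Lemma symbol_concentrate a w :
  (c (a, w) = 0 /\ exists i, (l <= cycle_deficit a w i)%N) \/
  exists a', [/\ c (a', w) = c (a, w), cycle_deficit a' w =1 cycle_deficit a w
    & forall i, i != froot w i -> deficit a' i = 0%N].
Proof.
pose pot a := (\sum_i deficit a i * findex w i (froot w i))%N.
have [n] := ubnP (pot a); elim: n a => // n IH a; rewrite ltnS => le.
have [/forallP h|] := boolP [forall i, (i != froot w i) ==> (deficit a i == 0)]%N.
  by right; exists a; split=> // i /(implyP (h i))/eqP.
rewrite negb_forall => /existsP [i]; rewrite negb_imply -lt0n => /andP[ir di].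
have iw : i != w i.
  apply: contraNneq ir => iw; apply/eqP.
  have /iter_findex <- : fconnect w i (froot w i) by exact: connect_root.
  by elim: (findex _ _ _) => //= k <-.
have cwi : fconnect w i (w i) by exact: fconnect1.
have := deficitK a i => Ki.
have [a0|a0] := posnP (a (w i)).
  left; split; first by apply: (cs_vanish cs) iw _ a0; lia.
  exists i; rewrite /cycle_deficit (bigD1 i) ?connect0 //= (bigD1 (w i)) /=; last first.
    by rewrite cwi eq_sym.
  by have := deficitK a (w i); rewrite a0; lia.
have lt : ((a i).+1 < l)%N by lia.
have lt' : ((a (w i)).-1 < l)%N by have := ltn_ord (a (w i)); lia.
pose a' := [ffun x => if x == i then Ordinal lt else if x == w i then Ordinal lt' else a x].
have ha' x : (a' x + (x == w i) = a x + (x == i))%N.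
  rewrite ffunE; have [->|xi] := eqVneq x i; first by rewrite (negbTE iw) /=; lia.
  by have [->|xw] := eqVneq x (w i) => /=; lia.
have da' x : (deficit a' x + (x == i) = deficit a x + (x == w i))%N.
  have := ha' x; have := deficitK a' x; have := deficitK a x.
  move: (deficit a' x) (deficit a x) (nat_of_ord (a' x)) (nat_of_ord (a x)) => D1 D2 A1 A2.
  by move: (nat_of_bool (x == i)) (nat_of_bool (x == w i)); lia.
have cd : cycle_deficit a' w =1 cycle_deficit a w.
  move=> j; have : (\sum_(x | fconnect w j x) (deficit a' x + (x == i)) =
     \sum_(x | fconnect w j x) (deficit a x + (x == w i)))%N.
    by apply: eq_bigr => x _; exact: da'.
  rewrite !big_split /=.
  have s1 (k : 'I_d) : (\sum_(x | fconnect w j x) (x == k) = fconnect w j k)%N.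
    have [ck|nk] := boolP (fconnect w j k).
      by rewrite (bigD1 k) //= eqxx big1 // => x /andP[_ /negbTE ->].
    by rewrite big1 // => x cx; case: eqP => // xk; rewrite -xk cx in nk.
  rewrite !s1 (_ : fconnect w j (w i) = fconnect w j i) => [/addIn //|].
  rewrite ![fconnect w j _]perm_fconnect_sym.
  apply/esym/same_connect => //; exact: perm_fconnect_sym.
have pa : (pot a' < n)%N.
  apply: leq_trans le.
  have : (\sum_x (deficit a' x + (x == i)) * findex w x (froot w x) =
     \sum_x (deficit a x + (x == w i)) * findex w x (froot w x))%N.
    by apply: eq_bigr => x _; rewrite da'.
  under eq_bigr do rewrite mulnDl; under [X in _ = X -> _]eq_bigr do rewrite mulnDl.
  rewrite !big_split /= -/(pot a) -/(pot a').
  have s1 (k : 'I_d) : (\sum_x (x == k) * findex w x (froot w x) = findex w k (froot w k))%N.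
    by rewrite (bigD1 k) //= eqxx mul1n big1 ?addn0 // => x /negbTE ->.
  rewrite !s1; have := findex_step ir.
  have <- : froot w i = froot w (w i) by apply/eqP; rewrite (root_connect (perm_fconnect_sym w)).
  by move: (pot a) (pot a') => u u'; lia.
have cc : c (a', w) = c (a, w) by rewrite (cs_move cs (a' := a') (j := i)).
case: (IH a' pa) => [[c0 [j hj]]|[a1 [h1 h2 h3]]].
  by left; split; [rewrite -cc|exists j; rewrite -cd].
by right; exists a1; split => // [|j]; [rewrite h1|rewrite h2 cd].
Qed.

Lemma symbol_deficit a w : c (a, w) != 0 -> forall i, (cycle_deficit a w i < l)%N.
Proof.
move=> nz i; case: (symbol_concentrate a w) => [[c0 _]|[a' [_ cd h]]].
  by rewrite c0 eqxx in nz.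
rewrite -cd /cycle_deficit.
rewrite (bigD1 (froot w i)) /=; last exact: connect_root.
rewrite big1 ?addn0 => [|x /andP[ix xr]]; last first.
  apply: h; apply: contraNneq xr => ->.
  by rewrite (root_connect (perm_fconnect_sym w)) (perm_fconnect_sym w).
by have := ltn_ord (a' i); rewrite /deficit; move: (nat_of_ord (a' (froot w i))) (nat_of_ord (a' i)) => x y; lia.
Qed.

(** Once all deficit sits at the roots, the exponents are determined by the deficits of the
    cycles. *)
Lemma symbol_eq_deficit a a' w : cycle_deficit a w =1 cycle_deficit a' w ->
  (forall i, (cycle_deficit a w i < l)%N) -> c (a, w) = c (a', w).
Proof.
move=> cd lt; case: (symbol_concentrate a w) => [[_ [i]]|[a1 [<- cd1 h1]]].
  by rewrite leqNgt lt.
case: (symbol_concentrate a' w) => [[_ [i]]|[a2 [<- cd2 h2]]].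
  by rewrite leqNgt -cd lt.
congr (c (_, w)); apply/ffunP => i; apply/val_inj/eqP => /=.
suff h : deficit a1 i = deficit a2 i.
  by have := deficitK a1 i; rewrite h -(deficitK a2 i) => /addnI ->.
have [ir|ir] := eqVneq i (froot w i); last by rewrite h1 // h2.
have hc b : (forall i, i != froot w i -> deficit b i = 0%N) ->
    cycle_deficit b w i = deficit b i.
  move=> hb; rewrite /cycle_deficit (bigD1 i) ?connect0 //= big1 ?addn0 // => x /andP[ix xi].
  by apply: hb; apply: contraNneq xi => ->; rewrite {1}ir (root_connect (perm_fconnect_sym w)) (perm_fconnect_sym w).
by rewrite -!hc // cd1 cd2.
Qed.

Lemma fconnect_conj w1 w2 v i x : (forall i, v (w1 i) = w2 (v i)) ->
  fconnect w2 (v i) (v x) = fconnect w1 i x.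
Proof.
move=> h; have it n y : v (iter n w1 y) = iter n w2 (v y).
  by elim: n => //= n IH; rewrite h IH.
apply/idP/idP => [/iter_findex|/iter_findex <-]; last by rewrite it fconnect_iter.
by rewrite -it => /perm_inj <-; rewrite fconnect_iter.
Qed.

Lemma symbol_iso a1 w1 a2 w2 v : (forall i, v (w1 i) = w2 (v i)) ->
  (forall i, cycle_deficit a1 w1 i = cycle_deficit a2 w2 (v i)) ->
  (forall i, (cycle_deficit a1 w1 i < l)%N) -> c (a1, w1) = c (a2, w2).
Proof.
move=> h cd lt; rewrite (cs_conj cs a1 w1 v).
have -> : (v^-1 * w1 * v)%g = w2.
  by apply/permP => i; rewrite !permM h permKV.
have cd' i : cycle_deficit [ffun i => a1 (v^-1%g i)] w2 i = cycle_deficit a2 w2 i.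
  rewrite -{2}[i](permKV v) -cd /cycle_deficit (reindex_inj (@perm_inj _ v)) /=.
  apply: eq_big => [x|x _]; last by rewrite /deficit ffunE permK.
  by rewrite -{1}[i](permKV v); apply: fconnect_conj.
apply: symbol_eq_deficit => // i; rewrite cd' -[i](permKV v) -cd; exact: lt.
Qed.
End Symbol.
End Cycles.

(** Turns an equality of multisets of keys into a matching of the cycles that carry them. *)
Lemma perm_map_matching (T1 T2 K : eqType) (f : T1 -> K) (g : T2 -> K) s1 s2 (y0 : T2) :
  uniq s1 -> uniq s2 -> perm_eq [seq f x | x <- s1] [seq g y | y <- s2] ->
  exists sg : T1 -> T2, [/\ {in s1, forall x, sg x \in s2}, {in s1, forall x, g (sg x) = f x}
    & {in s1 &, injective sg}].
Proof.
elim: s1 s2 => [|x s1 IH] s2 /=; first by exists (fun _ => y0); split.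
move=> /andP[xs u1] u2 pe.
have /mapP[y ys fy] : f x \in [seq g y | y <- s2] by rewrite -(perm_mem pe) mem_head.
have pe' : perm_eq [seq f x | x <- s1] [seq g y | y <- rem y s2].
  by rewrite -(perm_cons (f x)) (perm_trans pe) // fy -map_cons perm_map // perm_to_rem.
have [sg [h1 h2 h3]] := IH _ u1 (rem_uniq y u2) pe'.
have h1' x' : x' \in s1 -> sg x' \in s2 /\ sg x' != y.
  by move=> /h1; rewrite mem_rem_uniq // inE => /andP[].
exists (fun z => if z == x then y else sg z); split=> [z|z|z t]; rewrite !inE.
- by case: eqP => //= _ /h1'[].
- by case: eqP => [-> //|_ /= /h2].
case: eqP => [->|_]; case: eqP => [->|_] //=.
- by move=> _ /h1'[_ /eqP ne] e; case: ne.
- by move=> /h1'[_ /eqP ne] _ e; case: ne.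
exact: h3.
Qed.

Section Types.
Variables (d l : nat).
Implicit Types (a : {ffun 'I_d -> 'I_l}) (w v : 'S_d).

Definition cycle_keys a w : seq (nat * nat) :=
  [seq (cycle_deficit a w r, fingraph.order w r) | r <- enum (froots w)].

Definition cycle_part a w (t : nat) : seq nat :=
  sort geq [seq k.2 | k <- cycle_keys a w & k.1 == t].

Definition cycle_type a w : multiseq l d :=
  [ffun t : 'I_l => insub_bseq d [seq inord n : 'I_d.+1 | n <- cycle_part a w t]].

Lemma order_le w i : (fingraph.order w i <= d)%N.
Proof. by rewrite -[X in (_ <= X)%N]card_ord; apply: max_card. Qed.

Lemma cycle_partE a w (t : 'I_l) : component (cycle_type a w) t = cycle_part a w t.
Proof.
have pe : perm_eq (cycle_part a w t) [seq k.2 | k <- cycle_keys a w & k.1 == t :> nat].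
  by apply/permPl/perm_sort.
rewrite /component ffunE /insub_bseq insubdK; last first.
  rewrite unfold_in /= size_map (perm_size pe) size_map size_filter.
  rewrite (leq_trans (count_size _ _)) // size_map -cardE.
  by rewrite -[X in (_ <= X)%N]card_ord; apply: max_card.
rewrite -map_comp map_id_in // => n; rewrite (perm_mem pe).
case/mapP=> k /[!mem_filter]/andP[_ /mapP[r _ ->] ->] /=.
by rewrite inordK // ltnS order_le.
Qed.

Lemma sum_order w : (\sum_(r <- enum (froots w)) fingraph.order w r = d)%N.
Proof.
rewrite -[RHS]card_ord -sum1_card big_enum /=.
rewrite [RHS](partition_big (froot w) (froots w)) /=; last first.
  by move=> i _; apply: (roots_root (perm_fconnect_sym w)).
apply: eq_big => // r rr; rewrite /fingraph.order -sum1_card; apply: eq_bigl => i.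
rewrite inE (perm_fconnect_sym w) -(root_connect (perm_fconnect_sym w)).
by rewrite (eqP rr).
Qed.

Lemma cycle_type_multipartition a w : (forall i, (cycle_deficit a w i < l)%N) ->
  is_multipartition (cycle_type a w).
Proof.
move=> lt; apply/andP; split.
  apply/forallP => t; rewrite cycle_partE; apply/andP; split.
    by apply: sort_sorted => m n; exact: leq_total.
  rewrite mem_sort; apply/mapP => -[k /[!mem_filter]/andP[_ /mapP[r _ ->]]] /= e.
  by have := fingraph.order_gt0 w r; rewrite -e.
apply/eqP; rewrite -[RHS](sum_order w).
transitivity (\sum_(t < l) \sum_(r <- enum (froots w) | cycle_deficit a w r == t)
   fingraph.order w r)%N.
  apply: eq_bigr => t _; rewrite cycle_partE sumnE.
  rewrite (perm_big [seq k.2 | k <- cycle_keys a w & k.1 == t :> nat]) /=; last first.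
    by apply/permPl/perm_sort.
  by rewrite big_map big_filter big_map.
rewrite (exchange_big_dep xpredT) //=; apply: eq_bigr => r _.
by rewrite (big_pred1 (Ordinal (lt r))) // => t; rewrite -val_eqE eq_sym.
Qed.

(** A key (t, n) with t < l occurs as often as n occurs in the t-th component, and the bound on the
    deficits excludes keys with t >= l. *)
Lemma cycle_type_keys a1 w1 a2 w2 :
  (forall i, (cycle_deficit a1 w1 i < l)%N) -> (forall i, (cycle_deficit a2 w2 i < l)%N) ->
  cycle_type a1 w1 = cycle_type a2 w2 -> perm_eq (cycle_keys a1 w1) (cycle_keys a2 w2).
Proof.
move=> lt1 lt2 e.
have cnt a w t n : count_mem (t, n) (cycle_keys a w) = count_mem n (cycle_part a w t).
  have /seq.permP -> : perm_eq (cycle_part a w t) [seq k.2 | k <- cycle_keys a w & k.1 == t].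
    by apply/permPl/perm_sort.
  rewrite [RHS]count_map [RHS]count_filter; apply: eq_count => -[t' n'] /=.
  by rewrite xpair_eqE andbC.
apply/allP => -[t n] _ /=; rewrite !cnt; have [tl|lt] := ltnP t l.
  by have := cycle_partE a1 w1 (Ordinal tl); rewrite e cycle_partE => /= ->.
have no a w : (forall i, cycle_deficit a w i < l)%N -> cycle_part a w t = [::].
  move=> h; apply/nilP; rewrite /nilp size_sort size_map size_filter -leqn0 leqNgt -has_count.
  apply/hasPn => k /mapP[r _ ->] /=; rewrite neq_ltn; apply/orP; left.
  exact: leq_trans (h r) lt.
by rewrite !no.
Qed.

Lemma cycle_type_iso a1 w1 a2 w2 :
  (forall i, (cycle_deficit a1 w1 i < l)%N) -> (forall i, (cycle_deficit a2 w2 i < l)%N) ->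
  cycle_type a1 w1 = cycle_type a2 w2 ->
  exists v : 'S_d, (forall i, v (w1 i) = w2 (v i)) /\
    forall i, cycle_deficit a1 w1 i = cycle_deficit a2 w2 (v i).
Proof.
move=> lt1 lt2 /(cycle_type_keys lt1 lt2) pe.
have [d0|d0] := posnP d.
  by exists 1%g; split=> i; have := ltn_ord i; rewrite {2}d0.
pose y0 : 'I_d := Ordinal d0.
have [sg [sg1 sg2 sg3]] := perm_map_matching y0 (enum_uniq _) (enum_uniq _) pe.
have cs1 := perm_fconnect_sym w1; have cs2 := perm_fconnect_sym w2.
have rin i : froot w1 i \in enum (froots w1).
  by rewrite mem_enum; apply: (roots_root cs1).
have ord_sg i : fingraph.order w2 (sg (froot w1 i)) = fingraph.order w1 (froot w1 i).
  by have [] := sg2 _ (rin i).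
have rc i : fconnect w1 (froot w1 i) i by rewrite cs1; exact: connect_root.
have sroot i : froot w2 (sg (froot w1 i)) = sg (froot w1 i).
  by have := sg1 _ (rin i); rewrite mem_enum => /eqP.
(* The k-th point after a root goes to the k-th point after the matched root. Matched cycles have
   the same length, so this is still compatible where the cycle closes. *)
pose vf i := iter (findex w1 (froot w1 i) i) w2 (sg (froot w1 i)).
have vroot i : froot w2 (vf i) = sg (froot w1 i).
  rewrite -[RHS]sroot; apply/eqP; rewrite (root_connect cs2) cs2; exact: fconnect_iter.
have vinj : injective vf.
  move=> i j e; have rij : froot w1 i = froot w1 j.
    by apply: sg3 => //; rewrite -!vroot e.
  have := e; rewrite /vf -rij => /(congr1 (findex w2 (sg (froot w1 i)))).
  rewrite !findex_iter ?ord_sg ?findex_max //; last by rewrite rij.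
  by move=> ee; rewrite -(iter_findex (rc i)) ee rij iter_findex.
have vw i : vf (w1 i) = w2 (vf i).
  have rw : froot w1 (w1 i) = froot w1 i.
    by apply/eqP; rewrite (root_connect cs1) cs1; exact: fconnect1.
  rewrite /vf rw -iterS; set r := froot w1 i.
  have lt := findex_max (rc i); rewrite -/r in lt.
  have [lt2'|ge] := ltnP (findex w1 r i).+1 (fingraph.order w1 r).
    congr iter; rewrite -{1}(iter_findex (rc i)) -iterS findex_iter //.
  have eo : (findex w1 r i).+1 = fingraph.order w1 r by apply/eqP; rewrite eqn_leq lt.
  have -> : w1 i = r.
    by rewrite -{1}(iter_findex (rc i)) -iterS -/r eo; exact: (iter_order (@perm_inj _ w1)).
  by rewrite findex0 eo -ord_sg (iter_order (@perm_inj _ w2)).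
have rootE a w : cycle_deficit a w =1 cycle_deficit a w \o froot w.
  move=> j /=; apply: eq_bigl => x; apply: same_connect => //; last exact: connect_root.
  exact: perm_fconnect_sym.
exists (perm vinj); split=> i; first by rewrite !permE vw.
rewrite rootE [RHS]rootE /= permE vroot.
by have [] := sg2 _ (rin i).
Qed.

(* [rep mu] is a basis element whose cycles of deficit [t] have the parts of the [t]-th
   component of [mu] as lengths. *)
Lemma symbol_determined : exists rep : multiseq l d -> option (basis_index d l),
  forall (R : zmodType) (c : basis_index d l -> R), central_symbol c ->
  (forall mu b, is_multipartition mu -> rep mu = Some b -> c b = 0) -> forall b, c b = 0.
Proof.
pose good (b : basis_index d l) := [forall i, cycle_deficit b.1 b.2 i < l]%N.
exists (fun mu => [pick b | good b && (cycle_type b.1 b.2 == mu)]).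
move=> R c cs h [a w]; apply/eqP; apply: contraT => nz.
have lt := symbol_deficit cs nz.
case Ep: [pick b | good b && (cycle_type b.1 b.2 == cycle_type a w)] => [b|]; last first.
  by move: Ep; case: pickP => // /(_ (a, w)) /=; rewrite eqxx andbT => /forallP; case.
have c0 := h _ _ (cycle_type_multipartition lt) Ep.
move: Ep; case: pickP => // -[a' w'] /= /andP[/forallP lt' /eqP e] [eb].
have [v [v1 v2]] := cycle_type_iso lt' lt e.
by move: nz; rewrite -(symbol_iso cs v1 v2 lt') eb c0 eqxx.
Qed.
End Types.

Definition multipartitions (l d : nat) : {set multiseq l d} := [set la | is_multipartition la].

Lemma exists_coord (R : comNzRingType) (E : pzRingType) (d l : nat)
    (P : {rmorphism {mpoly R[d]} -> E}) (W : 'S_d -> E) (lc := lincomb (l := l) P W) :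
  (forall c, lc c = 0 -> c = 0) -> exists co : E -> {ffun basis_index d l -> R}, forall c, co (lc c) = c.
Proof.
move=> lc_inj; exists (fun e => epsilon (inhabits 0) (fun c => e = lc c)) => c.
have h : lc c = lc (epsilon (inhabits 0) (fun c' => lc c = lc c')).
  by apply: (epsilon_spec (inhabits 0) (fun c' => lc c = lc c')); exists c.
by apply/eqP; rewrite -subr_eq0; apply/eqP/lc_inj; rewrite /lc lincombB -/lc -h subrr.
Qed.

(** * The upper bound for the center *)

Section CenterBound.
Variables (k : fieldType) (E : pzRingType) (d l : nat).
Variables (P : {rmorphism {mpoly k[d]} -> E}) (W : 'S_d -> E).
Hypothesis HD : hecke_datum P W.
Variables (hd : (0 < d)%N) (q : 'I_l -> k).
Hypothesis Pq : P (cyclo hd q) = 0.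
Local Notation B := (basis_index d l).
Local Notation lc := (lincomb (l := l) P W).
Hypothesis lc_inj : forall c : {ffun B -> k}, lc c = 0 -> c = 0.

Definition coord_ffun (v : 'rV[k]_#|B|) : {ffun B -> k} := [ffun b => v 0 (enum_rank b)].

(** The matrix [M] reads off the coefficients at the representatives. If these vanish for a central
    element, its top degree part vanishes by [symbol_determined]; so the element is zero, and
    multiplication by [M] preserves the independence of the rows. *)
Lemma center_bound (p : nat) (U : 'M[k]_(p, #|B|)) : row_free U ->
  (forall v : 'rV_p, (forall j, P 'X_j * lc (coord_ffun (v *m U)) = lc (coord_ffun (v *m U)) * P 'X_j) /\
     (forall w, W w * lc (coord_ffun (v *m U)) = lc (coord_ffun (v *m U)) * W w)) ->
  (p <= #|multipartitions l d|)%N.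
Proof.
move=> Ufree Ucen; have [rep hrep] := symbol_determined d l.
have [co coK] := exists_coord lc_inj.
pose M : 'M[k]_(#|B|, #|multipartitions l d|) := \matrix_(i, j)
  (rep (enum_val j) == Some (enum_val i))%:R.
suff UM : row_free (U *m M).
  by have := rank_leq_col (U *m M); rewrite (eqP UM).
rewrite -kermx_eq0; apply/rowV0P => v /sub_kermxP; rewrite mulmxA => vM.
have {Ucen} [cX cW] := Ucen v; set c := coord_ffun (v *m U) in cX cW.
suff c0 : c = 0.
  have vU : v *m U = 0.
    apply/rowP => j; have /ffunP/(_ (enum_val j)) := c0.
    by rewrite !ffunE enum_valK !mxE.
  by apply/eqP; rewrite -(mulmx_free_eq0 _ Ufree) vU.
have crep mu b : is_multipartition mu -> rep mu = Some b -> c b = 0.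
  move=> mm rb; have mi : mu \in multipartitions l d by rewrite inE.
  have := congr1 (fun A : 'rV_ _ => A 0 (enum_rank_in mi mu)) vM.
  rewrite [LHS]mxE [RHS]mxE (bigD1 (enum_rank b)) //= [M _ _]mxE enum_rankK_in // enum_rankK rb eqxx mulr1.
  rewrite big1 ?addr0; first by rewrite ffunE.
  move=> i ib; rewrite [M _ _]mxE enum_rankK_in // rb.
  case: eqP => [[bi]|_]; last by rewrite mulr0.
  by move: ib; rewrite bi enum_valK eqxx.
apply/eqP; apply: contraT => nz.
have /existsP[b0 nb0] : [exists b, c b != 0].
  apply: contraNT nz; rewrite negb_exists => /forallP h; apply/eqP/ffunP => b.
  by rewrite [RHS]ffunE; apply/eqP; have := h b; rewrite negbK.
have [b1 nb1 mb] := eq_bigmax_cond (@bdeg d l) (A := [pred b | c b != 0]) ltac:(by apply/card_gt0P; exists b0).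
set m := \max_(_ in _) _ in mb.
have cm b : c b != 0 -> (bdeg b <= m)%N by move=> h; rewrite /m; apply: leq_bigmax_cond; rewrite inE.
have := hrep _ _ (top_symbolP HD Pq coK cX cW cm) _ b1.
rewrite -mb eqxx => h; move: nb1; rewrite inE h ?eqxx // => mu b mm rb.
by rewrite (crep _ _ mm rb) if_same.
Qed.

End CenterBound.

(** * The Coxeter presentation of the symmetric group *)

(** The letter k stands for the transposition of k and k + 1. The contexts [u] and [v] are built
    into the relations, which makes this a congruence for concatenation. *)
Inductive cox (n : nat) : seq nat -> seq nat -> Prop :=
| cox_refl w : cox n w w
| cox_sym u v : cox n u v -> cox n v u
| cox_trans u v w : cox n u v -> cox n v w -> cox n u w
| cox_sq u v k : (k < n)%N -> cox n (u ++ [:: k, k & v]) (u ++ v)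
| cox_far u v i j : (i.+1 < j)%N -> (j < n)%N ->
    cox n (u ++ [:: i, j & v]) (u ++ [:: j, i & v])
| cox_braid u v i : (i.+1 < n)%N ->
    cox n (u ++ [:: i, i.+1, i & v]) (u ++ [:: i.+1, i, i.+1 & v]).

Section CoxeterWords.
Variable n : nat.

Lemma cox_ctx x y u v : cox n u v -> cox n (x ++ u ++ y) (x ++ v ++ y).
Proof.
elim=> [w|u1 v1 _|u1 v1 w1 _ h1 _|u1 v1 k lt|u1 v1 i j h1 h2|u1 v1 i h].
- exact: cox_refl.
- exact: cox_sym.
- exact: cox_trans.
- by have := cox_sq (x ++ u1) (v1 ++ y) lt; rewrite -!catA.
- by have := cox_far (x ++ u1) (v1 ++ y) h1 h2; rewrite -!catA.
by have := cox_braid (x ++ u1) (v1 ++ y) h; rewrite -!catA.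
Qed.

Lemma cox_cons i u v : cox n u v -> cox n (i :: u) (i :: v).
Proof. by move=> h; have := cox_ctx [:: i] [::] h; rewrite !cats0. Qed.

Lemma cox_catr y u v : cox n u v -> cox n (u ++ y) (v ++ y).
Proof. exact: (cox_ctx [::] y). Qed.

Lemma cox_catl x u v : cox n u v -> cox n (x ++ u) (x ++ v).
Proof. by move=> h; have := cox_ctx x [::] h; rewrite !cats0. Qed.

Lemma cox_commute i v : (i < n)%N ->
  all (fun j => (j < n) && ((i.+1 < j) || (j.+1 < i)))%N v ->
  cox n (i :: v) (rcons v i).
Proof.
move=> lin; elim: v => [|j v IH] /=; first by move=> _; exact: cox_refl.
move=> /andP[/andP[jn ij] /IH h].
apply: cox_trans (cox_cons j h); case/orP: ij => ij.
  exact: (cox_far [::] v ij jn).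
exact/cox_sym/(cox_far [::] v ij lin).
Qed.

(** The letter i meets the word j, j+1, .., k from the left. If i + 1 < j it passes through; if i +
    1 = j it lengthens the word; if i = j it cancels; if i > j the braid relation lets it come out
    on the right as i - 1. *)
Lemma cox_push k i j : (k < n)%N -> (i <= k)%N -> (j <= k.+1)%N ->
  exists j' g, [/\ (j' <= k.+1)%N, all (fun x => x < k)%N g &
    cox n (i :: iota j (k.+1 - j)) (iota j' (k.+1 - j') ++ g)].
Proof.
move=> kn ik jk; have lin : (i < n)%N by lia.
case: (ltngtP i.+1 j) => [lt|gt|eq].
- exists j, [:: i]; split => //; first by rewrite /= andbT; lia.
  rewrite cats1; apply: cox_commute => //; apply/allP => x; rewrite mem_iota; lia.
- have [ij|ij] := eqVneq i j.
    exists j.+1, [::]; split => //; first by lia.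
    rewrite cats0 -ij (_ : (k.+1 - i = (k - i).+1)%N); last by lia.
    by rewrite /= subSS; apply: (cox_sq [::]).
  exists j, [:: i.-1]; split => //; first by rewrite /= andbT; lia.
  have -> : iota j (k.+1 - j) = iota j (i.-1 - j) ++ [:: i.-1, i & iota i.+1 (k - i)].
    rewrite (_ : (k.+1 - j = (i.-1 - j) + (k - i).+2)%N); last by lia.
    rewrite iotaD (_ : (j + (i.-1 - j) = i.-1)%N); last by lia.
    by rewrite /= (_ : i.-1.+1 = i) //; lia.
  have c1 : cox n (i :: iota j (i.-1 - j)) (rcons (iota j (i.-1 - j)) i).
    by apply: cox_commute => //; apply/allP => x; rewrite mem_iota; lia.
  have i1n : (i.-1 < n)%N by lia.
  have c2 : cox n (i.-1 :: iota i.+1 (k - i)) (rcons (iota i.+1 (k - i)) i.-1).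
    by apply: cox_commute => //; apply/allP => x; rewrite mem_iota; lia.
  apply: cox_trans (cox_catr [:: i.-1, i & iota i.+1 (k - i)] c1) _.
  rewrite cat_rcons -catA; apply: cox_catl.
  have ii : i.-1.+1 = i by lia.
  have := cox_braid [::] (iota i.+1 (k - i)) (i := i.-1); rewrite ii /= => /(_ n lin)/cox_sym h.
  apply: cox_trans h _; rewrite /= cats1; apply/cox_cons/cox_cons; exact: c2.
exists i, [::]; split => //; first by lia.
rewrite cats0 -eq (_ : (k.+1 - i = (k.+1 - i.+1).+1)%N) /=; last by lia.
exact: cox_refl.
Qed.

(** The words j, .., k represent the cosets of the subgroup generated by the letters less than k; j
    = k + 1 gives the empty word. *)
Lemma cox_normal k w : (k < n)%N -> all (fun x => x <= k)%N w ->
  exists j g, [/\ (j <= k.+1)%N, all (fun x => x < k)%N g &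
    cox n w (iota j (k.+1 - j) ++ g)].
Proof.
move=> kn; elim: w => [|i w IH] /=.
  by move=> _; exists k.+1, [::]; split => //; rewrite subnn; exact: cox_refl.
move=> /andP[ik /IH[j [g [jk gk h]]]].
have [j' [g' [jk' gk' h']]] := cox_push kn ik jk.
exists j', (g' ++ g); split => //; first by rewrite all_cat gk' gk.
apply: cox_trans (cox_cons i h) _.
by rewrite catA; apply: (cox_catr g h').
Qed.

Definition adj (k : nat) : 'S_n.+1 := tperm (inord k) (inord k.+1).

Definition word_perm (w : seq nat) : 'S_n.+1 := (\prod_(k <- w) adj k)%g.

Lemma word_perm_cat u v : word_perm (u ++ v) = (word_perm u * word_perm v)%g.
Proof. exact: big_cat. Qed.

(** Stated for monoids, to be applied to permutations and to ring elements alike. *)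
Lemma cox_eval (T : Type) (idx : T) (op : Monoid.law idx) (S : nat -> T) u v :
  (forall i, (i < n)%N -> op (S i) (S i) = idx) ->
  (forall i j, (i.+1 < j)%N -> (j < n)%N -> op (S i) (S j) = op (S j) (S i)) ->
  (forall i, (i.+1 < n)%N -> op (op (S i) (S i.+1)) (S i) = op (op (S i.+1) (S i)) (S i.+1)) ->
  cox n u v -> \big[op/idx]_(k <- u) S k = \big[op/idx]_(k <- v) S k.
Proof.
move=> Ssq Sfar Sbraid.
elim=> {u v} [//|//|u v w _ -> _ -> //|u v k lt|u v i j h1 h2|u v i h]; rewrite !big_cat !big_cons;
  congr (op _ _); rewrite !Monoid.mulmA /=.
- by rewrite Ssq // Monoid.mul1m.
- by rewrite Sfar.
by rewrite Sbraid.
Qed.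

Lemma adj_val k : (k < n)%N -> (inord k : 'I_n.+1) = k :> nat /\ (inord k.+1 : 'I_n.+1) = k.+1 :> nat.
Proof. by move=> kn; rewrite !inordK //; lia. Qed.

Lemma adj_fix k (x : 'I_n.+1) : (k < n)%N -> x != k :> nat -> x != k.+1 :> nat -> adj k x = x.
Proof.
move=> /adj_val[e1 e2] n1 n2; rewrite /adj tpermD // -val_eqE /= ?e1 ?e2 eq_sym //.
Qed.

Lemma adj_sq k : (adj k * adj k)%g = 1%g. Proof. exact: tperm2. Qed.

Lemma adj_far i j : (i.+1 < j)%N -> (j < n)%N -> (adj i * adj j = adj j * adj i)%g.
Proof.
move=> ij jn; have [e1 e2] := adj_val jn; have [e3 e4] : _ /\ _ := @adj_val i ltac:(lia).
apply/esym/commgP; rewrite /commg conjgE; rewrite /adj.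
rewrite -conjgE tpermJ !tpermD ?tpermV ?tperm2 //; rewrite -val_eqE /= ?e1 ?e2 ?e3 ?e4; lia.
Qed.

Lemma adj_braid i : (i.+1 < n)%N ->
  (adj i * adj i.+1 * adj i = adj i.+1 * adj i * adj i.+1)%g.
Proof.
move=> lt; have [e1 e2] := adj_val lt; have [e3 e4] : _ /\ _ := @adj_val i ltac:(lia).
have h (s t : 'S_n.+1) : (s * s)%g = 1%g -> (s * t * s)%g = (t ^ s)%g.
  by move=> ss; rewrite conjgE (_ : s^-1%g = s) ?mulgA // -[LHS]mulg1 -ss mulKg.
rewrite (h _ _ (adj_sq i)) (h _ _ (adj_sq i.+1)) /adj !tpermJ.
rewrite tpermR tpermL !tpermD //; rewrite -val_eqE /= ?e1 ?e2 ?e3 ?e4; lia.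
Qed.

Lemma cox_word_perm u v : cox n u v -> word_perm u = word_perm v.
Proof. by apply: cox_eval => [i _||]; [exact: adj_sq|exact: adj_far|exact: adj_braid]. Qed.

Lemma word_perm_iota k j : (k < n)%N -> (j <= k.+1)%N ->
  word_perm (iota j (k.+1 - j)) (inord j) = inord k.+1.
Proof.
move=> kn; move e : (k.+1 - j)%N => m; elim: m j e => [|m IH] j e jk.
  by rewrite /word_perm big_nil perm1; congr inord; lia.
rewrite /= /word_perm big_cons permM {1}/adj tpermL.
by apply: IH; lia.
Qed.

Lemma word_perm_fix k w (x : 'I_n.+1) : (k <= n)%N -> all (fun i => i < k)%N w ->
  (k < x)%N -> word_perm w x = x.
Proof.
move=> kn; rewrite /word_perm; elim: w => [|i w IH] /=; first by rewrite big_nil perm1.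
move=> /andP[ik h] kx; rewrite big_cons permM adj_fix ?IH //; lia.
Qed.

(** In the normal form, the coset representative sends j to k + 1 and the tail fixes k + 1. The
    identity therefore forces j = k + 1, the representative is empty, and the tail has smaller
    letters. *)
Lemma word_perm1_cox k w : (k <= n)%N -> all (fun i => i < k)%N w ->
  word_perm w = 1%g -> cox n w [::].
Proof.
elim: k w => [|k IH] w kn; first by case: w => [_ _|//]; exact: cox_refl.
move=> /(cox_normal kn)[j [g [jk gk h]]] w1.
have := cox_word_perm h; rewrite w1 word_perm_cat => /permP/(_ (inord j)).
have ej : (inord j : 'I_n.+1) = j :> nat by rewrite inordK //; lia.
have ek : (inord k.+1 : 'I_n.+1) = k.+1 :> nat by rewrite inordK.
rewrite perm1 permM word_perm_iota // (word_perm_fix _ gk) ?ek //; last exact: ltnW.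
move/(congr1 val); rewrite /= ej ek => e; rewrite e subnn /= in h; apply: (cox_trans h (IH _ _ gk _)); first exact: ltnW.
by rewrite -(cox_word_perm h).
Qed.

Lemma cox_rev w : all (fun i => i < n)%N w -> cox n (w ++ rev w) [::].
Proof.
elim: w => [|i w IH] /=; first by move=> _; exact: cox_refl.
move=> /andP[lt /IH h]; rewrite rev_cons -cats1 catA.
have := cox_ctx [:: i] [:: i] h; move/cox_trans; apply.
exact: (cox_sq [::] [::] lt).
Qed.

Lemma word_perm_cox u v : all (fun i => i < n)%N u -> all (fun i => i < n)%N v ->
  word_perm u = word_perm v -> cox n u v.
Proof.
move=> hu hv e; have hr : all (fun i => i < n)%N (rev v) by rewrite all_rev.
have h1 : cox n (u ++ rev v) [::].
  apply: (word_perm1_cox (leqnn n)); first by rewrite all_cat hu hr.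
  by rewrite word_perm_cat e -word_perm_cat (cox_word_perm (cox_rev hv)) /word_perm big_nil.
apply: cox_trans (cox_trans _ (cox_catr v h1)) (cox_refl n v).
rewrite -catA; apply: cox_sym; rewrite -{2}[u]cats0; apply: cox_catl.
by have := cox_rev hr; rewrite revK.
Qed.

Lemma word_perm_surj (p : 'S_n.+1) :
  exists w, all (fun i => i < n)%N w && (word_perm w == p).
Proof.
elim/adjacent_tperm_ind: p => [|i j p ij [w /andP[wn /eqP wp]]].
  by exists [::]; rewrite /word_perm big_nil eqxx.
have lt : (i < n)%N by have := ltn_ord j; lia.
exists (nat_of_ord i :: w); rewrite /= lt wn /word_perm big_cons -/(word_perm w).
have e : inord i.+1 = j by apply: ord_inj; rewrite /= inordK -ij.
by rewrite /= wp /adj inord_val e.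
Qed.

Definition perm_word p : seq nat := xchoose (word_perm_surj p).

Lemma perm_wordP p : all (fun i => i < n)%N (perm_word p) /\ word_perm (perm_word p) = p.
Proof. by have /andP[-> /eqP ->] := xchooseP (word_perm_surj p). Qed.

(** Seminormal matrices are given for adjacent transpositions only. The value at a permutation is
    computed from a chosen word, and [word_perm_cox] makes the choice irrelevant. *)
Lemma coxeter_presentation (E : pzRingType) (S : nat -> E) :
  (forall i, (i < n)%N -> S i * S i = 1) ->
  (forall i j, (i.+1 < j)%N -> (j < n)%N -> S i * S j = S j * S i) ->
  (forall i, (i.+1 < n)%N -> S i * S i.+1 * S i = S i.+1 * S i * S i.+1) ->
  exists W : 'S_n.+1 -> E, [/\ W 1%g = 1, forall u v, W (u * v)%g = W u * W v
    & forall i, (i < n)%N -> W (adj i) = S i].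
Proof.
move=> h1 h2 h3; pose W p := \prod_(k <- perm_word p) S k.
have key w : all (fun i => i < n)%N w -> W (word_perm w) = \prod_(k <- w) S k.
  move=> wn; apply: (cox_eval h1 h2 h3); have [pn pw] := perm_wordP (word_perm w).
  exact: word_perm_cox.
exists W; split=> [|u v|i lt].
- by have := key [::] isT; rewrite /word_perm !big_nil.
- have [un {1}<-] := perm_wordP u; have [vn {1}<-] := perm_wordP v.
  by rewrite -word_perm_cat key ?all_cat ?un // big_cat.
by have := key [:: i]; rewrite /word_perm !big_seq1 /= lt => ->.
Qed.
End CoxeterWords.

(** * Standard multitableaux *)

(* Multipartitions are encoded by their l Maya diagrams, that is by the set of positions of
   the beads on l runners. Adding a box of content c to the r-th component moves a bead on the
   r-th runner from position c - 1 to position c. Contents are shifted by d, to make them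
   natural numbers. *)
Definition letter (l M : nat) : finType := ('I_l * 'I_M.+1)%type.

Section Words.
Variables (l M : nat).
Local Notation C := (letter l M).
Implicit Types (a b c : C) (S : {set C}) (u v w : seq C).

Definition pos (c : C) : nat := c.2.

(** At position 0 this is the letter itself, a case excluded by [addable] and [removable]. *)
Definition prevl c : C := (c.1, inord (pos c).-1).

Definition addable S c := [&& (0 < pos c)%N, prevl c \in S & c \notin S].
Definition removable S c := [&& (0 < pos c)%N, prevl c \notin S & c \in S].
Definition move S c : {set C} := c |: (S :\ prevl c).
Definition unmove S c : {set C} := prevl c |: (S :\ c).

Fixpoint std S w : bool := if w is c :: w' then addable S c && std (move S c) w' else true.
Definition fin S w : {set C} := foldl move S w.

(** Boxes on neighbouring diagonals of one component; by [std_swap] this is the only obstruction to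
    exchanging consecutive letters. *)
Definition nb a b := (a.1 == b.1) && ((pos b == (pos a).+1) || (pos a == (pos b).+1)).

Lemma nbC a b : nb a b = nb b a.
Proof. by rewrite /nb eq_sym orbC. Qed.

Lemma letter_eq a b : (a == b) = (a.1 == b.1) && (pos a == pos b).
Proof. by case: a b => [r p] [s t]; rewrite xpair_eqE. Qed.

Lemma prevl2 c : pos (prevl c) = (pos c).-1.
Proof. by rewrite /pos /= inordK //; exact: leq_ltn_trans (leq_pred _) (ltn_ord _). Qed.

Lemma prevl_neq c : (0 < pos c)%N -> (prevl c == c) = false.
Proof. by rewrite letter_eq prevl2 eqxx /= => h; apply/eqP; lia. Qed.

Lemma eq_prevl a b : (0 < pos b)%N -> (a == prevl b) = (a.1 == b.1) && (pos b == (pos a).+1).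
Proof.
by move=> h; rewrite letter_eq prevl2 /=; congr (_ && _); apply/eqP/eqP; lia.
Qed.

Lemma prevl_inj a b : (0 < pos a)%N -> (0 < pos b)%N -> (prevl a == prevl b) = (a == b).
Proof.
move=> ha hb; rewrite eq_prevl // prevl2 letter_eq /=.
by congr (_ && _); apply/eqP/eqP; lia.
Qed.

Lemma nb_prevl a b : (0 < pos a)%N -> (0 < pos b)%N -> nb a b = (a == prevl b) || (b == prevl a).
Proof. by move=> ha hb; rewrite !eq_prevl // [b.1 == _]eq_sym -andb_orr. Qed.

Lemma std_cat S u v : std S (u ++ v) = std S u && std (fin S u) v.
Proof. by elim: u S => //= c u IH S; rewrite IH andbA. Qed.

Lemma fin_cat S u v : fin S (u ++ v) = fin (fin S u) v.
Proof. exact: foldl_cat. Qed.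

Lemma in_move S c x : (x \in move S c) = (x == c) || (x != prevl c) && (x \in S).
Proof. by rewrite !inE. Qed.

Lemma in_unmove S c x : (x \in unmove S c) = (x == prevl c) || (x != c) && (x \in S).
Proof. by rewrite !inE. Qed.

Lemma std2_neq S a b w : std S [:: a, b & w] -> a != b.
Proof.
move=> /= /and3P[_ /and3P[_ _ hb] _]; apply: contraNneq hb => ->.
by rewrite in_move eqxx.
Qed.

Lemma addable_nb S a b : addable S a -> nb a b -> addable S b = false.
Proof.
move=> /and3P[a0 pa na] h; apply/negP => /and3P[b0 pb nb'].
move: h; rewrite nb_prevl // => /orP[/eqP e|/eqP e].
  by rewrite -e (negbTE na) in pb.
by rewrite e pa in nb'.
Qed.

Lemma addable_move S a b : addable S a -> a != b -> ~~ nb a b ->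
  addable (move S a) b = addable S b.
Proof.
rewrite {1}/addable => /and3P[a0 pa na] ab nab; rewrite /addable.
have [b0|//] := ltnP 0 (pos b); rewrite /= !in_move.
move: nab; rewrite nb_prevl // negb_or => /andP[h1 h2].
by rewrite [prevl b == a]eq_sym (negbTE h1) [b == a]eq_sym (negbTE ab) prevl_inj // eq_sym ab h2.
Qed.

Lemma moveC S a b : (0 < pos a)%N -> (0 < pos b)%N -> ~~ nb a b ->
  move (move S a) b = move (move S b) a.
Proof.
move=> a0 b0; rewrite nb_prevl // negb_or => /andP[h1 h2].
apply/setP => x; rewrite !in_move.
have [->|xb] := eqVneq x b; first by rewrite h2 orbT.
by have [->|xa] := eqVneq x a; rewrite /= ?h1 // andbCA.
Qed.

Lemma std_swap S a b w : std S [:: a, b & w] -> std S [:: b, a & w] = ~~ nb a b.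
Proof.
move=> h; have ab := std2_neq h; move: h => /= /and3P[ha hb hw].
have [nab|nab] := boolP (nb a b); first by rewrite (addable_nb ha nab).
rewrite addable_move // in hb; rewrite hb addable_move // 1?eq_sym 1?nbC // ha /=.
by rewrite moveC // 1?nbC //; [case/and3P: hb|case/and3P: ha].
Qed.

Lemma fin_swap S a b w : std S [:: a, b & w] -> ~~ nb a b ->
  fin S [:: b, a & w] = fin S [:: a, b & w].
Proof.
by move=> /= /and3P[ha hb hw] nab; rewrite moveC 1?nbC //; [case/and3P: hb|case/and3P: ha].
Qed.

(** Between two arrivals at the same position, the bead there has to leave and another one has to
    come up just behind it, which takes two moves. *)
Lemma std3_neq S a b c w : std S [:: a, b, c & w] -> a != c.
Proof.
move=> /= /and4P[/and3P[a0 pa na] /and3P[b0 pb hb] /and3P[c0 pc hc] _].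
apply/eqP => ac; subst c; move: hc pc; rewrite !in_move eqxx /= andbT.
rewrite prevl_neq //= eqxx /= andbF orbF negb_or negbK => /andP[_ /eqP ab] /eqP pab.
have := eqxx a; rewrite {1}ab -pab => /eqP/(congr1 (fun x : C => pos x)).
by rewrite !prevl2; lia.
Qed.

(** Two neighbours are never addable at the same time. Hence a letter that is addable now can be
    exchanged with everything that precedes its first occurrence. *)
Lemma connect_front (Q : seq C -> seq C -> Prop) S0 :
  (forall u, std S0 u -> Q u u) ->
  (forall u v w, Q u v -> Q v w -> Q u w) ->
  (forall p a b t, std S0 (p ++ [:: a, b & t]) -> ~~ nb a b ->
     Q (p ++ [:: a, b & t]) (p ++ [:: b, a & t])) ->
  forall p v1 c v2, std S0 (p ++ v1 ++ c :: v2) -> addable (fin S0 p) c -> c \notin v1 ->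
  std S0 (p ++ c :: v1 ++ v2) /\ Q (p ++ c :: v1 ++ v2) (p ++ v1 ++ c :: v2).
Proof.
move=> Qr Qt Qs p v1 c v2; elim: v1 p => [|b v1 IH] p; first by split=> //; exact: Qr.
rewrite inE negb_or => hst hc /andP[cb cv1].
have := hst; rewrite std_cat => /andP[hp /= /andP[hb hs]].
have nbc : ~~ nb b c.
  by apply: contraTN hb => h; rewrite (addable_nb hc) // nbC.
have hst' : std S0 ((p ++ [:: b]) ++ v1 ++ c :: v2) by rewrite -catA.
have hc' : addable (fin S0 (p ++ [:: b])) c.
  by rewrite fin_cat /= addable_move // eq_sym.
have [h1 h2] := IH _ hst' hc' cv1; rewrite -!catA /= in h1 h2.
have h3 : std S0 (p ++ [:: c, b & v1 ++ v2]).
  rewrite std_cat hp /=; move: h1; rewrite std_cat => /andP[_ h1].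
  by have := std_swap h1; rewrite nbc => /= ->.
split=> //; apply: Qt h2; apply: Qs => //.
by rewrite nbC.
Qed.

Lemma std_connect (Q : seq C -> seq C -> Prop) S0 :
  (forall u, std S0 u -> Q u u) ->
  (forall u v w, Q u v -> Q v w -> Q u w) ->
  (forall p a b t, std S0 (p ++ [:: a, b & t]) -> ~~ nb a b ->
     Q (p ++ [:: a, b & t]) (p ++ [:: b, a & t])) ->
  forall u v, std S0 u -> std S0 v -> perm_eq u v -> Q u v.
Proof.
move=> Qr Qt Qs.
suff h u p v : std S0 (p ++ u) -> std S0 (p ++ v) -> perm_eq u v -> Q (p ++ u) (p ++ v).
  by move=> u v hu hv; apply: (h u [::] v).
elim: u p v => [|c u IH] p v hu hv.
  by rewrite perm_sym => /perm_nilP ->; rewrite !cats0; apply: Qr; rewrite cats0 in hu.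
move=> pe; have cv : c \in v by rewrite -(perm_mem pe) mem_head.
have [v1 [v2 [ev cv1]]] : exists v1 v2, v = v1 ++ c :: v2 /\ c \notin v1.
  exists (take (index c v) v), (drop (index c v).+1 v); split.
    by rewrite -{1}(cat_take_drop (index c v) v) (drop_nth c) ?index_mem // nth_index.
  by rewrite in_take ?ltnn // index_size.
have hc : addable (fin S0 p) c by move: hu; rewrite std_cat /= => /and3P[].
rewrite ev in hv pe *; have [h1 h2] := connect_front Qr Qt Qs hv hc cv1.
apply: Qt h2; rewrite -cat1s catA -[c :: v1 ++ v2]cat1s catA.
apply: IH; rewrite -?catA //.
by rewrite -(perm_cons c) (perm_trans pe) // -cat1s -[c :: v1 ++ v2]cat1s perm_catCA.
Qed.

Definition count_next c w := count (fun x : C => (0 < pos x)%N && (prevl x == c)) w.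

(** Conservation of beads at position [c]: its arrivals are the letters [c], its departures the
    letters with predecessor [c]. *)
Lemma fin_count S w c : std S w ->
  ((c \in fin S w) + count_next c w = (c \in S) + count_mem c w)%N.
Proof.
elim: w S => [|x w IH] S //= /andP[hx /IH]; rewrite in_move.
move: hx => /and3P[x0 px nx]; rewrite x0 /=.
have [->|cx] := eqVneq c x; first by rewrite prevl_neq // (negbTE nx) /=; lia.
have [->|cp] := eqVneq c (prevl x); last by rewrite /=; lia.
by rewrite px /=; lia.
Qed.

(** By conservation, the multiplicity of a letter follows from that of its successor on the runner;
    nothing leaves the last position, where the induction starts. *)
Lemma fin_perm_eq S u v : std S u -> std S v -> fin S u = fin S v -> perm_eq u v.
Proof.
move=> hu hv e; apply/allP => c _ /=; apply/eqP.
have [n] := ubnP (M - pos c); elim: n c => // n IH c; rewrite ltnS => le.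
have := fin_count c hu; have := fin_count c hv; rewrite e.
suff -> : count_next c u = count_next c v by move=> h1 h2; apply: (@addnI (c \in S)); rewrite -h1 -h2.
have [cM|Mc] := ltnP (pos c) M.
  pose c' : C := (c.1, inord (pos c).+1).
  have c'2 : pos c' = (pos c).+1 by rewrite /pos /= inordK.
  have h w : count_next c w = count_mem c' w.
    apply: eq_count => x /=; have [x0|x0] := posnP (pos x).
      by rewrite [RHS]letter_eq c'2 x0 andbF.
    by rewrite [RHS]letter_eq c'2 eq_sym eq_prevl // [c.1 == _]eq_sym.
  by rewrite !h; apply: IH; rewrite c'2; lia.
have h w : count_next c w = 0%N.
  rewrite /count_next (@eq_count _ _ pred0) ?count_pred0 // => x /=.
  apply/negP => /andP[x0]; rewrite eq_sym eq_prevl // => /andP[_ /eqP].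
  by have := ltn_ord x.2; rewrite -/(pos x); lia.
by rewrite !h.
Qed.
End Words.

Fixpoint words (T : finType) (k : nat) : seq (seq T) :=
  if k is k'.+1 then [seq rcons w c | w <- words T k', c <- enum T] else [:: [::]].

Lemma mem_words (T : finType) k w : (w \in words T k) = (size w == k).
Proof.
elim: k w => [|k IH] w; first by rewrite inE -size_eq0.
apply/allpairsP/eqP => [[[u c] /= [+ _ ->]]|]; first by rewrite IH size_rcons => /eqP ->.
elim/last_ind: w => // w c _; rewrite size_rcons => -[sw].
by exists (w, c); rewrite IH sw eqxx mem_enum.
Qed.

Lemma words_uniq (T : finType) k : uniq (words T k).
Proof.
elim: k => //= k IH; apply: allpairs_uniq => //; first exact: enum_uniq.
by move=> [u a] [v b] _ _ /= /rcons_inj [-> ->].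
Qed.

(** * Counting standard multitableaux *)

Section UpDown.
Variables (l M : nat).
Local Notation C := (letter l M).
Implicit Types (a b c : C) (S X : {set C}) (u v w : seq C).
Local Open Scope nat_scope.

Lemma std_rcons S w c : std S (rcons w c) = std S w && addable (fin S w) c.
Proof. by rewrite -cats1 std_cat /= andbT. Qed.

Lemma fin_rcons S w c : fin S (rcons w c) = move (fin S w) c.
Proof. by rewrite -cats1 fin_cat. Qed.

Lemma addable_removable X c : addable X c -> removable (move X c) c /\ unmove (move X c) c = X.
Proof.
move=> /and3P[c0 pX cX]; split.
  by rewrite /removable c0 !in_move !eqxx prevl_neq.
apply/setP => x; rewrite in_unmove in_move.
have [->|xp] := eqVneq x (prevl c); first by rewrite pX.
by have [->|xc] := eqVneq x c; rewrite ?(negbTE cX).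
Qed.

Lemma removable_addable X c : removable X c -> addable (unmove X c) c /\ move (unmove X c) c = X.
Proof.
move=> /and3P[c0 pX cX]; split.
  by rewrite /addable c0 !in_unmove !eqxx [c == _]eq_sym prevl_neq.
apply/setP => x; rewrite in_move in_unmove.
have [->|xp] := eqVneq x c; first by rewrite cX.
by have [->|xc] := eqVneq x (prevl c); rewrite ?(negbTE pX).
Qed.

Lemma addable_move_eq X S c :
  addable X c && (move X c == S) = removable S c && (X == unmove S c).
Proof.
apply/andP/andP => [[/addable_removable[h1 h2] /eqP <-]|[/removable_addable[h1 h2] /eqP ->]].
  by rewrite h1 h2.
by rewrite h1 h2.
Qed.

Lemma up_down_comm X c c' : c != c' ->
  addable X c && removable (move X c) c' = removable X c' && addable (unmove X c') c.
Proof.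
move=> cc; rewrite /addable /removable.
have [c0|c0] := posnP (pos c); first by rewrite /= andbF.
have [c'0|c'0] := posnP (pos c'); first by rewrite /= !andbF.
have e1 : (prevl c == prevl c') = false by rewrite prevl_inj // (negbTE cc).
rewrite !in_move !in_unmove [prevl c' == prevl c]eq_sym [c' == c]eq_sym e1 (negbTE cc) /=.
rewrite [c == prevl c']eq_sym [c' == prevl c]eq_sym.
by case: (prevl c \in X); case: (c \in X); case: (prevl c' \in X); case: (c' \in X);
  case: (prevl c' == c); case: (prevl c == c').
Qed.

Lemma up_down_state X c c' : c != c' -> addable X c -> removable (move X c) c' ->
  unmove (move X c) c' = move (unmove X c') c.
Proof.
move=> cc /and3P[c0 pX cX] /and3P[c'0 p'X c'X].
have c'p : c' != prevl c.
  by move: c'X; rewrite in_move eq_sym (negbTE cc) /= => /andP[].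
have cp' : c != prevl c' by move: p'X; rewrite in_move negb_or eq_sym => /andP[].
apply/setP => x; rewrite in_unmove !in_move in_unmove.
have [->|x1] := eqVneq x (prevl c').
  by rewrite /= (prevl_inj c'0 c0) [c' == c]eq_sym (negbTE cc) /= orbT.
have [->|x2] := eqVneq x c; first by rewrite cc.
have [->|x3] := eqVneq x c'; first by rewrite /= andbF.
by [].
Qed.

Variable (d : nat).
Definition beads : {set C} := [set c | pos c < d].

Definition npaths k S : nat := count (fun w => std beads w && (fin beads w == S)) (words C k).

Lemma npathsE k S : npaths k S = \sum_(w <- words C k | std beads w) (fin beads w == S).
Proof.
rewrite /npaths -sum1_count big_mkcond [RHS]big_mkcond; apply: eq_bigr => w _.
by case: (std beads w); case: (_ == _).
Qed.

Lemma npathsS k S : npaths k.+1 S = \sum_(c : C | removable S c) npaths k (unmove S c).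
Proof.
rewrite npathsE /= big_mkcond big_allpairs_dep /=.
under [RHS]eq_bigr => c _ do rewrite npathsE.
rewrite [RHS]exchange_big /= [RHS]big_mkcond; apply: eq_bigr => w _.
rewrite big_enum /=; case: ifP => [sw|nw]; last first.
  by rewrite big1 // => c _; rewrite std_rcons nw.
rewrite [RHS]big_mkcond; apply: eq_bigr => c _.
rewrite std_rcons sw fin_rcons /=.
have := addable_move_eq (fin beads w) S c.
by case: (addable _ _); case: (removable _ _) => /= e; rewrite ?e // -e.
Qed.

(** The adjoint D of the operator U by which [npathsS] obtains [npaths k.+1] from [npaths k]. *)
Definition down (f : {set C} -> nat) S := \sum_(c : C | addable S c) f (move S c).

Definition nadd S := \sum_(c : C) addable S c.
Definition nrem S := \sum_(c : C) removable S c.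

(** The commutation relation of a differential poset, D U - U D = [nadd] - [nrem], written without
    subtraction. Terms that add one box and remove a different one agree on both sides by
    [up_down_comm]. *)
Lemma down_npathsS k X :
  down (npaths k.+1) X + nrem X * npaths k X =
  nadd X * npaths k X + \sum_(c : C | removable X c) down (npaths k) (unmove X c).
Proof.
pose f := npaths k.
pose T := \sum_(c : C) \sum_(c' : C | c' != c)
   if addable X c && removable (move X c) c' then f (unmove (move X c) c') else 0.
have -> : down (npaths k.+1) X = nadd X * f X + T.
  rewrite /down /nadd big_distrl /= -big_split /= big_mkcond; apply: eq_bigr => c _.
  case: ifP => [ac|_]; last by rewrite mul0n big1.
  have [rc uc] := addable_removable ac.
  rewrite npathsS mul1n (bigD1 c) //= uc; congr (_ + _).
  rewrite big_mkcond [RHS]big_mkcond; apply: eq_bigr => c' _; rewrite /=.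
  by case: (c' != c); case: (removable _ _).
rewrite -!addnA; congr (_ + _).
have -> : T = \sum_(c' : C) \sum_(c : C | c' != c)
    if removable X c' && addable (unmove X c') c then f (move (unmove X c') c) else 0.
  rewrite /T; under eq_bigr do rewrite big_mkcond.
  under [RHS]eq_bigr do rewrite big_mkcond.
  rewrite exchange_big; apply: eq_bigr => c' _; apply: eq_bigr => c _.
  case: ifP => // cc; rewrite eq_sym in cc; rewrite up_down_comm //.
  case: ifP => // h; have := h; rewrite -up_down_comm // => /andP[h1 h2].
  by rewrite up_down_state.
rewrite /nrem big_distrl /= -big_split /= [RHS]big_mkcond; apply: eq_bigr => c _.
case: ifP => [rc|_]; last by rewrite mul0n big1.
have [ac uc] := removable_addable rc.
rewrite /down [RHS](bigD1 c) //= uc mul1n addnC; congr (_ + _).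
rewrite big_mkcond [RHS]big_mkcond; apply: eq_bigr => c' _.
by rewrite /= [c == c']eq_sym; case: (c' != c); case: (addable _ _).
Qed.

(** Words of length at most d disturb only positions within distance d of the starting level, so the
    ends of the finite runners have no influence. *)
Lemma fin_range w c : std beads w ->
  (pos c + size w < d -> c \in fin beads w) /\ (d + size w <= pos c -> c \notin fin beads w).
Proof.
elim/last_ind: w c => [|w x IH] c; first by rewrite /= !inE addn0; split=> //; rewrite -leqNgt addn0.
rewrite std_rcons fin_rcons size_rcons => /andP[sw /and3P[x0 px nx]].
have pp := prevl2 x.
split=> h; rewrite in_move.
  have [//|cx] /= := eqVneq c x; apply/andP; split; last by apply: (IH c sw).1; lia.
  apply: contraNneq nx => cp; apply: (IH x sw).1.
  by move: h; rewrite cp pp; lia.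
rewrite negb_or negb_and negbK; apply/andP; split.
  apply: contraTneq px => cx; apply: (IH (prevl x) sw).2.
  by move: h; rewrite cx pp; lia.
by apply/orP; right; apply: (IH c sw).2; lia.
Qed.

Hypothesis dM : d + d <= M.

(** Addable and removable places are the two kinds of changes between occupied and empty positions,
    and these alternate. Every runner begins occupied and ends empty, so each contributes one more
    of the first kind. *)
Lemma nadd_nrem k S : k < d -> npaths k S != 0 -> nadd S = nrem S + l.
Proof.
move=> kd; rewrite -lt0n -has_count => /hasP[w]; rewrite mem_words => /eqP sw /andP[hw /eqP <-].
set X := fin beads w.
pose x (r : 'I_l) (p : nat) : bool := (r, inord p) \in X.
have x0 r : x r 0 by apply: (fin_range _ hw).1; rewrite /pos /= inordK // sw.
have xM r : x r M = false.
  by apply/negbTE; apply: (fin_range _ hw).2; rewrite /pos /= inordK // sw; lia.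
have sumC (g : C -> nat) : \sum_(c : C) g c = \sum_(r < l) \sum_(p < M.+1) g (r, p).
  by rewrite pair_big; apply: eq_bigr => -[].
rewrite /nadd /nrem !sumC -[X in _ + X]card_ord -sum1_card -big_split /=.
apply: eq_bigr => r _; rewrite !big_ord_recl /= {1}/addable {1}/removable /pos /= !add0n.
have e1 (p : 'I_M) : addable X (r, lift ord0 p) = (x r p && ~~ x r p.+1) :> nat.
  rewrite /addable /pos /= /prevl /pos /= /x; congr (nat_of_bool (_ && ~~ (_ \in X))).
  by congr (_, _); apply: val_inj; rewrite /= inordK ?ltnS // ltn_ord.
have e2 (p : 'I_M) : removable X (r, lift ord0 p) = (~~ x r p && x r p.+1) :> nat.
  rewrite /removable /pos /= /prevl /pos /= /x; congr (nat_of_bool (_ && (_ \in X))).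
  by congr (_, _); apply: val_inj; rewrite /= inordK ?ltnS // ltn_ord.
under eq_bigr do rewrite e1; under [in RHS]eq_bigr do rewrite e2.
suff h m : \sum_(p < m) (x r p && ~~ x r p.+1) + x r m =
    \sum_(p < m) (~~ x r p && x r p.+1) + x r 0.
  by have := h M; rewrite xM x0 addn0.
elim: m => [|m IH]; first by rewrite !big_ord0.
rewrite !big_ord_recr /= addnAC.
have -> : \sum_(p < m) (~~ x r p && x r p.+1) + (~~ x r m && x r m.+1) + x r 0 =
   \sum_(p < m) (x r p && ~~ x r p.+1) + x r m + (~~ x r m && x r m.+1) by rewrite IH addnAC.
by case: (x r m); case: (x r m.+1); rewrite /= ?addn0.
Qed.

(** Iterates D U = U D + l, starting from D = 0 on the empty shape, which has no removable box. *)
Lemma down_npaths k X : k < d -> down (npaths k.+1) X = k.+1 * l * npaths k X.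
Proof.
elim: k X => [|k IH] X kd.
  apply: (@addIn (nrem X * npaths 0 X)); rewrite down_npathsS.
  rewrite big1 ?addn0 => [|c rc]; last first.
    apply: big1 => c' ac'; apply/eqP; rewrite /npaths /= addn0 eqb0.
    apply/eqP => e; have [+ _] := addable_removable ac'.
    by rewrite -e /removable !inE prevl2; lia.
  have [->|nz] := eqVneq (npaths 0 X) 0; first by rewrite !muln0.
  by rewrite (nadd_nrem kd nz) mulnDl mul1n addnC.
apply: (@addIn (nrem X * npaths k.+1 X)); rewrite down_npathsS.
under eq_bigr => c rc do rewrite IH ?(ltnW kd) //.
rewrite -big_distrr /= -npathsS.
have [->|nz] := eqVneq (npaths k.+1 X) 0; first by rewrite !muln0.
by rewrite (nadd_nrem kd nz); ring.
Qed.

(* Pairs of standard tableaux of the same shape: the Robinson-Schensted count. *)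
Lemma sum_npaths_sq k : k <= d -> \sum_(S : {set C}) npaths k S ^ 2 = l ^ k * k`!.
Proof.
elim: k => [|k IH] kd.
  rewrite (bigD1 beads) //= big1 => [|S /negbTE h]; rewrite /npaths /=.
    by rewrite eqxx.
  by rewrite eq_sym h.
have -> : \sum_(S : {set C}) npaths k.+1 S ^ 2 = \sum_(S : {set C}) npaths k S * down (npaths k.+1) S.
  under eq_bigr => S _ do rewrite expnS expn1 {1}npathsS big_distrl /=.
  under [RHS]eq_bigr => S _ do rewrite /down big_distrr /=.
  rewrite (exchange_big_dep xpredT) //= [RHS](exchange_big_dep xpredT) //=.
  apply: eq_bigr => c _.
  rewrite (reindex_onto (fun S => move S c) (fun S => unmove S c)) /=; last first.
    by move=> S /removable_addable[].
  rewrite big_mkcond [RHS]big_mkcond; apply: eq_bigr => S _.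
  case: ifP => [/andP[rS /eqP e]|h].
    by have [+ _] := removable_addable rS; rewrite e => ->.
  by case: ifP => // /addable_removable[h1 h2]; rewrite h1 h2 eqxx in h.
under eq_bigr => S _ do rewrite down_npaths //.
under eq_bigr => S _ do rewrite mulnC -mulnA mulnn.
by rewrite -big_distrr /= IH ?(ltnW kd) // expnS factS; ring.
Qed.
End UpDown.

(** * Young's seminormal form *)

Section SwapWord.
Variables (T : eqType) (x0 : T).

Definition trn (k i : nat) : nat := if i == k then k.+1 else if i == k.+1 then k else i.

Definition swapw (k : nat) (w : seq T) : seq T := mkseq (fun i => nth x0 w (trn k i)) (size w).

Lemma size_swapw k w : size (swapw k w) = size w. Proof. exact: size_mkseq. Qed.

Lemma nth_swapw k w i : (i < size w)%N -> nth x0 (swapw k w) i = nth x0 w (trn k i).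
Proof. exact: nth_mkseq. Qed.

Lemma trn_lt k i m : (k.+1 < m)%N -> (i < m)%N -> (trn k i < m)%N.
Proof. by rewrite /trn => km im; case: ifP => // _; case: ifP => // _; lia. Qed.

Lemma swapw_cat p a b t : swapw (size p) (p ++ [:: a, b & t]) = p ++ [:: b, a & t].
Proof.
apply: (@eq_from_nth _ x0); first by rewrite size_swapw !size_cat.
move=> i; rewrite size_swapw => lt; rewrite nth_swapw // /trn.
case: ifP => [/eqP ->|n1]; first by rewrite !nth_cat ltnn subnn ltnNge leqnSn /= subSnn.
case: ifP => [/eqP ->|n2]; first by rewrite !nth_cat ltnn subnn ltnNge leqnSn /= subSnn.
rewrite !nth_cat; case: ltnP => // le.
have -> : (i - size p = (i - size p).-2.+2)%N by move/eqP: n1; move/eqP: n2; lia.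
by [].
Qed.

Lemma word_split k w : (k.+1 < size w)%N ->
  exists p t, w = p ++ [:: nth x0 w k, nth x0 w k.+1 & t] /\ size p = k.
Proof.
move=> lt; exists (take k w), (drop k.+2 w); split; last by rewrite size_takel //; lia.
by rewrite -!drop_nth ?cat_take_drop //; lia.
Qed.

Lemma swapwK k w : (k.+1 < size w)%N -> swapw k (swapw k w) = w.
Proof.
by move=> /word_split[p [t [-> <-]]]; rewrite !swapw_cat.
Qed.

Lemma swapwC k k' w : (k.+1 < k')%N -> (k'.+1 < size w)%N ->
  swapw k (swapw k' w) = swapw k' (swapw k w).
Proof.
move=> kk kw; apply: (@eq_from_nth _ x0); rewrite !size_swapw // => i iw.
have h j : (trn j i < size w)%N \/ ~~ (j.+1 < size w)%N.
  by case: (ltnP j.+1 (size w)) => h; [left; apply: trn_lt|right].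
have lt1 : (trn k i < size w)%N by apply: trn_lt => //; lia.
have lt2 : (trn k' i < size w)%N by apply: trn_lt => //; lia.
rewrite !nth_swapw ?size_swapw //; congr nth; rewrite /trn.
by do !case: eqP => //=; lia.
Qed.
End SwapWord.

Section Seminormal.
Variables (K : fieldType) (l n : nat) (t : 'I_l -> K).
Local Notation d := n.+1.
Local Notation M := (d + d)%N.
Local Notation C := (letter l M).
Variable c0 : C.
Hypothesis generic : forall r s (p p' : nat),
  t r + p%:R = t s + p'%:R -> r = s /\ p = p'.
Implicit Types (a b c : C) (w : seq C).

Definition cont c : K := t c.1 + (pos c)%:R.

Lemma cont_inj : injective cont.
Proof. by move=> a b /generic[h1 h2]; apply/eqP; rewrite letter_eq h1 h2 !eqxx. Qed.

Lemma cont_succ a b : (cont b == cont a + 1) = (a.1 == b.1) && (pos b == (pos a).+1).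
Proof.
apply/eqP/andP => [|[/eqP h1 /eqP h2]].
  rewrite /cont -addrA natr1 => /generic[-> ->]; by rewrite !eqxx.
by rewrite /cont h1 h2 -addrA natr1.
Qed.

Lemma cont_nb a b : nb a b = (cont b == cont a + 1) || (cont a == cont b + 1).
Proof. by rewrite !cont_succ /nb [b.1 == _]eq_sym -andb_orr. Qed.

(* Locked, lest trivial side conditions be decided by enumerating all words. *)
Definition std_words : seq (seq C) := locked [seq w <- words C d | std (beads l M d) w].
Local Notation L := std_words.
Local Notation m := (size L).
Definition wd (i : 'I_m) : seq C := nth [::] L i.

Lemma std_words_uniq : uniq L. Proof. by rewrite /std_words -lock; exact/filter_uniq/words_uniq. Qed.

Lemma mem_std_words w : (w \in L) = std (beads l M d) w && (size w == d).
Proof. by rewrite /std_words -lock mem_filter mem_words. Qed.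

Lemma wd_in i : wd i \in L. Proof. exact: mem_nth. Qed.

Lemma size_wd i : size (wd i) = d.
Proof. by have := wd_in i; rewrite mem_std_words => /andP[_ /eqP]. Qed.

Lemma wd_inj : injective wd.
Proof.
by move=> i j /eqP; rewrite nth_uniq ?std_words_uniq // => /eqP/val_inj.
Qed.

Lemma wd_surj w : w \in L -> exists i, wd i = w.
Proof.
move=> h; move: (h); rewrite -index_mem => lt.
by exists (Ordinal lt); rewrite /wd /= nth_index.
Qed.

(* The row indexed by [w], or zero if [w] is not standard. *)
Definition rw p (Phi : 'M[K]_(m, p)) w : 'rV[K]_p := \sum_(i < m | wd i == w) row i Phi.

Lemma rw_wd p (Phi : 'M[K]_(m, p)) i : rw Phi (wd i) = row i Phi.
Proof.
by rewrite /rw (big_pred1 i) // => j; rewrite (inj_eq wd_inj).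
Qed.

Lemma rw_out p (Phi : 'M[K]_(m, p)) w : w \notin L -> rw Phi w = 0.
Proof.
by move=> h; apply: big1 => i /eqP e; rewrite -e wd_in in h.
Qed.

Lemma rwP p (Phi Psi : 'M[K]_(m, p)) : (forall w, w \in L -> rw Phi w = rw Psi w) -> Phi = Psi.
Proof. by move=> h; apply/row_matrixP => i; rewrite -!rw_wd h // wd_in. Qed.

Lemma rwD p (Phi Psi : 'M[K]_(m, p)) w : rw (Phi + Psi) w = rw Phi w + rw Psi w.
Proof. by rewrite -big_split; apply: eq_bigr => i _; rewrite linearD. Qed.

Definition evpt w (x : 'I_d) : K := cont (nth c0 w x).

Definition sn_pol (p : {mpoly K[d]}) : 'M[K]_m := diag_mx (\row_i p.@[evpt (wd i)]).

Lemma sn_pol_additive : {morph sn_pol : p q / p - q}.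
Proof.
move=> p q; apply/matrixP => i j; rewrite !mxE -mulrnBl.
by rewrite rmorphB.
Qed.

Lemma sn_pol_multiplicative : monoid_morphism sn_pol.
Proof.
split=> [|p q]; first by apply/matrixP => i j; rewrite !mxE meval1.
by rewrite -mulmxE mulmx_diag; congr diag_mx; apply/rowP => i; rewrite !mxE mevalM.
Qed.

HB.instance Definition _ := GRing.isZmodMorphism.Build {mpoly K[d]} 'M[K]_m sn_pol sn_pol_additive.
HB.instance Definition _ := GRing.isMonoidMorphism.Build {mpoly K[d]} 'M[K]_m sn_pol sn_pol_multiplicative.

Lemma rw_pol p (f : {mpoly K[d]}) (Phi : 'M[K]_(m, p)) w :
  rw (sn_pol f *m Phi) w = f.@[evpt w] *: rw Phi w.
Proof.
rewrite /rw scaler_sumr; apply: eq_bigr => i /eqP <-.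
by apply/rowP => j; rewrite mul_diag_mx !mxE.
Qed.

Definition al (x y : K) := (y - x)^-1.
Definition alw k w := al (cont (nth c0 w k)) (cont (nth c0 w k.+1)).

(** The normalization of the seminormal form without square roots: v_w goes to al v_w + (1 - al)
    v_(s w), with al the inverse difference of the two contents. If the swapped word is not
    standard, no index [j] carries it and the second term disappears. *)
Definition sn_swap k : 'M[K]_m := \matrix_(i, j)
  (alw k (wd i) *+ (i == j) + (1 - alw k (wd i)) *+ (wd j == swapw c0 k (wd i))).

Lemma rw_swap p k (Phi : 'M[K]_(m, p)) w :
  rw (sn_swap k *m Phi) w =
  if w \in L then alw k w *: rw Phi w + (1 - alw k w) *: rw Phi (swapw c0 k w) else 0.
Proof.
case: ifPn => [/wd_surj[i <-]|]; last exact: rw_out.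
rewrite !rw_wd; apply/rowP => j; rewrite !mxE summxE mulr_sumr.
under eq_bigr => x _ do rewrite mxE mulrDl.
rewrite big_split /= (bigD1 i) //= eqxx mulr1n big1 ?addr0; last first.
  by move=> x /negbTE xi; rewrite eq_sym xi mulr0n mul0r.
congr (_ + _); rewrite [RHS]big_mkcond; apply: eq_bigr => x _.
by case: ifP => _; rewrite ?mulr1n ?mulr0n ?mul0r // mxE.
Qed.

Lemma std_words_size w : w \in L -> size w = d.
Proof. by rewrite mem_std_words => /andP[_ /eqP]. Qed.

Lemma swapw_mem k w : (k < n)%N -> w \in L ->
  (swapw c0 k w \in L) = ~~ nb (nth c0 w k) (nth c0 w k.+1).
Proof.
move=> kn wL; have sw := std_words_size wL; move: wL; rewrite !mem_std_words size_swapw => /andP[+ ->].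
have [|p [q [ew sp]]] := @word_split _ c0 k w; first by rewrite sw ltnS.
move: (nth c0 w k) (nth c0 w k.+1) ew => a b ->; rewrite -sp swapw_cat andbT !std_cat.
by move=> /andP[-> h]; rewrite (std_swap h).
Qed.

Lemma std_words_neq1 k w : (k < n)%N -> w \in L -> nth c0 w k != nth c0 w k.+1.
Proof.
move=> kn wL; have sw := std_words_size wL; move: wL; rewrite !mem_std_words => /andP[+ _].
have [|p [q [ew sp]]] := @word_split _ c0 k w; first by rewrite sw ltnS.
move: (nth c0 w k) (nth c0 w k.+1) ew => a b ->; rewrite std_cat => /andP[_].
exact: std2_neq.
Qed.

Lemma std_words_split3 k w : (k.+1 < n)%N -> w \in L -> exists p q,
  w = p ++ [:: nth c0 w k, nth c0 w k.+1, nth c0 w k.+2 & q] /\ size p = k.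
Proof.
move=> kn /std_words_size sw; exists (take k w), (drop k.+3 w).
by rewrite size_takel ?sw //; [split => //; rewrite -!drop_nth ?cat_take_drop ?sw //; lia|lia].
Qed.

Lemma std_words_neq2 k w : (k.+1 < n)%N -> w \in L -> nth c0 w k != nth c0 w k.+2.
Proof.
move=> kn wL; have [p [q [ew sp]]] := std_words_split3 kn wL.
move: wL; rewrite mem_std_words => /andP[+ _].
move: (nth c0 w k) (nth c0 w k.+1) (nth c0 w k.+2) ew => a b c ->.
by rewrite std_cat => /andP[_]; exact: std3_neq.
Qed.

Lemma nth_swapw_lt k w i : w \in L -> (i < d)%N ->
  nth c0 (swapw c0 k w) i = nth c0 w (trn k i).
Proof. by move=> wL lt; rewrite nth_swapw // std_words_size. Qed.

Lemma trn_l k : trn k k = k.+1. Proof. by rewrite /trn eqxx. Qed.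
Lemma trn_r k : trn k k.+1 = k. Proof. by rewrite /trn eqxx; case: eqP => // ?; lia. Qed.
Lemma trn_o k i : i != k -> i != k.+1 -> trn k i = i.
Proof. by rewrite /trn => /negbTE -> /negbTE ->. Qed.

Lemma al_neg x y : al y x = - al x y :> K.
Proof. by rewrite /al -invrN opprB. Qed.

Lemma alw_swap k w : (k < n)%N -> w \in L -> alw k (swapw c0 k w) = - alw k w.
Proof.
by move=> kn wL; rewrite /alw !nth_swapw_lt ?trn_l ?trn_r 1?al_neg //; lia.
Qed.

(** For generic charges, contents differ by 1 only on neighbouring diagonals of one component. *)
Lemma nb_alw k w : (k < n)%N -> w \in L -> nb (nth c0 w k) (nth c0 w k.+1) = (alw k w ^+ 2 == 1).
Proof.
move=> kn wL; have := std_words_neq1 kn wL; rewrite cont_nb -(inj_eq cont_inj) /alw /al.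
move: (cont (nth c0 w k)) (cont (nth c0 w k.+1)) => x y xy.
have yx : y - x != 0 by rewrite subr_eq0 eq_sym.
have E : (x == y + 1) = (x - y - 1 == 0) by rewrite -addrA -opprD subr_eq0.
rewrite -subr_eq0 E.
have -> : y - (x + 1) = (y - x) - 1 by ring.
have -> : x - y - 1 = - ((y - x) + 1) by ring.
rewrite oppr_eq0 -mulf_eq0 exprVn -[RHS](inj_eq (mulfI (expf_neq0 2 yx))).
by rewrite mulfV ?expf_neq0 // mulr1 -[RHS]eq_sym -[RHS]subr_eq0; congr (_ == 0); ring.
Qed.

Lemma sn_swap_sq k : (k < n)%N -> sn_swap k * sn_swap k = 1.
Proof.
(* With the identity matrix as last factor, [rw_swap] computes products row by row. *)
move=> kn; rewrite -[LHS]mulr1 -mulrA; apply: rwP => w wL.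
rewrite -!mulmxE rw_swap wL !rw_swap wL swapw_mem // swapwK ?std_words_size //.
rewrite alw_swap //; have := nb_alw kn wL; case: ifPn => [_ _|].
  by apply/rowP => j; rewrite !mxE; ring.
rewrite negbK => nbw; rewrite nbw => /esym/eqP a1.
have -> : rw 1%:M (swapw c0 k w) = 0 :> 'rV_m by apply: rw_out; rewrite swapw_mem // nbw.
by rewrite !scaler0 !addr0 scalerA -expr2 a1 scale1r.
Qed.

Lemma alw_far k k' w : (k < n)%N -> w \in L -> k' != k -> k' != k.+1 -> k'.+1 != k -> (k' < n)%N ->
  alw k' (swapw c0 k w) = alw k' w.
Proof.
move=> kn wL h1 h2 h3 k'n; rewrite /alw !nth_swapw_lt //; try lia.
by rewrite !trn_o // eqSS.
Qed.

Lemma sn_swap_far k k' : (k.+1 < k')%N -> (k' < n)%N ->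
  sn_swap k * sn_swap k' = sn_swap k' * sn_swap k.
Proof.
move=> kk kn; have kn' : (k < n)%N by lia.
rewrite -[LHS]mulr1 -[RHS]mulr1 -!mulrA; apply: rwP => w wL.
rewrite -!mulmxE !rw_swap wL !swapw_mem //.
set u := rw _ w; set s := swapw c0 k w; set s' := swapw c0 k' w.
have -> : alw k' s = alw k' w by apply: alw_far => //; lia.
have -> : alw k s' = alw k w by apply: alw_far => //; lia.
have -> : swapw c0 k s' = swapw c0 k' s by apply: swapwC; rewrite ?std_words_size.
have e0 : nb (nth c0 w k) (nth c0 w k.+1) -> rw (1%:M : 'M_m) s = 0.
  by move=> h; apply: rw_out; rewrite swapw_mem // h.
have e0' : nb (nth c0 w k') (nth c0 w k'.+1) -> rw (1%:M : 'M_m) s' = 0.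
  by move=> h; apply: rw_out; rewrite swapw_mem // h.
have e1 : nb (nth c0 w k') (nth c0 w k'.+1) -> s \in L -> rw (1%:M : 'M_m) (swapw c0 k' s) = 0.
  move=> h sL; apply: rw_out; rewrite swapw_mem // !nth_swapw_lt ?trn_o ?h //; lia.
have e1' : nb (nth c0 w k) (nth c0 w k.+1) -> s' \in L -> rw (1%:M : 'M_m) (swapw c0 k' s) = 0.
  move=> h sL; rewrite -swapwC ?std_words_size //; apply: rw_out.
  by rewrite swapw_mem // !nth_swapw_lt ?trn_o ?h //; lia.
move: e1 e1'; rewrite !swapw_mem //.
case: (nb (nth c0 w k) _) e0 => e0; case: (nb (nth c0 w k') _) e0' => e0' e1 e1' /=.
- by rewrite e0 // e0' //; apply/rowP => j; rewrite !mxE; ring.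
- by rewrite e0 // e1' //; apply/rowP => j; rewrite !mxE; ring.
- by rewrite e0' // e1 //; apply/rowP => j; rewrite !mxE; ring.
by apply/rowP => j; rewrite !mxE; ring.
Qed.

Lemma sn_swap_sx k : (k < n)%N ->
  sn_swap k * sn_pol 'X_(inord k.+1) = sn_pol 'X_(inord k) * sn_swap k + 1.
Proof.
move=> kn; rewrite -[LHS]mulr1 -[RHS]mulr1 -mulrA mulrDl mul1r -mulrA; apply: rwP => w wL.
rewrite -!mulmxE rwD rw_pol !rw_swap wL !rw_pol !mevalXU /evpt !inordK //; try lia.
rewrite nth_swapw_lt ?trn_r //; have := std_words_neq1 kn wL.
rewrite -(inj_eq cont_inj) /alw /al; move: (cont (nth c0 w k)) (cont (nth c0 w k.+1)) => x y.
rewrite -subr_eq0 => xy; apply/rowP => j; rewrite !mxE.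
have yx : y - x != 0 by rewrite -oppr_eq0 opprB.
by field.
Qed.

Lemma sn_swap_sx_far k (x : 'I_d) : (k < n)%N -> x != k :> nat -> x != k.+1 :> nat ->
  sn_swap k * sn_pol 'X_x = sn_pol 'X_x * sn_swap k.
Proof.
move=> kn xk xk1; rewrite -[LHS]mulr1 -[RHS]mulr1 -!mulrA; apply: rwP => w wL.
rewrite -!mulmxE rw_pol !rw_swap wL !rw_pol !mevalXU /evpt.
rewrite nth_swapw_lt // trn_o // scalerDr !scalerA; congr (_ *: _ + _ *: _); ring.
Qed.

(* With [A = al x y], [B = al y z], [D = al x z] one has [A B = D (A + B)], and up to the
   relations [A^2 = 1], [B^2 = 1] in the degenerate cases both sides differ by a multiple of
   [A B - D (A + B)]. *)
Lemma braid_scalar (nab nbc nac : bool) (x y z f1 f2 f3 f4 f5 f6 : K) :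
  y - x != 0 -> z - y != 0 -> z - x != 0 ->
  (nab -> al x y ^+ 2 = 1) -> (nbc -> al y z ^+ 2 = 1) ->
  (nab -> f2 = 0) -> (nbc -> f3 = 0) -> (~~ nab -> nac -> f4 = 0) -> (~~ nbc -> nac -> f5 = 0) ->
  (~~ nac -> ~~ nbc -> nab -> f6 = 0) -> (~~ nac -> ~~ nab -> nbc -> f6 = 0) ->
  al x y * (al y z * (al x y * f1 + (1 - al x y) * f2) +
    (1 - al y z) * (if ~~ nbc then al x z * f3 + (1 - al x z) * f5 else 0)) +
  (1 - al x y) * (if ~~ nab then al x z * (al y x * f2 + (1 - al y x) * f1) +
    (1 - al x z) * (if ~~ nac then al y z * f4 + (1 - al y z) * f6 else 0) else 0) =
  al y z * (al x y * (al y z * f1 + (1 - al y z) * f3) +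
    (1 - al x y) * (if ~~ nab then al x z * f2 + (1 - al x z) * f4 else 0)) +
  (1 - al y z) * (if ~~ nbc then al x z * (al z y * f3 + (1 - al z y) * f1) +
    (1 - al x z) * (if ~~ nac then al x y * f5 + (1 - al x y) * f6 else 0) else 0).
Proof.
move=> yx zy zx; rewrite (al_neg x y) (al_neg y z).
have : al x y * al y z - al x z * (al x y + al y z) = 0.
  by rewrite /al; field; rewrite zx zy yx.
have : al x y + al y z != 0.
  have -> : al x y + al y z = (z - x) * (al x y * al y z) by rewrite /al; field; rewrite zy yx.
  by rewrite !mulf_neq0 ?invr_eq0.
move: (al x y) (al y z) (al x z) => A B D AB R0 hab hbc.
have gen : forall g1 g2 g3 : K, (g1 * (A - B) + g2 * (1 - A) - g3 * (1 - B)) * (A * B - D * (A + B)) = 0.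
  by move=> *; rewrite R0 mulr0.
case: nab nbc nac hab hbc => [] [] nac //= hab hbc h2 h3 h4 h5 h6 h7.
- have e : A = B.
    apply/eqP; rewrite -subr_eq0 -(inj_eq (mulIf AB)) mul0r -subr_sqr hab // hbc //.
    by rewrite subrr.
  by rewrite h2 // h3 // e; ring.
- rewrite h2 //; apply/eqP; rewrite -subr_eq0 -[X in _ == X](gen f1 0 f3).
  rewrite -subr_eq0; have a2 : A ^+ 2 - 1 = 0 by rewrite hab // subrr.
  rewrite -[X in _ == X](mulr0 (D * f1)) -[X in _ == _ * X]a2.
  by clear h4 h7; case: nac h5 h6 => /= h5 h6; [rewrite h5 //|rewrite h6 //]; apply/eqP; ring.
- rewrite h3 //; apply/eqP; rewrite -subr_eq0 -[X in _ == X](gen f1 f2 0).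
  rewrite -subr_eq0; have a2 : 1 - B ^+ 2 = 0 by rewrite hbc // subrr.
  rewrite -[X in _ == X](mulr0 (D * f1)) -[X in _ == _ * X]a2.
  by clear h5 h6; case: nac h4 h7 => /= h4 h7; [rewrite h4 //|rewrite h7 //]; apply/eqP; ring.
apply/eqP; rewrite -subr_eq0 -[X in _ == X](gen f1 f2 f3).
by clear h6 h7; case: nac h4 h5 => /= h4 h5; [rewrite h4 // h5 //|]; apply/eqP; ring.
Qed.

Lemma alw_cat p a b q : alw (size p) (p ++ [:: a, b & q]) = al (cont a) (cont b).
Proof. by rewrite /alw !nth_cat ltnn subnn ltnNge leqnSn /= subSnn. Qed.

Lemma alw_cat1 p a b c q : alw (size p).+1 (p ++ [:: a, b, c & q]) = al (cont b) (cont c).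
Proof. by have := alw_cat (rcons p a) b c q; rewrite size_rcons cat_rcons. Qed.

Lemma swapw_cat1 p a b c q :
  swapw c0 (size p).+1 (p ++ [:: a, b, c & q]) = p ++ [:: a, c, b & q].
Proof. by have := swapw_cat c0 (rcons p a) b c q; rewrite size_rcons !cat_rcons. Qed.

Lemma std_words_swap p a b q : p ++ [:: a, b & q] \in L ->
  (p ++ [:: b, a & q] \in L) = ~~ nb a b.
Proof.
rewrite !mem_std_words !std_cat !size_cat => /andP[/andP[-> h] ->].
by rewrite (std_swap h) andbT.
Qed.

Lemma std_words_swap1 p a b c q : p ++ [:: a, b, c & q] \in L ->
  (p ++ [:: a, c, b & q] \in L) = ~~ nb b c.
Proof. by have := @std_words_swap (rcons p a) b c q; rewrite !cat_rcons. Qed.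

(** Only the six arrangements of three consecutive letters are involved. The hypotheses of
    [braid_scalar] record which of them fail to be standard. *)
Lemma sn_swap_braid k : (k.+1 < n)%N ->
  sn_swap k * sn_swap k.+1 * sn_swap k = sn_swap k.+1 * sn_swap k * sn_swap k.+1.
Proof.
move=> kn; rewrite -[LHS]mulr1 -[RHS]mulr1 -!mulrA; apply: rwP => w wL.
have := std_words_neq1 (ltnW kn) wL; have := std_words_neq1 kn wL; have := std_words_neq2 kn wL.
have := nb_alw kn wL; have := nb_alw (ltnW kn) wL.
have [p [q []]] := std_words_split3 kn wL.
move: (nth c0 w k) (nth c0 w k.+1) (nth c0 w k.+2) => a b c ew sp; subst w k.
rewrite alw_cat alw_cat1 -!(inj_eq cont_inj) => nab nbc ac bc ab.
rewrite -!mulmxE !rw_swap wL.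
rewrite !(swapw_cat, swapw_cat1, alw_cat, alw_cat1).
rewrite (std_words_swap wL) (std_words_swap1 wL).
have m4 : ~~ nb a b -> (p ++ [:: b, c, a & q] \in L) = ~~ nb a c.
  by move=> h; rewrite (@std_words_swap1 p b a c) // std_words_swap.
have m5 : ~~ nb b c -> (p ++ [:: c, a, b & q] \in L) = ~~ nb a c.
  by move=> h; rewrite (@std_words_swap p a c) // std_words_swap1.
have m6 : ~~ nb a b -> ~~ nb a c -> (p ++ [:: c, b, a & q] \in L) = ~~ nb b c.
  by move=> h h'; rewrite (@std_words_swap p b c) // m4.
have m6' : ~~ nb b c -> ~~ nb a c -> (p ++ [:: c, b, a & q] \in L) = ~~ nb a b.
  by move=> h h'; rewrite (@std_words_swap1 p c a b) // m5.
apply/rowP => j.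
pose X v := (rw (1%:M : 'M_m) v) 0 j.
have h0 v x : (v \in L) = ~~ x -> x -> X v = 0 by move=> e h; rewrite /X rw_out ?mxE // e h.
have sub0 (x y : K) : x != y -> y - x != 0 by rewrite subr_eq0 eq_sym.
have := @braid_scalar (nb a b) (nb b c) (nb a c) _ _ _ (X (p ++ [:: a, b, c & q]))
  (X (p ++ [:: b, a, c & q])) (X (p ++ [:: a, c, b & q])) (X (p ++ [:: b, c, a & q]))
  (X (p ++ [:: c, a, b & q])) (X (p ++ [:: c, b, a & q])) (sub0 _ _ ab) (sub0 _ _ bc) (sub0 _ _ ac)
  (fun h => eqP (etrans (esym nab) h)) (fun h => eqP (etrans (esym nbc) h))
  (h0 _ _ (std_words_swap wL)) (h0 _ _ (std_words_swap1 wL)) (fun h => h0 _ _ (m4 h))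
  (fun h => h0 _ _ (m5 h)) (fun h h' => h0 _ _ (m6' h' h)) (fun h h' => h0 _ _ (m6 h' h)).
case: (boolP (nb a b)) m4 => n1 m4; case: (boolP (nb b c)) m5 => n2 m5 /=; rewrite ?m4 ?m5 //;
  case: (nb a c) => /= => e; rewrite !mxE //.
Qed.
End Seminormal.

(** * Multipartitions as shapes *)

Lemma iota0S k : iota 0 k.+1 = iota 0 k ++ [:: k].
Proof. by rewrite -addn1 iotaD add0n. Qed.

Section Shapes.
Variables (l d : nat).
Local Notation M := (d + d)%N.
Local Notation C := (letter l M).
Implicit Types (r : 'I_l) (s : seq nat) (S : {set C}).
Local Open Scope nat_scope.

Lemma pos_inord r p : p <= M -> pos ((r, inord p) : C) = p.
Proof. by move=> h; rewrite /pos /= inordK. Qed.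

(** The boxes of one row push a single bead from p to p + k. *)
Definition row_word r (p k : nat) : seq C := [seq (r, inord (j + p.+1)) | j <- iota 0 k].

Lemma row_word_std S r p k : p + k <= M -> (r, inord p) \in S ->
  (forall x, 0 < x <= k -> (r, inord (p + x)) \notin S) ->
  std S (row_word r p k) /\ forall c : C, (c \in fin S (row_word r p k)) =
    (c == (r, inord (p + k))) || (c != (r, inord p)) && (c \in S).
Proof.
elim: k => [|k IH] le pS free.
  split=> // c; rewrite addn0; case: eqP => [->|] //=.
have [||stk fink] := IH _ pS; [by lia|by move=> x h; apply: free; lia|].
rewrite /row_word iota0S map_cat std_cat fin_cat -/(row_word r p k) stk /= andbT.
set b : C := (r, inord (k + p.+1)).
have pb : pos b = (p + k).+1 by rewrite pos_inord; lia.
have prb : prevl b = (r, inord (p + k)) by rewrite /prevl pb.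
have kp : inord (p + k.+1) = inord (k + p.+1) :> 'I_M.+1 by congr inord; lia.
have bS : b \notin S by rewrite /b -kp; apply: free; lia.
have neq x y : x <= M -> y <= M -> x != y -> ((r, inord x) : C) != (r, inord y).
  by move=> hx hy; apply: contraNneq => /(congr1 (@pos _ _)); rewrite !pos_inord // => ->.
split.
  rewrite /addable pb prb !fink eqxx /= (negbTE bS) andbF orbF.
  by apply: neq; lia.
move=> c; rewrite in_move prb fink kp -/b.
have [//|cb] /= := eqVneq c b.
have [->|cp] := eqVneq c (r, inord (p + k)) => //=.
have [e0|k0] := posnP k.
  by rewrite e0 addn0 eqxx.
by rewrite (negbTE (free k _)) ?andbF //; lia.
Qed.

(** The beta numbers of a partition, for d beads. *)
Definition beta s : seq nat := [seq (d.-1 - i + nth 0 s i)%N | i <- iota 0 d].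

Lemma beta_rcons s k y : size s < d ->
  (y \in beta (rcons s k)) = (y == d.-1 - size s + k) || (y != d.-1 - size s) && (y \in beta s).
Proof.
move=> sd; have sn : nth 0 s (size s) = 0 by rewrite nth_default.
apply/mapP/orP => [[i]|[/eqP ->|/andP[ny /mapP[i]]]].
- rewrite mem_iota add0n => /= id ->; rewrite nth_rcons.
  case: (ltngtP i (size s)) => [lt|gt|->]; last by left.
    right; apply/andP; split; first by apply/eqP; lia.
    by apply/mapP; exists i => //; rewrite mem_iota.
  right; apply/andP; split; first by apply/eqP; lia.
  by apply/mapP; exists i; rewrite ?mem_iota // nth_default // ltnW.
- by exists (size s); rewrite ?mem_iota // nth_rcons ltnn eqxx.
rewrite mem_iota add0n => /= id ey; exists i; rewrite ?mem_iota // nth_rcons ey.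
case: (ltngtP i (size s)) => [//|gt|e]; first by rewrite nth_default // ltnW.
by rewrite ey e sn addn0 eqxx in ny.
Qed.

Definition part_word r s : seq C :=
  [seq (r, inord (j + d - i)) | i <- iota 0 (size s), j <- iota 0 (nth 0 s i)].

Lemma part_word_rcons r s k : size s < d ->
  part_word r (rcons s k) = part_word r s ++ row_word r (d.-1 - size s) k.
Proof.
move=> sd; rewrite /part_word size_rcons iota0S map_cat flatten_cat /= cats0.
rewrite nth_rcons ltnn eqxx; congr (_ ++ _).
  congr flatten; apply/eq_in_map => i; rewrite mem_iota => /= lt.
  by rewrite nth_rcons lt.
by apply: eq_map => j; congr (_, inord _); lia.
Qed.

Definition on_runner S r s := forall p, p <= M -> ((r, inord p) \in S) = (p \in beta s).

(** The bead of the next row starts at d - 1 - [size s]. Its way is free because the new part is not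
    larger than the previous ones. *)
Lemma part_word_std S r s : size s <= d -> (forall k, k \in s -> k <= d) -> sorted geq s ->
  on_runner S r [::] ->
  [/\ std S (part_word r s), on_runner (fin S (part_word r s)) r s
    & forall c : C, c.1 != r -> (c \in fin S (part_word r s)) = (c \in S)].
Proof.
elim/last_ind: s => [|s k IH] sd kd ss S0; first by split.
rewrite size_rcons in sd.
have sds : size s <= d by exact: ltnW.
have kds x : x \in s -> x <= d by move=> h; apply: kd; rewrite mem_rcons inE h orbT.
have kdk : k <= d by apply: kd; rewrite mem_rcons mem_head.
have ge_k x : x \in s -> k <= x.
  move: ss; rewrite sorted_pairwise; last by move=> x' y' z' h1 h2; exact: leq_trans h2 h1.
  by rewrite -cats1 pairwise_cat allrel1r => /and3P[/allP h _ _] /h.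
have sss : sorted geq s by move: ss; rewrite -cats1; apply: (subseq_sorted _ (prefix_subseq _ _)) => x y z h1 h2; exact: leq_trans h2 h1.
have [st on oth] := IH sds kds sss S0.
rewrite part_word_rcons // std_cat fin_cat st.
have le : d.-1 - size s + k <= M by lia.
have pin : (r, inord (d.-1 - size s)) \in fin S (part_word r s).
  rewrite on; last by lia.
  by apply/mapP; exists (size s); rewrite ?mem_iota // nth_default // addn0.
have free x : 0 < x <= k -> (r, inord (d.-1 - size s + x)) \notin fin S (part_word r s).
  move=> xk; rewrite on; last by lia.
  apply/mapP => -[i]; rewrite mem_iota add0n => /= id.
  case: (ltnP i (size s)) => [lt|ge].
    by have gk : k <= nth 0 s i := ge_k _ (mem_nth 0 lt); lia.
  by rewrite nth_default // => e; lia.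
have [st2 fin2] := row_word_std le pin free.
split=> //.
  move=> p pM; rewrite fin2 beta_rcons // -on //.
  have eqr x : x <= M -> ((r, inord p) == (r, inord x) :> C) = (p == x).
    by move=> xM; rewrite letter_eq eqxx !pos_inord.
  by rewrite !eqr //; lia.
move=> c cr; rewrite fin2 oth //.
have neqc x : (c == (r, inord x)) = false by apply/eqP => e; rewrite e eqxx in cr.
by rewrite !neqc.
Qed.

Lemma beta_nil y : (y \in beta [::]) = (y < d).
Proof.
apply/mapP/idP => [[i]|lt]; first by rewrite mem_iota nth_nil => /= h ->; lia.
by exists (d.-1 - y); rewrite ?mem_iota ?nth_nil; lia.
Qed.

(** The beta numbers are strictly decreasing, so their set determines their list and thus the parts
    padded by zeros; the absence of zero parts fixes the length. *)
Lemma beta_inj s s' : is_partition s -> is_partition s' -> size s <= d -> size s' <= d ->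
  beta s =i beta s' -> s = s'.
Proof.
move=> /andP[ss s0] /andP[ss' s0'] sd sd' e.
have geq_tr : transitive geq by move=> x y z h1 h2; exact: leq_trans h2 h1.
have gtn_tr : transitive gtn by move=> x y z h1 h2; exact: ltn_trans h2 h1.
have nth_mono u i j : sorted geq u -> i <= j -> nth 0 u j <= nth 0 u i.
  move=> su ij; case: (ltnP j (size u)) => [lt|ge]; last by rewrite (nth_default _ ge).
  have : geq (nth 0 u i) (nth 0 u j); last by [].
  by apply: (sorted_leq_nth geq_tr) => //; rewrite ?inE; [move=> x /=|lia].
have sb u : sorted geq u -> sorted gtn (beta u).
  move=> su; rewrite sorted_pairwise // pairwise_map.
  apply: (sub_in_pairwise (P := fun i => i < d) (r := ltn)); last first.
  - by rewrite -sorted_pairwise; [exact: iota_ltn_sorted|exact: ltn_trans].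
  - by apply/allP => i; rewrite mem_iota.
  move=> i j id jd /= ij; have := nth_mono u i j su (ltnW ij).
  by rewrite unfold_in /= in id jd; lia.
have eb : beta s = beta s'.
  apply: (irr_sorted_eq gtn_tr) => //; [by move=> x; rewrite /= ltnn|exact: sb|exact: sb].
have en i : i < d -> nth 0 s i = nth 0 s' i.
  move=> id; have := congr1 (fun u => nth 0 u i) eb.
  by rewrite !(nth_map 0) ?size_iota // !nth_iota // => /addnI.
have szle u v : 0 \notin u -> size u <= d -> (forall i, i < d -> nth 0 u i = nth 0 v i) ->
    size u <= size v.
  move=> u0 ud h; rewrite leqNgt; apply/negP => lt; have := h (size v) (leq_trans lt ud).
  rewrite [RHS]nth_default // => z; move: u0; rewrite -z mem_nth //.
have sz : size s = size s'.
  by apply/eqP; rewrite eqn_leq !szle // => i id; rewrite en.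
by apply: (eq_from_nth (x0 := 0) sz) => i lt; apply: en; exact: leq_trans lt sd.
Qed.

Definition multi_word (la : multiseq l d) : seq C :=
  flatten [seq part_word r (component la r) | r <- enum 'I_l].

Lemma component_bounds (la : multiseq l d) r :
  size (component la r) <= d /\ forall k, k \in component la r -> k <= d.
Proof.
split; first by rewrite size_map; exact: size_bseq.
by move=> k /mapP[x _ ->]; rewrite -ltnS.
Qed.

Lemma multi_word_std (la : multiseq l d) : is_multipartition la ->
  std (beads l M d) (multi_word la) /\
  forall r, on_runner (fin (beads l M d) (multi_word la)) r (component la r).
Proof.
move=> /andP[/forallP pla _]; rewrite /multi_word.
suff h (rs : seq 'I_l) S : uniq rs -> (forall r, r \in rs -> on_runner S r [::]) ->
  [/\ std S (flatten [seq part_word r (component la r) | r <- rs]),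
    forall r, r \in rs ->
      on_runner (fin S (flatten [seq part_word r (component la r) | r <- rs])) r (component la r)
    & forall c : C, c.1 \notin rs ->
      (c \in fin S (flatten [seq part_word r (component la r) | r <- rs])) = (c \in S)].
  have [|h1 h2 _] := h (enum 'I_l) (beads l M d) (enum_uniq _).
  - by move=> r _ p pM; rewrite beta_nil inE pos_inord.
  - by split=> // r; apply: h2; rewrite mem_enum.
elim: rs S => [|r rs IH] S /=; first by move=> _ _; split.
move=> /andP[rrs urs] hS.
have [sz bd] := component_bounds la r; have /andP[so _] := pla r.
have [st on oth] := part_word_std sz bd so (hS r (mem_head _ _)).
have [|st2 on2 oth2] := IH (fin S (part_word r (component la r))) urs.
  move=> r' r'rs p pM; rewrite oth; first by apply: hS => //; rewrite inE r'rs orbT.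
  by apply: contraNneq rrs => /= <-.
split; first by rewrite std_cat st.
  move=> r'; rewrite inE fin_cat => /orP[/eqP ->|]; last exact: on2.
  by move=> p pM; rewrite oth2 // on.
by move=> c; rewrite inE negb_or fin_cat => /andP[cr crs]; rewrite oth2 // oth.
Qed.

Lemma size_multi_word (la : multiseq l d) : is_multipartition la -> size (multi_word la) = d.
Proof.
move=> /andP[_ /eqP h]; rewrite -[RHS]h size_flatten /shape -map_comp sumnE big_map big_enum /=.
apply: eq_bigr => r _ /=; rewrite size_allpairs_dep.
set s := component la r.
have es : [seq nth 0 s i | i <- iota 0 (size s)] = s by rewrite map_nth_iota0 ?take_size.
rewrite -[RHS]/(sumn s) -[in RHS]es.
by congr sumn; apply: eq_map => i; rewrite size_iota.
Qed.

Lemma multi_word_inj (la mu : multiseq l d) : is_multipartition la -> is_multipartition mu ->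
  fin (beads l M d) (multi_word la) = fin (beads l M d) (multi_word mu) -> la = mu.
Proof.
move=> hla hmu e; have [_ ola] := multi_word_std hla; have [_ omu] := multi_word_std hmu.
apply/ffunP => r; apply: val_inj.
have : component la r = component mu r.
  have [sz1 bd1] := component_bounds la r; have [sz2 bd2] := component_bounds mu r.
  move: hla hmu => /andP[/forallP/(_ r) p1 _] /andP[/forallP/(_ r) p2 _].
  apply: beta_inj => // y; case: (leqP y M) => yM; first by rewrite -ola // -omu // e.
  have no s : (forall k, k \in s -> k <= d) -> (y \in beta s) = false.
    move=> bd; apply/mapP => -[i]; rewrite mem_iota => /= id ey.
    case: (ltnP i (size s)) => [lt|ge]; last by rewrite nth_default // in ey; lia.
    by have gk : nth 0 s i <= d := bd _ (mem_nth 0 lt); lia.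
  by rewrite !no.
by move/(inj_map val_inj).
Qed.

End Shapes.

(** * Independence in the quotient by base change *)

Section MonomialExtension.
Variables (F : fieldType) (d N : nat) (g : 'X_{1..d} -> 'M[F]_N).
Hypotheses (g0 : g 0%MM = 1) (gD : forall m1 m2, g (m1 + m2)%MM = g m1 * g m2).

(** Matrices do not commute, but the values of [g] do, since [gD] makes [g] multiplicative on a
    commutative monoid; so the linear extension is a ring morphism. *)
Definition mext (p : {mpoly F[d]}) : 'M[F]_N := \sum_(m <- msupp p) p@_m *: g m.

Lemma mextE p k : (msize p <= k)%N -> mext p = \sum_(m : 'X_{1..d < k}) p@_m *: g m.
Proof.
move=> le; set I : subFinType _ := 'X_{1..d < k}.
rewrite /mext (big_mksub I) ?msupp_uniq //=; first last.
  by move=> x /msize_mdeg_lt /leq_trans; apply.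
rewrite big_rmcond //= => j /memN_msupp_eq0 ->.
by rewrite scale0r.
Qed.

Lemma mext_additive : {morph mext : p q / p - q}.
Proof.
move=> p q; pose k := maxn (msize p) (maxn (msize q) (msize (p - q))).
rewrite !(@mextE _ k) ?leq_max ?leqnn ?orbT // -sumrB; apply: eq_bigr => m _.
by rewrite mcoeffB scalerBl.
Qed.

HB.instance Definition _ := GRing.isZmodMorphism.Build {mpoly F[d]} 'M[F]_N mext mext_additive.

Lemma mextZ c p : mext (c *: p) = c *: mext p.
Proof.
pose k := maxn (msize p) (msize (c *: p)).
rewrite !(@mextE _ k) ?leq_max ?leqnn ?orbT // scaler_sumr; apply: eq_bigr => m _.
by rewrite mcoeffZ scalerA.
Qed.

Lemma mextX m : mext 'X_[m] = g m.
Proof. by rewrite /mext msuppX big_seq1 mcoeffX eqxx scale1r. Qed.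

Lemma mext_multiplicative : monoid_morphism mext.
Proof.
split=> [|p q]; first by rewrite -mpolyX0 mextX.
rewrite [p]mpolyE mulr_suml !raddf_sum /= mulr_suml; apply: eq_bigr => m _.
rewrite -scalerAl !mextZ mextX -mulmxE -scalemxAl; congr (_ *: _).
have -> : mext ('X_[m] * q) = \sum_(m' <- msupp q) q@_m' *: g (m + m')%MM.
  rewrite {1}[q]mpolyE mulr_sumr raddf_sum; apply: eq_bigr => m' _ /=.
  by rewrite -scalerAr mextZ -mpolyXD mextX.
by rewrite /mext mulmx_sumr; apply: eq_bigr => m' _; rewrite gD -mulmxE scalemxAr.
Qed.

HB.instance Definition _ := GRing.isMonoidMorphism.Build {mpoly F[d]} 'M[F]_N mext mext_multiplicative.
End MonomialExtension.

(** * The left regular representation over R and its base change *)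

Section Regular.
Variables (R : comNzRingType) (E : pzRingType) (d l : nat).
Variables (P : {rmorphism {mpoly R[d]} -> E}) (W : 'S_d -> E).
Hypothesis HD : hecke_datum P W.
Variables (hd : (0 < d)%N) (q : 'I_l -> R).
Hypothesis Pq : P (cyclo hd q) = 0.
Local Notation B := (basis_index d l).
Local Notation lc := (lincomb (l := l) P W).
Hypothesis lc_inj : forall c : {ffun B -> R}, lc c = 0 -> c = 0.

Definition lrep (e : E) (L : 'M[R]_#|B|) :=
  forall j, e * bas P W (enum_val j) = lc [ffun b => L (enum_rank b) j].

Lemma lc_sum (c : {ffun B -> R}) : lc c = \sum_(j < #|B|) P (c (enum_val j))%:MP * bas P W (enum_val j).
Proof.
rewrite /lincomb (reindex (fun k : 'I_#|B| => enum_val k : B)) //.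
exact/onW_bij/enum_val_bij.
Qed.

Lemma lc_eq (c c' : {ffun B -> R}) : lc c = lc c' -> c = c'.
Proof.
by move=> e; apply/eqP; rewrite -subr_eq0; apply/eqP/lc_inj; rewrite lincombB e subrr.
Qed.

Lemma lrep_inj e L L' : lrep e L -> lrep e L' -> L = L'.
Proof.
move=> h h'; apply/matrixP => i j; have := lc_eq (etrans (esym (h j)) (h' j)).
by move/ffunP/(_ (enum_val i)); rewrite !ffunE !enum_valK.
Qed.

Lemma lrep_lc e L (c : {ffun B -> R}) : lrep e L ->
  e * lc c = lc [ffun b => \sum_(j < #|B|) L (enum_rank b) j * c (enum_val j)].
Proof.
move=> h; rewrite lc_sum mulr_sumr.
under eq_bigr => j _ do rewrite mulrA -(hd_central HD) -mulrA h -lincombZ.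
pose G j : {ffun B -> R} := [ffun b => c (enum_val j) * [ffun b' => L (enum_rank b') j] b].
have -> : \sum_j lc (G j) = lc (\sum_j G j).
  by elim/big_rec2: _ => [|j y z _ ->]; rewrite ?lincomb0 ?lincombD.
congr lincomb; apply/ffunP => b; rewrite sum_ffunE ffunE; apply: eq_bigr => j _.
by rewrite !ffunE mulrC.
Qed.

Lemma lrepM e f L L' : lrep e L -> lrep f L' -> lrep (e * f) (L * L').
Proof.
move=> h h' j; rewrite -mulrA h' (lrep_lc _ h); congr lincomb; apply/ffunP => b.
by rewrite !ffunE -mulmxE mxE; apply: eq_bigr => k _; rewrite ffunE enum_valK.
Qed.

Lemma lrepD e f L L' : lrep e L -> lrep f L' -> lrep (e + f) (L + L').
Proof.
move=> h h' j; rewrite mulrDl h h' -lincombD; congr lincomb; apply/ffunP => b.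
by rewrite !ffunE mxE.
Qed.

Lemma lrep_scal r : lrep (P r%:MP) r%:M.
Proof.
move=> j; rewrite -lincomb_delta -lincombZ; congr lincomb; apply/ffunP => b.
by rewrite !ffunE mxE -(inj_eq enum_rank_inj) enum_valK mulr_natr.
Qed.

Lemma lrep1 : lrep 1 1.
Proof. by have := lrep_scal 1; rewrite mpolyC1 rmorph1. Qed.

Lemma lrep_exists e : reducible l P W e -> exists L, lrep e L.
Proof.
move=> re; have [co coK] := exists_coord lc_inj.
exists (\matrix_(i, j) co (e * bas P W (enum_val j)) (enum_val i)) => j.
have [c hc] : reducible l P W (e * bas P W (enum_val j)).
  by apply: (reducibleM HD Pq) => //; exact: reducible_bas.
by rewrite hc; congr lincomb; apply/ffunP => b; rewrite ffunE mxE enum_rankK hc coK.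
Qed.

Definition Lmat (e : E) : 'M[R]_#|B| := epsilon (inhabits 0) (lrep e).

Lemma LmatP e : reducible l P W e -> lrep e (Lmat e).
Proof. by move=> /lrep_exists; exact: epsilon_spec. Qed.

Lemma Lmat_eq e L : lrep e L -> Lmat e = L.
Proof. by move=> h; apply: lrep_inj (epsilon_spec _ _ (ex_intro _ L h)) h. Qed.

Let redP p : reducible l P W (P p). Proof. exact: (reducible_pol HD Pq). Qed.
Let redW w : reducible l P W (W w). Proof. exact: (reducible_perm HD Pq). Qed.
Lemma LmatM e f : reducible l P W e -> reducible l P W f -> Lmat (e * f) = Lmat e * Lmat f.
Proof. by move=> re rf; apply: Lmat_eq; apply: lrepM; apply: LmatP. Qed.

Lemma LmatD e f : reducible l P W e -> reducible l P W f -> Lmat (e + f) = Lmat e + Lmat f.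
Proof. by move=> re rf; apply: Lmat_eq; apply: lrepD; apply: LmatP. Qed.

Lemma Lmat1 : Lmat 1 = 1. Proof. exact/Lmat_eq/lrep1. Qed.

Section BaseChange.
Variables (F : fieldType) (phi : {rmorphism R -> F}).
Local Notation N := #|B|.

Definition bc_mono (m : 'X_{1..d}) : 'M[F]_N := map_mx phi (Lmat (P 'X_[m])).

Lemma bc_mono0 : bc_mono 0%MM = 1.
Proof. by rewrite /bc_mono mpolyX0 rmorph1 Lmat1 -[1 in LHS]/(1%:M) map_scalar_mx rmorph1. Qed.

Lemma bc_monoD m1 m2 : bc_mono (m1 + m2)%MM = bc_mono m1 * bc_mono m2.
Proof. by rewrite /bc_mono mpolyXD rmorphM LmatM // -mulmxE map_mxM. Qed.

Definition bc_pol : {mpoly F[d]} -> 'M[F]_N := mext bc_mono.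
HB.instance Definition _ := GRing.Additive.on bc_pol.
HB.instance Definition _ := GRing.isMonoidMorphism.Build {mpoly F[d]} 'M[F]_N bc_pol
  (mext_multiplicative bc_mono0 bc_monoD).

Definition bc_perm (w : 'S_d) : 'M[F]_N := map_mx phi (Lmat (W w)).

Lemma bc_polE (p : {mpoly R[d]}) : bc_pol (map_mpoly phi p) = map_mx phi (Lmat (P p)).
Proof.
have -> : map_mpoly phi p = \sum_(m <- msupp p) map_mpoly phi (p@_m *: 'X_[m]).
  by rewrite {1}[p]mpolyE raddf_sum.
have -> : P p = \sum_(m <- msupp p) P (p@_m *: 'X_[m]).
  by rewrite {1}[p]mpolyE raddf_sum.
have -> : Lmat (\sum_(i <- msupp p) P (p@_i *: 'X_[i])) = \sum_(i <- msupp p) Lmat (P (p@_i *: 'X_[i])).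
  elim: (msupp p) => [|m s IH]; last first.
    rewrite !big_cons LmatD ?IH //; apply: reducible_sum => x _; exact: redP.
  rewrite !big_nil; apply: Lmat_eq => j; rewrite mul0r -(lincomb0 l P W); congr lincomb.
  by apply/ffunP => b; rewrite !ffunE mxE.
rewrite !raddf_sum; apply: eq_bigr => m _ /=.
rewrite map_mpolyZ map_mpolyX /bc_pol mextZ mextX /bc_mono.
rewrite -mul_mpolyC rmorphM LmatM // -mulmxE map_mxM.
by rewrite (Lmat_eq (lrep_scal _)) map_scalar_mx mul_scalar_mx.
Qed.

Lemma bc_polC c : bc_pol c%:MP = c%:M.
Proof.
by rewrite -[c%:MP]mulr1 mul_mpolyC /bc_pol mextZ -mpolyX0 mextX bc_mono0 -[1]/(1%:M) scalemx1.
Qed.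

Lemma bc_polX k : bc_pol 'X_k = map_mx phi (Lmat (P 'X_k)).
Proof. exact: mextX. Qed.

Lemma bc_datum : hecke_datum bc_pol bc_perm.
Proof.
split.
- by move=> c e; rewrite bc_polC -!mulmxE; apply/esym/scalar_mxC.
- by rewrite /bc_perm (hd_perm1 HD) Lmat1 -[1 in LHS]/(1%:M) map_scalar_mx rmorph1.
- by move=> u w; rewrite /bc_perm (hd_permM HD) LmatM // -mulmxE map_mxM.
- move=> i j ij; rewrite !bc_polX /bc_perm -mulmxE -!map_mxM !mulmxE -!LmatM //.
  rewrite (hd_sx HD ij) LmatD ?Lmat1 //; first last.
  + by have := redP 1; rewrite rmorph1.
  + by apply: (reducibleM HD Pq).
  by rewrite map_mxD -[1 in LHS]/(1%:M) map_scalar_mx rmorph1.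
move=> i j k ij ki kj; rewrite !bc_polX /bc_perm -mulmxE -!map_mxM !mulmxE -!LmatM //.
by rewrite (hd_sx_far HD ij).
Qed.

Lemma bc_cyclo : bc_pol (cyclo hd (fun r => phi (q r))) = 0.
Proof.
have -> : cyclo hd (fun r => phi (q r)) = map_mpoly phi (cyclo hd q).
  rewrite /cyclo rmorph_prod; apply: eq_bigr => r _.
  by rewrite rmorphB /= map_mpolyX map_mpolyC.
rewrite bc_polE Pq; have := lrep_scal 0; rewrite mpolyC0 rmorph0 => /Lmat_eq ->.
by rewrite map_scalar_mx rmorph0 raddf0.
Qed.

Hypothesis hl : (0 < l)%N.

(** In the matrix of a basis element, the column belonging to the unit is a standard unit vector,
    and this survives every specialization. *)
Lemma bc_lincomb_inj (c : {ffun B -> F}) : lincomb bc_pol bc_perm c = 0 -> c = 0.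
Proof.
pose b0 : B := ([ffun=> Ordinal hl], 1%g).
have bas0 : bas P W b0 = 1.
  rewrite /bas (hd_perm1 HD) mulr1 (_ : expo _ = 0%MM) ?mpolyX0 ?rmorph1 //.
  by apply/mnmP => i; rewrite mnmE ffunE mnm0E.
have col (b : B) i : bas bc_pol bc_perm b i (enum_rank b0) = (i == enum_rank b)%:R.
  have bcX mu : bc_pol 'X_[mu] = bc_mono mu := mextX bc_mono mu.
  rewrite /bas /= bcX /bc_mono /bc_perm -mulmxE -map_mxM mulmxE -LmatM //.
  rewrite mxE; have := LmatP (reducible_bas P W b) (enum_rank b0).
  rewrite enum_rankK bas0 mulr1 => e.
  have /ffunP/(_ (enum_val i)) := lc_eq (etrans (lincomb_delta P W b) e).
  rewrite !ffunE enum_valK -/(bas P W b) => <-.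
  by rewrite rmorph_nat -(inj_eq enum_rank_inj) enum_valK.
move=> h; apply/ffunP => b.
have := congr1 (fun X : 'M_N => X (enum_rank b) (enum_rank b0)) h.
rewrite /lincomb summxE (bigD1 b) //= big1 ?addr0 => [|b' bb'].
  rewrite [RHS]mxE => e; rewrite ffunE -[RHS]e.
  by rewrite bc_polC -mulmxE mul_scalar_mx mxE col eqxx mulr1.
by rewrite bc_polC -mulmxE mul_scalar_mx mxE col (inj_eq enum_rank_inj) eq_sym (negbTE bb') mulr0.
Qed.
End BaseChange.
End Regular.

Section PairMorphism.
Variables (A E1 E2 : pzRingType) (f : {rmorphism A -> E1}) (g : {rmorphism A -> E2}).

Definition pairm (x : A) : E1 * E2 := (f x, g x).

Lemma pairm_additive : {morph pairm : x y / x - y}.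
Proof. by move=> x y; rewrite /pairm !rmorphB. Qed.

Lemma pairm_multiplicative : monoid_morphism pairm.
Proof. by split=> [|x y]; rewrite /pairm ?rmorph1 ?rmorphM. Qed.

HB.instance Definition _ := GRing.isZmodMorphism.Build A (E1 * E2)%type pairm pairm_additive.
HB.instance Definition _ := GRing.isMonoidMorphism.Build A (E1 * E2)%type pairm pairm_multiplicative.
End PairMorphism.

Lemma pair_sum (V1 V2 : nmodType) (I : finType) (f : I -> V1) (g : I -> V2) :
  \sum_i (f i, g i) = (\sum_i f i, \sum_i g i).
Proof.
rewrite [LHS]surjective_pairing (big_morph fst (id1 := 0) (op1 := +%R)) //.
by rewrite (big_morph snd (id1 := 0) (op1 := +%R)).
Qed.

Lemma pair_datum (R : comNzRingType) (d : nat) (E1 E2 : pzRingType)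
    (P1 : {rmorphism {mpoly R[d]} -> E1}) (P2 : {rmorphism {mpoly R[d]} -> E2})
    (W1 : 'S_d -> E1) (W2 : 'S_d -> E2) :
  hecke_datum P1 W1 -> hecke_datum P2 W2 ->
  hecke_datum (pairm P1 P2) (fun w => (W1 w, W2 w)).
Proof.
move=> h1 h2; split.
- move=> c [e1 e2]; congr (_, _); [exact: (hd_central h1)|exact: (hd_central h2)].
- by rewrite (hd_perm1 h1) (hd_perm1 h2).
- by move=> u w; rewrite (hd_permM h1) (hd_permM h2).
- by move=> i j ij; congr (_, _); [exact: (hd_sx h1)|exact: (hd_sx h2)].
by move=> i j k ij ki kj; congr (_, _); [exact: (hd_sx_far h1)|exact: (hd_sx_far h2)].
Qed.

Lemma map_datum (R S : comNzRingType) (d : nat) (E : pzRingType) (phi : {rmorphism R -> S})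
    (P : {rmorphism {mpoly S[d]} -> E}) (W : 'S_d -> E) :
  hecke_datum P W -> hecke_datum (P \o @map_mpoly d R S phi) W.
Proof.
move=> h; split=> /=.
- by move=> c e; rewrite map_mpolyC (hd_central h).
- exact: (hd_perm1 h).
- exact: (hd_permM h).
- by move=> i j ij; rewrite !map_mpolyX (hd_sx h).
by move=> i j k ij ki kj; rewrite !map_mpolyX (hd_sx_far h).
Qed.

Lemma map_cyclo (R S : comNzRingType) (d l : nat) (hd : (0 < d)%N) (phi : {rmorphism R -> S})
    (q : 'I_l -> R) : map_mpoly phi (cyclo hd q) = cyclo hd (fun r => phi (q r)).
Proof.
rewrite /cyclo rmorph_prod; apply: eq_bigr => r _.
by rewrite rmorphB /= map_mpolyX map_mpolyC.
Qed.

(** * The basis of the cyclotomic quotient *)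

Section Quotient.
Variables (F : fieldType) (d l : nat) (hd : (0 < d)%N) (q : l.-tuple F).
Variables (H : algType F) (HH : dAHA d H) (A : algType F) (pi : {lrmorphism H -> A}).
Hypothesis hpi : is_cyclotomic_quotient hd q HH pi.
Local Notation B := (basis_index d l).

Lemma dA_polC c : dA_pol HH c%:MP = c%:A.
Proof. by rewrite -[c%:MP]mulr1 mul_mpolyC linearZ /= rmorph1. Qed.

Lemma dAHA_datum : hecke_datum (dA_pol HH) (dA_perm HH).
Proof.
split.
- by move=> c e; rewrite dA_polC -scalerAl -scalerAr mul1r mulr1.
- exact: dA_perm1.
- exact: dA_permM.
- exact: dA_sx.
exact: dA_sx_far.
Qed.

Definition qpol : {mpoly F[d]} -> A := pi \o dA_pol HH.
HB.instance Definition _ := GRing.RMorphism.on qpol.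
Definition qperm (w : 'S_d) : A := pi (dA_perm HH w).

Lemma quotient_datum : hecke_datum qpol qperm.
Proof.
have h := dAHA_datum; rewrite /qpol /qperm; split=> /=.
- move=> c e; have [h' <-] := hpi.1 e; by rewrite -!rmorphM (hd_central h).
- by rewrite (hd_perm1 h) rmorph1.
- by move=> u w; rewrite (hd_permM h) rmorphM.
- by move=> i j ij; rewrite -rmorphM (hd_sx h ij) rmorphD rmorphM rmorph1.
by move=> i j k ij ki kj; rewrite -!rmorphM (hd_sx_far h ij).
Qed.

Lemma quotient_cyclo : qpol (cyclo hd (tnth q)) = 0.
Proof.
apply/(hpi.2 _); exists [:: (1, 1)]; rewrite big_seq1 /= mul1r mulr1.
by [].
Qed.

Lemma quotient_reducible (a : A) : reducible l qpol qperm a.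
Proof.
have [h <-] := hpi.1 a; have [c [-> _]] := dA_PBW HH h.
rewrite rmorph_sum; apply: reducible_sum => w _; rewrite rmorphM.
exact: (reducible_term quotient_datum quotient_cyclo).
Qed.

(* The elements [(P h, P' h)], for [h] in the affine algebra, form the graph of a homomorphism,
   because of the PBW decomposition; this homomorphism annihilates the cyclotomic ideal. *)
Lemma quotient_independent (N : nat) (P' : {rmorphism {mpoly F[d]} -> 'M[F]_N})
    (W' : 'S_d -> 'M[F]_N) :
  hecke_datum P' W' -> P' (cyclo hd (tnth q)) = 0 ->
  (forall c : {ffun B -> F}, lincomb P' W' c = 0 -> c = 0) ->
  forall c : {ffun B -> F}, lincomb qpol qperm c = 0 -> c = 0.
Proof.
move=> HD' P'q inj c; pose PP := pairm (dA_pol HH) P'.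
pose WW w := (dA_perm HH w, W' w).
have HDD : hecke_datum PP WW by apply: pair_datum HD' => //; exact: dAHA_datum.
pose G (e : H * 'M[F]_N) := exists m, pbw_span PP WW m e.
have GD e f : G e -> G f -> G (e + f).
  move=> [m he] [m' hf]; exists (maxn m m').
  by apply: pbw_spanD; [apply: pbw_span_leq he|apply: pbw_span_leq hf]; rewrite leq_max leqnn ?orbT.
have GM e f : G e -> G f -> G (e * f).
  by move=> [m he] [m' hf]; exists (m + m')%N; exact: (pbw_spanM HDD).
have sumE (k : {ffun 'S_d -> {mpoly F[d]}}) : \sum_w PP (k w) * WW w =
   (\sum_w dA_pol HH (k w) * dA_perm HH w, \sum_w P' (k w) * W' w).
  exact: pair_sum.
have G0 M : G (0, M) -> M = 0.
  move=> [m [k _]]; rewrite sumE => -[h0 ->].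
  have [k' [_ uk']] := dA_PBW HH 0.
  have e1 := uk' _ h0; have e2 : k' = 0.
    by apply: uk'; rewrite big1 // => w _; rewrite ffunE rmorph0 mul0r.
  by rewrite -e1 e2 big1 // => w _; rewrite ffunE rmorph0 mul0r.
have Gsurj h : exists M, G (h, M).
  have [k [-> _]] := dA_PBW HH h; exists (\sum_w P' (k w) * W' w).
  rewrite -sumE; exists (\max_w msize (k w)); exists k => // w; exact: leq_bigmax.
have Gf : G (dA_pol HH (cyclo hd (tnth q)), 0).
  exists (msize (cyclo hd (tnth q))).
  have -> : (dA_pol HH (cyclo hd (tnth q)), 0) = PP (cyclo hd (tnth q)) * WW 1%g.
    by rewrite (hd_perm1 HDD) mulr1 /PP /= /pairm P'q.
  exact: pbw_span_term.
have Glc : G (lincomb (dA_pol HH) (dA_perm HH) c, lincomb P' W' c).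
  have -> : (lincomb (dA_pol HH) (dA_perm HH) c, lincomb P' W' c) = lincomb PP WW c.
    exact/esym/pair_sum.
  exists (\max_(b : B) (bdeg b)).+1; apply: red_span_pbw; exists c => // b _.
  by rewrite ltnS; apply: leq_bigmax.
move=> c0; apply: inj; apply: G0.
have : pi (lincomb (dA_pol HH) (dA_perm HH) c) = 0.
  rewrite -c0 /lincomb rmorph_sum; apply: eq_bigr => b _.
  by rewrite !rmorphM.
move=> /(hpi.2 _)[s hs].
have GI : G (lincomb (dA_pol HH) (dA_perm HH) c, 0).
  rewrite hs; elim: s {hs} => [|[x y] s IH].
    by rewrite big_nil; exists 0%N; exact: pbw_span0.
  rewrite big_cons /=; have [X hX] := Gsurj x; have [Y hY] := Gsurj y.
  have := GD _ _ (GM _ _ (GM _ _ hX Gf) hY) IH.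
  congr G; congr (_, _); by rewrite /= mulr0 mul0r addr0.
have GN e : G e -> G (- e) by move=> [m he]; exists m; exact: pbw_spanN.
have := GD _ _ Glc (GN _ GI); congr G; congr (_, _); rewrite /= ?subrr //.
by rewrite oppr0 addr0.
Qed.
End Quotient.

(** * Specialization *)

Lemma row_free_mxsub (F : fieldType) (m p r : nat) (D : 'M[F]_(m, p)) (f : 'I_r -> 'I_m)
    (g : 'I_r -> 'I_p) : mxsub f g D \in unitmx -> (r <= \rank D)%N.
Proof.
move=> u; have -> : r = \rank (mxsub f g D) by rewrite mxrank_unit.
have -> : mxsub f g D = rowsub f 1%:M *m D *m colsub g 1%:M.
  by apply/matrixP => i j; rewrite mulmx_colsub mulmx1 mul_rowsub_mx mul1mx !mxE.
by apply: leq_trans (mxrankM_maxl _ _) (mxrankM_maxr _ _).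
Qed.

Lemma exists_free_rows (F : fieldType) (m p r : nat) (A : 'M[F]_(m, p)) :
  \rank A = r -> exists f : 'I_r -> 'I_m, row_free (rowsub f A).
Proof. by move=> <-; exists (maxrankfun A); exact: maxrowsub_free. Qed.

(* Minors that do not vanish after [phi] do not vanish over [R]. *)
Lemma mxrank_map_le (R : comNzRingType) (F K : fieldType) (phi : {rmorphism R -> F})
    (psi : {rmorphism R -> K}) (m p : nat) (D : 'M[R]_(m, p)) :
  injective psi -> (\rank (map_mx phi D) <= \rank (map_mx psi D))%N.
Proof.
move=> inj; set Df := map_mx phi D; set r := \rank Df.
have [f fr] := exists_free_rows (erefl r).
have rk : \rank (rowsub f Df)^T = r by rewrite mxrank_tr; exact/eqP.
have [g gu] := exists_free_rows rk.
have um : mxsub f g Df \in unitmx.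
  rewrite -unitmx_tr -row_free_unit.
  by move: gu; congr row_free; apply/matrixP => i j; rewrite !mxE.
apply: (@row_free_mxsub _ _ _ _ _ f g); rewrite -map_mxsub unitmxE det_map_mx unitfE.
rewrite -(rmorph0 psi) (inj_eq inj); apply: contraTneq um => d0.
by rewrite -map_mxsub unitmxE det_map_mx d0 rmorph0 unitr0.
Qed.

Section SymmetricEvaluation.
Variable d : nat.

Lemma meval_msym (R : comNzRingType) (p : {mpoly R[d]}) (s : 'S_d) (v : 'I_d -> R) :
  (msym s p).@[v] = p.@[fun i => v (s i)].
Proof.
elim/mpolyind: p => [|c m p _ _ IH]; first by rewrite msym0 !meval0.
rewrite msymD !mevalD IH msymZ !mevalZ msymX !mevalX; congr (_ * _ + _).
rewrite (reindex_inj (@perm_inj _ s)); apply: eq_bigr => i _ /=.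
by rewrite mnmE permK.
Qed.

Lemma meval_sym_perm (R : comNzRingType) (p : {mpoly R[d]}) (s s' : d.-tuple R) :
  p \is symmetric -> perm_eq s s' -> p.@[tnth s] = p.@[tnth s'].
Proof.
move=> /issymP sp /tuple_permP[u e].
have -> : p.@[tnth s] = (msym u p).@[tnth s'].
  rewrite meval_msym; apply: meval_eq => i; rewrite (tnth_nth 0) e (nth_map i) ?size_enum_ord //.
  by rewrite nth_ord_enum.
by rewrite sp.
Qed.

Lemma prod_XsubC_perm (F : fieldType) (s s' : seq F) :
  \prod_(c <- s) ('X - c%:P) = \prod_(c <- s') ('X - c%:P) -> perm_eq s s'.
Proof.
elim: s s' => [|c s IH] s' e.
  have := congr1 (fun p : {poly F} => size p) e.
  by rewrite big_nil size_poly1 size_prod_XsubC => -[/esym/size0nil ->].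
have cs' : c \in s' by rewrite -root_prod_XsubC -e big_cons rootM root_XsubC eqxx.
rewrite perm_sym (perm_trans (perm_to_rem cs')) // perm_cons perm_sym IH //.
apply: (@mulfI _ ('X - c%:P)); first by rewrite polyXsubC_eq0.
by move: e; rewrite big_cons (perm_big _ (perm_to_rem cs')) /= big_cons.
Qed.

(** Up to sign these values are the coefficients of the product of the X - c, whose roots with
    multiplicities they determine. *)
Lemma mesym_separate (F : fieldType) (s s' : d.-tuple F) :
  (forall k : 'I_d.+1, (mesym d F k).@[tnth s] = (mesym d F k).@[tnth s']) -> perm_eq s s'.
Proof.
move=> h.
have e : \prod_(c <- s) ('X - c%:P) = \prod_(c <- s') ('X - c%:P).
  apply/polyP => k.
  have sz (t : d.-tuple F) : size (\prod_(c <- t) ('X - c%:P)) = d.+1.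
    by rewrite size_prod_XsubC size_tuple.
  case: (leqP k d) => [kd|dk]; last by rewrite !nth_default ?sz.
  pose o : 'I_d.+1 := Ordinal (leq_ltn_trans (leq_subr k d) (ltnSn d)).
  have -> : k = (d - o)%N by rewrite /= subKn.
  by rewrite !mroots_coeff h.
exact: prod_XsubC_perm.
Qed.
End SymmetricEvaluation.

Section Coordinates.
Variables (R : comNzRingType) (E : pzRingType) (d l : nat).
Variables (P : {rmorphism {mpoly R[d]} -> E}) (W : 'S_d -> E).
Hypothesis HD : hecke_datum P W.
Local Notation B := (basis_index d l).
Local Notation N := #|B|.

Definition vlc (v : 'rV[R]_N) : E := lincomb (l := l) P W [ffun b => v 0 (enum_rank b)].

Definition linear_op (T : E -> E) : Prop :=
  [/\ T 0 = 0, {morph T : x y / x + y} & forall r x, T (P r%:MP * x) = P r%:MP * T x].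

Lemma vlcE v : vlc v = \sum_j P (v 0 j)%:MP * bas P W (enum_val j).
Proof.
rewrite /vlc lc_sum; apply: eq_bigr => j _.
by rewrite ffunE enum_valK.
Qed.

Lemma vlc0 : vlc 0 = 0.
Proof. by rewrite vlcE big1 // => j _; rewrite mxE mpolyC0 rmorph0 mul0r. Qed.

Lemma vlcD : {morph vlc : u v / u + v}.
Proof. by move=> u v; rewrite !vlcE -big_split; apply: eq_bigr => j _; rewrite mxE mpolyCD rmorphD mulrDl. Qed.

Lemma vlcZ r v : vlc (r *: v) = P r%:MP * vlc v.
Proof.
by rewrite !vlcE mulr_sumr; apply: eq_bigr => j _; rewrite mxE mpolyCM rmorphM mulrA.
Qed.

Lemma vlc_op T (C : 'M[R]_N) : linear_op T ->
  (forall j, T (bas P W (enum_val j)) = vlc (row j C)) -> forall v, T (vlc v) = vlc (v *m C).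
Proof.
move=> [T0 TD TZ] h v; rewrite !vlcE (big_morph T TD T0).
under eq_bigr => j _ do rewrite TZ h vlcE mulr_sumr.
rewrite exchange_big /=; apply: eq_bigr => k _.
rewrite mxE rmorph_sum rmorph_sum mulr_suml; apply: eq_bigr => j _ /=.
by rewrite mulrA -rmorphM -mpolyCM mxE.
Qed.

Lemma vlc_exists e : reducible l P W e -> exists v, e = vlc v.
Proof.
move=> [c ->]; exists (\row_j c (enum_val j)); rewrite /vlc; congr lincomb.
by apply/ffunP => b; rewrite ffunE mxE enum_rankK.
Qed.

Lemma vlc_inj : (forall c : {ffun B -> R}, lincomb P W c = 0 -> c = 0) ->
  forall v, vlc v = 0 -> v = 0.
Proof.
move=> inj v /inj/ffunP h; apply/rowP => j.
by have := h (enum_val j); rewrite !ffunE enum_valK mxE.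
Qed.

Lemma comm_linear_op e : linear_op (fun x => e * x - x * e).
Proof.
split=> [|x y|r x].
- by rewrite mulr0 mul0r subrr.
- by rewrite mulrDr mulrDl opprD addrACA.
by rewrite mulrBr !mulrA -[e * P _](hd_central HD).
Qed.

Lemma mul_linear_op e : linear_op (fun x => e * x).
Proof.
split=> [|x y|r x]; [by rewrite mulr0|by rewrite mulrDr|].
by rewrite !mulrA (hd_central HD).
Qed.
End Coordinates.

Section Transfer.
Variables (R : comNzRingType) (F K : fieldType) (d l : nat) (hd : (0 < d)%N).
Variables (phi : {rmorphism R -> F}) (psi : {rmorphism R -> K}) (q : 'I_l -> R).
Hypothesis psi_inj : injective psi.
Variables (A M : pzRingType).
Variables (PA : {rmorphism {mpoly F[d]} -> A}) (WA : 'S_d -> A).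
Variables (PK : {rmorphism {mpoly K[d]} -> M}) (WK : 'S_d -> M).
Hypotheses (HDA : hecke_datum PA WA) (HDK : hecke_datum PK WK).
Hypotheses (PAq : PA (cyclo hd (fun r => phi (q r))) = 0)
  (PKq : PK (cyclo hd (fun r => psi (q r))) = 0).
Local Notation B := (basis_index d l).
Local Notation N := #|B|.
Hypothesis indA : forall c : {ffun B -> F}, lincomb PA WA c = 0 -> c = 0.
Hypothesis indK : forall c : {ffun B -> K}, lincomb PK WK c = 0 -> c = 0.

(** The product ring, over R, takes the place of an integral form: its span of basis elements maps
    to both algebras. *)
Definition PE : {mpoly R[d]} -> A * M := pairm (PA \o @map_mpoly d R F phi) (PK \o @map_mpoly d R K psi).
HB.instance Definition _ := GRing.RMorphism.on PE.
Definition WE (w : 'S_d) : A * M := (WA w, WK w).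

Lemma HDE : hecke_datum PE WE.
Proof.
have h1 := map_datum phi HDA; have h2 := map_datum psi HDK.
have h := @pair_datum R d A M (PA \o @map_mpoly d R F phi) (PK \o @map_mpoly d R K psi) WA WK h1 h2.
exact: h.
Qed.

Lemma PEq : PE (cyclo hd q) = 0.
Proof. by rewrite /PE /pairm /= !map_cyclo PAq PKq. Qed.

Lemma bas_pair (b : B) : bas PE WE b = (bas PA WA b, bas PK WK b) :> A * M.
Proof.
rewrite [LHS]surjective_pairing; congr (_, _); rewrite /bas /=; congr (_ * _).
  by congr (PA _); exact: map_mpolyX.
by congr (PK _); exact: map_mpolyX.
Qed.

Lemma vlc_pair (v : 'rV[R]_N) :
  vlc PE WE v = (vlc PA WA (map_mx phi v), vlc PK WK (map_mx psi v)).
Proof.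
rewrite !vlcE -pair_sum; apply: eq_bigr => j _.
by rewrite bas_pair [LHS]surjective_pairing /PE /pairm /= !map_mpolyC !mxE.
Qed.

(** Both components have the same coordinates in R. They vanish over K by independence, hence in R
    because [psi] is injective, hence over F. *)
Lemma pair_vanish a : reducible l PE WE (a, 0) -> a = 0.
Proof.
move=> /vlc_exists[v]; rewrite vlc_pair => -[-> /esym/(vlc_inj indK) v0].
suff -> : v = 0 by rewrite map_mx0 vlc0.
by apply/rowP => j; have /rowP/(_ j) := v0; rewrite !mxE -(rmorph0 psi) => /psi_inj.
Qed.

Lemma pol_vanish p : PK (map_mpoly psi p) = 0 -> PA (map_mpoly phi p) = 0.
Proof.
move=> pK; apply: pair_vanish; rewrite -[X in (_, X)]pK; exact: (reducible_pol HDE PEq p).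
Qed.

Section Kernel.
Variables (I : finType) (TA : I -> A -> A) (TK : I -> M -> M).
Hypotheses (linA : forall i, linear_op PA (TA i)) (linK : forall i, linear_op PK (TK i)).
Hypothesis red : forall i (b : B), reducible l PE WE (TA i (bas PA WA b), TK i (bas PK WK b)).

(* The solution spaces over [F] and [K] of a system of linear equations defined over [R]. *)
Lemma common_kernel : exists kap : 'M[F]_N,
  (forall v : 'rV_N, (v <= kap)%MS <-> forall i, TA i (vlc PA WA v) = 0) /\
  forall (p : nat) (U : 'M[K]_(p, N)), row_free U ->
    (forall (v : 'rV_p) i, TK i (vlc PK WK (v *m U)) = 0) -> (p <= \rank kap)%N.
Proof.
have ex i : exists C : 'M[R]_N, forall j,
    (TA i (bas PA WA (enum_val j)), TK i (bas PK WK (enum_val j))) = vlc PE WE (row j C).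
  have /fin_all_exists[f hf] : forall j : 'I_N, exists v : 'rV[R]_N,
      (TA i (bas PA WA (enum_val j)), TK i (bas PK WK (enum_val j))) = vlc PE WE v.
    by move=> j; apply: vlc_exists; apply: red.
  by exists (\matrix_j f j) => j; rewrite rowK.
have {ex} [C hC] := fin_all_exists ex.
have CA i v : TA i (vlc PA WA v) = vlc PA WA (v *m map_mx phi (C i)).
  apply: vlc_op => // j; have := hC i j; rewrite vlc_pair => -[-> _].
  by rewrite map_row.
have CK i v : TK i (vlc PK WK v) = vlc PK WK (v *m map_mx psi (C i)).
  apply: vlc_op => // j; have := hC i j; rewrite vlc_pair => -[_ ->].
  by rewrite map_row.
pose D : 'M[R]_(N, #|{: I * 'I_N}|) := \matrix_(a, j) C (enum_val j).1 a (enum_val j).2.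
have DP (S : fieldType) (f : {rmorphism R -> S}) (v : 'rV[S]_N) :
    v *m map_mx f D = 0 <-> forall i, v *m map_mx f (C i) = 0.
  split=> [h i|h].
    apply/rowP => k; have /rowP/(_ (enum_rank (i, k))) := h.
    rewrite !mxE => e; rewrite -[RHS]e; apply: eq_bigr => a _.
    by rewrite !mxE enum_rankK.
  apply/rowP => j; have /rowP/(_ (enum_val j).2) := h (enum_val j).1.
  rewrite !mxE => e; rewrite -[RHS]e; apply: eq_bigr => a _.
  by rewrite !mxE.
exists (kermx (map_mx phi D)); split=> [v|p U Ufree hU].
  split=> [/sub_kermxP/DP h i|h]; first by rewrite CA h vlc0.
  apply/sub_kermxP/DP => i; apply: (vlc_inj indA); rewrite -CA; exact: h.
have UD : U *m map_mx psi D = 0.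
  apply/row_matrixP => i; rewrite row0 row_mul; apply/DP => k.
  by apply: (vlc_inj indK); rewrite -CK rowE; apply: hU.
rewrite mxrank_ker; have := mxrank_map_le phi D psi_inj.
have := mxrank_mul_ker U (map_mx psi D); rewrite UD mxrank0 add0n.
have h1 : (U <= kermx (map_mx psi D))%MS by apply/sub_kermxP.
have := mxrankS h1; rewrite (eqP Ufree) mxrank_ker => h2 _ h3.
by apply: leq_trans h2 _; apply: leq_sub2l.
Qed.
End Kernel.
End Transfer.

(** * Shapes and central matrices *)

Section Blocks.
Variables (K : fieldType) (l n : nat) (t : 'I_l -> K).
Local Notation d := n.+1.
Local Notation M := (d + d)%N.
Local Notation C := (letter l M).
Variable c0 : C.
Hypothesis generic : forall r s (p p' : nat),
  t r + p%:R = t s + p'%:R -> r = s /\ p = p'.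
Local Notation L := (std_words l n).
Local Notation m := (size L).
Local Notation P := (sn_pol t c0).
Local Notation B := (basis_index d l).
Variable hd0 : (0 < d)%N.

Lemma exists_sn_datum : exists W : 'S_d -> 'M[K]_m,
  hecke_datum P W /\ forall k, (k < n)%N -> W (adj n k) = sn_swap t c0 k.
Proof.
have [W [W1 WM Wadj]] := coxeter_presentation (@sn_swap_sq K l n t c0 generic)
  (@sn_swap_far K l n t c0) (@sn_swap_braid K l n t c0 generic).
exists W; split=> //; split=> //.
- move=> c e; have -> : P c%:MP = c%:M.
    by apply/matrixP => i j; rewrite !mxE mevalC.
  by rewrite -!mulmxE; apply/esym/scalar_mxC.
- move=> i j ij; have lt : (i < n)%N by have := ltn_ord j; lia.
  have ej : j = inord i.+1 by apply: ord_inj; rewrite /= inordK -ij.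
  have -> : tperm i j = adj n i by rewrite /adj inord_val -ej.
  by have := sn_swap_sx c0 generic lt; rewrite Wadj // inord_val -ej.
move=> i j k ij ki kj; have lt : (i < n)%N by have := ltn_ord j; lia.
have ej : j = inord i.+1 by apply: ord_inj; rewrite /= inordK -ij.
have -> : tperm i j = adj n i by rewrite /adj inord_val -ej.
by rewrite Wadj //; apply: sn_swap_sx_far; rewrite // -ij.
Qed.

(** The first letter of a standard word is the corner of a component r, in position d; so x_1 has
    eigenvalue t_r + d there. *)
Lemma sn_cyclo : P (cyclo hd0 (fun r => t r + d%:R)) = 0.
Proof.
apply/matrixP => i j; rewrite !mxE.
suff -> : (cyclo hd0 (fun r => t r + d%:R)).@[evpt t c0 (wd i)] = 0 by rewrite mul0rn.
rewrite /cyclo rmorph_prod /=; set w := wd i.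
have := wd_in i; rewrite mem_std_words -/w => /andP[+ /eqP sw].
case: w sw => [//|c w] _ /= /andP[/and3P[c1 pc cc] _].
rewrite (bigD1 c.1) //= rmorphB /= mevalXU mevalC /evpt /= /cont.
move: pc cc; rewrite !inE prevl2 -leqNgt => pc cc.
by rewrite (_ : pos c = d) ?subrr ?mul0r //; lia.
Qed.

Variable W : 'S_d -> 'M[K]_m.
Hypotheses (HD : hecke_datum P W)
  (Wadj : forall k, (k < n)%N -> W (adj n k) = sn_swap t c0 k).
Local Notation Lam := (reducible l P W).

Let LamM := reducibleM HD sn_cyclo.
Let LamP := reducible_pol HD sn_cyclo.
Let LamW := reducible_perm HD sn_cyclo.

Lemma reducible_scale c (A : 'M[K]_m) : Lam A -> Lam (c *: A).
Proof.
move=> h; have -> : c *: A = P c%:MP * A.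
  by rewrite -mulmxE; apply/matrixP => i j; rewrite mul_diag_mx !mxE mevalC.
by apply: LamM => //; exact: LamP.
Qed.

(** Interpolation: two different words differ in some entry and generic contents are distinct, so a
    product of linear factors vanishes at all words but the i-th. *)
Lemma reducible_delta_diag i : Lam (delta_mx i i).
Proof.
pose p : {mpoly K[d]} := \prod_(x < d) \prod_(c : C | c != nth c0 (wd i) x) ('X_x - (cont t c)%:MP).
pose v := p.@[evpt t c0 (wd i)].
have v0 : v != 0.
  rewrite /v /p rmorph_prod; apply/prodf_neq0 => x _; rewrite rmorph_prod.
  apply/prodf_neq0 => c cn; rewrite rmorphB /= mevalXU mevalC subr_eq0 /evpt.
  by rewrite (inj_eq (cont_inj generic)) eq_sym.
have -> : delta_mx i i = v^-1 *: P p.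
  apply/matrixP => a b; rewrite !mxE.
  have [->|ai] := eqVneq a i.
    by rewrite andTb eq_sym; case: eqP => _; rewrite ?mulr1n ?mulr0n ?mulr0 // mulVf.
  rewrite (_ : p.@[_] = 0) ?mul0rn ?mulr0 //.
  have /existsP[x xn] : [exists x : 'I_d, nth c0 (wd a) x != nth c0 (wd i) x].
    apply: contraNT ai; rewrite negb_exists => /forallP h; apply/eqP/(@wd_inj l n).
    apply: (@eq_from_nth _ c0); first by rewrite !size_wd.
    by move=> k; rewrite size_wd => kd; have := h (Ordinal kd); rewrite negbK => /eqP.
  rewrite /p rmorph_prod (bigD1 x) //= rmorph_prod (bigD1 (nth c0 (wd a) x)) //=.
  by rewrite rmorphB /= mevalXU mevalC /evpt subrr !mul0r.
exact/reducible_scale/LamP.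
Qed.

(** Words of equal shape are connected by admissible swaps. Across one swap s the matrix unit E_xy
    is E_xx s E_yy divided by 1 - al, which is nonzero because the letters are not neighbours. *)
Lemma reducible_delta i j : fin (beads l M d) (wd i) = fin (beads l M d) (wd j) ->
  Lam (delta_mx i j).
Proof.
move=> e; have [wi wj] := (wd_in i, wd_in j).
(* Standardness of [v] is part of the relation, since [std_connect] requires transitivity on
   arbitrary words. *)
pose Q u v := size u = d -> v \in L /\ forall i j, wd i = u -> wd j = v -> Lam (delta_mx i j).
suff : Q (wd i) (wd j) by case/(_ (size_wd i)) => _; apply.
move: (wi) (wj); rewrite !mem_std_words => /andP[si _] /andP[sj _].
apply: (std_connect (S0 := beads l M d)) => //.
- move=> u su sz; rewrite mem_std_words su sz eqxx; split => // a b ha hb.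
  have -> : b = a by apply: (@wd_inj l n); rewrite ha hb.
  exact: reducible_delta_diag.
- move=> u v w huv hvw su; have [vL h1] := huv su.
  have [wL h2] := hvw (std_words_size vL); split => // a b ha hb.
  have [c hc] := wd_surj vL.
  have -> : delta_mx a b = delta_mx a c * delta_mx c b :> 'M[K]_m.
    by rewrite -mulmxE mul_delta_mx.
  by apply: LamM; [apply: h1|apply: h2].
- move=> p a b q h nab sz.
  have uL : p ++ [:: a, b & q] \in L by rewrite mem_std_words h sz eqxx.
  have vL : p ++ [:: b, a & q] \in L by rewrite std_words_swap.
  split=> // x y hx hy; have kn : (size p < n)%N by move: sz; rewrite size_cat /=; lia.
  have al1 : 1 - alw t c0 (size p) (wd x) != 0.
    rewrite hx subr_eq0 eq_sym; apply: contra nab => /eqP a1.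
    have := nb_alw c0 generic kn uL; rewrite a1 expr1n eqxx.
    by rewrite !nth_cat ltnn subnn ltnNge leqnSn /= subSnn.
  have yx : (x == y) = false.
    apply/eqP => xy; have := std_words_neq1 c0 kn uL.
    rewrite -hx xy hy !nth_cat ltnn subnn ltnNge leqnSn /= subSnn.
    have := congr1 (fun w => nth c0 w (size p)) (etrans (esym hx) (etrans (congr1 (@wd l n) xy) hy)).
    by rewrite !nth_cat ltnn subnn /= => ->; rewrite eqxx.
  have -> : delta_mx x y = (1 - alw t c0 (size p) (wd x))^-1 *:
      (delta_mx x x * sn_swap t c0 (size p) * delta_mx y y).
    apply/matrixP => i' j'; rewrite -!mulmxE !mxE (bigD1 y) //= big1 ?addr0; last first.
      by move=> z zy; rewrite !mxE (negbTE zy) mulr0.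
    rewrite !mxE (bigD1 x) //= big1 ?addr0; last first.
      by move=> z zx; rewrite !mxE (negbTE zx) andbF mul0r.
    rewrite !mxE eqxx andbT yx mulr0n add0r hy hx swapw_cat !eqxx mulr1n /=.
    case: (i' == x); case: (j' == y); rewrite ?mulr0 ?mul0r ?mulr0 // mul1r mulr1 -hx.
    by rewrite mulVf.
  apply: reducible_scale; apply: LamM; last exact: reducible_delta_diag.
  by apply: LamM; [exact: reducible_delta_diag | rewrite -Wadj //; exact: LamW].
exact: (fin_perm_eq si sj e).
Qed.

Definition shape_pairs := {ij : 'I_m * 'I_m | fin (beads l M d) (wd ij.1) == fin (beads l M d) (wd ij.2)}.

Lemma card_shape_pairs : #|{: shape_pairs}| = #|B|.
Proof.
rewrite card_basis_index -(@sum_npaths_sq l M d (leqnn M) d (leqnn d)).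
rewrite card_sig -sum1_card.
rewrite (partition_big (fun ij : 'I_m * 'I_m => fin (beads l M d) (wd ij.1)) xpredT) //=.
apply: eq_bigr => S _.
have hn : npaths (M := M) d d S = (\sum_(i < m | fin (beads l M d) (wd i) == S) 1)%N.
  have -> : npaths (M := M) d d S = count (fun w => fin (beads l M d) w == S) L.
    rewrite /npaths /std_words -lock count_filter; apply: eq_count => w /=.
    by rewrite andbC.
  rewrite -sum1_count (big_nth [::]) big_mkord; apply: eq_bigl => i.
  by rewrite /wd.
rewrite hn expnS expn1 big_distrlr /=.
rewrite [RHS]pair_big_dep /=; apply: eq_bigl => -[i j] /=.
rewrite ?inE /=; apply/andP/andP => [[/eqP e1 /eqP e2]|[/eqP e1 /eqP e2]].
  by rewrite -e1 e2 eqxx.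
by rewrite e1 e2 eqxx.
Qed.

(* The span contains as many matrix units as there are elements [bas b]. *)
Lemma sn_independent (c : {ffun B -> K}) : lincomb P W c = 0 -> c = 0.
Proof.
pose Mb : 'M[K]_(#|B|, m * m) := \matrix_(b, j) mxvec (bas P W (enum_val b)) 0 j.
pose N := #|{: shape_pairs}|.
pose D : 'M[K]_(N, m * m) :=
  \matrix_(k, j) mxvec (delta_mx (val (enum_val k)).1 (val (enum_val k)).2 : 'M[K]_m) 0 j.
have lcE (c' : {ffun B -> K}) : mxvec (lincomb P W c') = (\row_b c' (enum_val b)) *m Mb.
  rewrite /lincomb linear_sum /=; apply/rowP => j; rewrite summxE !mxE.
  rewrite (reindex (fun k : 'I_#|B| => enum_val k : B)) /=; last by apply/onW_bij/enum_val_bij.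
  apply: eq_bigr => b _; rewrite !mxE.
  have -> : P (c' (enum_val b))%:MP * bas P W (enum_val b) = c' (enum_val b) *: bas P W (enum_val b).
    by rewrite -mulmxE; apply/matrixP => x y; rewrite mul_diag_mx !mxE mevalC.
  by rewrite linearZ mxE.
have DM : (D <= Mb)%MS.
  apply/row_subP => k; have [c' hc'] := reducible_delta (eqP (valP (enum_val k))).
  have -> : row k D = mxvec (lincomb P W c') by rewrite -hc'; apply/rowP => j; rewrite !mxE.
  by rewrite lcE submxMl.
have Dfree : row_free D.
  rewrite -kermx_eq0; apply/rowV0P => v /sub_kermxP vD; apply/rowP => k.
  have := congr1 (fun u => (vec_mx u : 'M[K]_m) (val (enum_val k)).1 (val (enum_val k)).2) vD.
  rewrite mulmx_sum_row !linear_sum /= summxE linear0 mxE (bigD1 k) //= linearZ /=.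
  have rowD x : vec_mx (row x D) = delta_mx (val (enum_val x)).1 (val (enum_val x)).2.
    by rewrite -[RHS]mxvecK; congr vec_mx; apply/rowP => j; rewrite !mxE.
  rewrite rowD !mxE !eqxx mulr1 big1 ?addr0 // => x xk.
  rewrite linearZ /= rowD !mxE; case: eqP => e1; rewrite ?mulr0 //.
  case: eqP => e2; rewrite ?mulr0 //; case/eqP: xk; apply: enum_val_inj.
  by apply: val_inj; rewrite [LHS]surjective_pairing [RHS]surjective_pairing e1 e2.
have Mfree : row_free Mb.
  rewrite /row_free eqn_leq rank_leq_row /=.
  have rD : (N <= \rank Mb)%N by rewrite -(eqP Dfree); apply: mxrankS.
  by apply: leq_trans rD; rewrite /N card_shape_pairs.
move=> c0'; have := lcE c; rewrite c0' linear0 => /esym/eqP.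
rewrite mulmx_free_eq0 // => /eqP/rowP h; apply/ffunP => b.
by have := h (enum_rank b); rewrite !mxE enum_rankK ffunE.
Qed.

Definition shape (i : 'I_m) : {set C} := fin (beads l M d) (wd i).

Definition block_diag (vs : {set C} -> K) : 'M[K]_m := diag_mx (\row_i vs (shape i)).

Lemma block_reducible vs : reducible l P W (block_diag vs).
Proof.
have -> : block_diag vs = \sum_i vs (shape i) *: delta_mx i i.
  apply/matrixP => a b; rewrite summxE !mxE (bigD1 a) //= big1 ?addr0 => [|i ia].
    by rewrite !mxE eqxx eq_sym; case: eqP; rewrite ?mulr1 ?mulr0.
  by rewrite !mxE eq_sym (negbTE ia) mulr0.
apply: reducible_sum => i _; apply: reducible_scale.
exact: reducible_delta_diag.
Qed.

Lemma block_commP vs p : P p * block_diag vs = block_diag vs * P p.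
Proof. by rewrite -!mulmxE diag_mxC. Qed.

Lemma block_comm (vs : {set C} -> K) (S : 'M[K]_m) :
  (forall i j, S i j != 0 -> shape i = shape j) -> S * block_diag vs = block_diag vs * S.
Proof.
move=> h; rewrite -!mulmxE; apply/matrixP => i j; rewrite mul_diag_mx mul_mx_diag !mxE.
by have [->|/h ->] := eqVneq (S i j) 0; rewrite ?mulr0 ?mul0r // mulrC.
Qed.

Lemma block_commW vs w : W w * block_diag vs = block_diag vs * W w.
Proof.
elim/adjacent_tperm_ind: w => [|i j w ij IH]; first by rewrite (hd_perm1 HD) mul1r mulr1.
rewrite (hd_permM HD) -mulrA IH !mulrA; congr (_ * _).
have lt : (i < n)%N by have := ltn_ord j; lia.
have -> : tperm i j = adj n i.
  by rewrite /adj inord_val; congr tperm; apply: ord_inj; rewrite /= inordK -ij.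
rewrite Wadj //; apply: block_comm => a b; rewrite mxE.
have [-> //|ab] := eqVneq a b; rewrite mulr0n add0r.
have [e|] := eqVneq (wd b) _; last by rewrite mulr0n eqxx.
move=> _; rewrite /shape e; have aL := wd_in a.
have bL := wd_in b; rewrite e swapw_mem // in bL.
have [|p [q' [ew sp]]] := @word_split _ c0 i (wd a); first by rewrite size_wd ltnS.
move: aL bL; move: (nth _ _ _) (nth _ _ _) ew => x y -> aL nxy; rewrite -sp swapw_cat.
move: aL; rewrite mem_std_words std_cat => /andP[/andP[_ h] _].
by rewrite !fin_cat (fin_swap h nxy).
Qed.

(** The rows are the indicator matrices of the shapes. Each shape is attained by some word, so its
    diagonal entry there shows independence. *)
Lemma shape_rows (Y : {set {set C}}) : (forall S, S \in Y -> exists i, shape i = S) ->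
  exists U : 'M[K]_(#|Y|, #|B|), row_free U /\ forall v : 'rV_#|Y|,
    exists vs, vlc P W (v *m U) = block_diag vs /\ forall S, S \notin Y -> vs S = 0.
Proof.
move=> hY; have /fin_all_exists[f hf] : forall k : 'I_#|Y|, exists u : 'rV[K]_#|B|,
    block_diag (fun S => (S == enum_val k)%:R) = vlc P W u.
  by move=> k; apply: vlc_exists; exact: block_reducible.
pose U := \matrix_k f k.
have key (v : 'rV_#|Y|) : vlc P W (v *m U) = block_diag (fun S => \sum_k v 0 k * (S == enum_val k)%:R).
  rewrite mulmx_sum_row (big_morph _ (vlcD P W) (vlc0 l P W)).
  apply/matrixP => a b; rewrite summxE !mxE -sumrMnl; apply: eq_bigr => k _.
  rewrite rowK vlcZ -hf -mulmxE mul_diag_mx !mxE mevalC; exact: mulrnAr.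
exists U; split; last first.
  move=> v; exists (fun S => \sum_k v 0 k * (S == enum_val k)%:R); split; first exact: key.
  move=> S SY; apply: big1 => k _; case: eqP => [e|_]; last by rewrite mulr0.
  by rewrite e enum_valP in SY.
rewrite -kermx_eq0; apply/rowV0P => v /sub_kermxP vU; apply/rowP => k.
have := key v; rewrite vU vlc0.
have [i hi] := hY _ (enum_valP k).
move=> /(congr1 (fun X : 'M_m => X i i)); rewrite !mxE eqxx mulr1n (bigD1 k) //= hi eqxx mulr1.
rewrite big1 ?addr0 => [-> //|x xk]; case: eqP => [/enum_val_inj e|_]; last by rewrite mulr0.
by rewrite e eqxx in xk.
Qed.

Lemma multi_word_shape la : la \in multipartitions l d ->
  exists i, wd i = multi_word la.
Proof.
rewrite inE => h; apply: wd_surj; rewrite mem_std_words (multi_word_std h).1.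
by rewrite /= size_multi_word ?eqxx.
Qed.

(* By [center_bound] there are no more shapes than multipartitions. *)
Lemma every_shape i : exists2 la, la \in multipartitions l d &
  shape i = fin (beads l M d) (multi_word la).
Proof.
pose Y := [set shape i | i : 'I_m].
have hY S : S \in Y -> exists i, shape i = S by move=> /imsetP[i' _ ->]; exists i'.
have [U [Ufree hU]] := shape_rows hY.
have inj : forall c : {ffun B -> K}, lincomb P W c = 0 -> c = 0.
  exact: sn_independent.
have le := center_bound HD sn_cyclo inj Ufree.
have {}le : (#|Y| <= #|multipartitions l d|)%N.
  apply: le => v; have [vs [e _]] := hU v; rewrite -/(vlc P W (v *m U)) in e.
  rewrite /coord_ffun; rewrite /vlc in e; rewrite e; split=> [k|w].
    exact: block_commP.
  exact: block_commW.
pose f la := fin (beads l M d) (multi_word la).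
have sub : f @: multipartitions l d \subset Y.
  apply/subsetP => S /imsetP[la lam ->]; have [j hj] := multi_word_shape lam.
  by apply/imsetP; exists j => //; rewrite /shape hj.
have fcard : #|f @: multipartitions l d| = #|multipartitions l d|.
  apply: card_in_imset => la mu; rewrite !inE => hla hmu; exact: multi_word_inj.
have /eqP eY : f @: multipartitions l d == Y by rewrite eqEcard sub fcard.
have : shape i \in Y by apply/imsetP; exists i.
by rewrite -eY => /imsetP[la lam e]; exists la.
Qed.
End Blocks.

Section MapEvaluation.
Variables (R S : comNzRingType) (f : {rmorphism R -> S}) (d : nat).

Lemma meval_map_mpoly (p : {mpoly R[d]}) (v : 'I_d -> R) :
  (map_mpoly f p).@[fun i => f (v i)] = f p.@[v].
Proof.
elim/mpolyind: p => [|c m p _ _ IH]; first by rewrite !meval0 !raddf0.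
rewrite raddfD !mevalD raddfD /= IH map_mpolyZ map_mpolyX !mevalZ !mevalX rmorphM.
congr (_ * _ + _). rewrite /= (rmorph_prod f); apply: eq_bigr => i _; by rewrite rmorphXn.
Qed.

Lemma map_mpoly_sym (p : {mpoly R[d]}) : p \is symmetric -> map_mpoly f p \is symmetric.
Proof.
move=> /issymP sp; apply/issymP => s; apply/mpolyP => m.
by rewrite mcoeff_sym !mcoeff_map_mpoly -mcoeff_sym sp.
Qed.

Lemma map_mesym k : map_mpoly f (mesym d R k) = mesym d S k.
Proof.
by rewrite !mesymE raddf_sum; apply: eq_bigr => h _ /=; exact: map_mpolyX.
Qed.

Lemma meval_sym_seq (p : {mpoly R[d]}) (x0 y0 : R) (s s' : seq R) : p \is symmetric ->
  size s = d -> perm_eq s s' -> p.@[fun i => nth x0 s i] = p.@[fun i => nth y0 s' i].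
Proof.
move=> sp sz h; have sz' : size s' == d by rewrite -(perm_size h) sz.
move/eqP: sz => sz; have := meval_sym_perm (s := Tuple sz) (s' := Tuple sz') sp h.
rewrite (meval_eq (v2 := fun i : 'I_d => nth x0 s i)) => [->|i]; last exact: tnth_nth.
by apply: meval_eq => i; exact: tnth_nth.
Qed.
End MapEvaluation.

Lemma mpolyX_generic (l : nat) (r s : 'I_l) (p p' : nat) :
  'X_r + p%:R = 'X_s + p'%:R :> {mpoly int[l]} -> r = s /\ p = p'.
Proof.
move=> e; have c (k : nat) : k%:R = (k%:R)%:MP :> {mpoly int[l]} by rewrite mpolyC_nat.
have U0 (x : 'I_l) : (U_(x) == 0 :> 'X_{1..l})%MM = false.
  by apply/negbTE; rewrite -mdeg_eq0 mdeg1.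
rewrite !c in e; split.
  have := congr1 (mcoeff U_(s)) e; rewrite !mcoeffD !mcoeffC !mcoeffX U0 eqxx !mulr0 !addr0.
  by have [/mnmP/(_ r)|] := eqVneq (U_(r))%MM (U_(s))%MM; rewrite // !mnm1E eqxx; case: eqP.
have := congr1 (mcoeff 0%MM) e; rewrite !mcoeffD !mcoeffC !mcoeffX !U0 eqxx !mulr1 !add0r.
by rewrite !natz => -[].
Qed.

Section Generic.
Variables (l n : nat) (R : comNzRingType) (K : fieldType) (psi : {rmorphism R -> K}).
Variable xi : 'I_l -> R.
Local Notation d := n.+1.
Local Notation M := (d + d)%N.
Local Notation C := (letter l M).
Hypothesis psi_inj : injective psi.
Hypothesis xi_generic : forall r s (p p' : nat),
  xi r + p%:R = xi s + p'%:R -> r = s /\ p = p'.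

(* Shifted by [d], since the runners of an abacus start at [d]. *)
Definition gcharge (r : 'I_l) : K := psi (xi r) - d%:R.

Lemma gcharge_generic r s (p p' : nat) :
  gcharge r + p%:R = gcharge s + p'%:R -> r = s /\ p = p'.
Proof.
rewrite /gcharge => e; apply: xi_generic; apply: psi_inj.
rewrite !rmorphD !rmorph_nat /= -[LHS](addrNK d%:R) -[RHS](addrNK d%:R); congr (_ + _).
by rewrite addrAC e addrAC.
Qed.

Definition gcont (c : C) : R := xi c.1 + (pos c)%:R - d%:R.

Lemma psi_gcont c : psi (gcont c) = cont gcharge c.
Proof. by rewrite /gcont /cont /gcharge rmorphB rmorphD /= !rmorph_nat addrAC. Qed.

Definition gpoint (la : multiseq l d) (i : 'I_d) : R := nth 0 (map gcont (multi_word la)) i.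

Variable hd0 : (0 < d)%N.
Variable c0 : C.
Variable W : 'S_d -> 'M[K]_(size (std_words l n)).
Local Notation P := (sn_pol gcharge c0).
Hypotheses (HD : hecke_datum P W)
  (Wadj : forall k, (k < n)%N -> W (adj n k) = sn_swap gcharge c0 k).

Lemma gcyclo : P (cyclo hd0 (fun r => psi (xi r))) = 0.
Proof.
rewrite -[RHS](sn_cyclo gcharge c0 hd0); congr (P _); rewrite /cyclo.
by apply: eq_bigr => r _; rewrite /gcharge addrNK.
Qed.

(** Words of equal shape have the same letters, and a symmetric polynomial ignores their order. *)
Lemma sym_eval_shape (p : {mpoly R[d]}) la i : p \is symmetric -> is_multipartition la ->
  shape i = fin (beads l M d) (multi_word la) ->
  (map_mpoly psi p).@[evpt gcharge c0 (wd i)] = psi p.@[gpoint la].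
Proof.
move=> sp hla e; rewrite -meval_map_mpoly.
have := wd_in i; rewrite mem_std_words => /andP[si /eqP zi].
have [sla _] := multi_word_std hla; have pe := fin_perm_eq si sla e.
have h1 : size (map (cont gcharge) (wd i)) = d by rewrite size_map.
rewrite (meval_eq (v2 := fun j : 'I_d => nth 0 (map (cont gcharge) (wd i)) j)); last first.
  by move=> j; rewrite (nth_map c0) ?zi.
rewrite (meval_sym_seq 0 0 (map_mpoly_sym psi sp) h1 (perm_map (cont gcharge) pe)).
apply: meval_eq => j; rewrite /gpoint (nth_map c0) ?size_multi_word // (nth_map c0 0 gcont) ?size_multi_word //.
by rewrite -psi_gcont.
Qed.

Lemma sym_block (p : {mpoly R[d]}) : p \is symmetric ->
  exists vs, P (map_mpoly psi p) = block_diag vs /\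
    forall la, is_multipartition la ->
      vs (fin (beads l M d) (multi_word la)) = psi p.@[gpoint la].
Proof.
move=> sp.
(* The multipartition behind a shape, unique by [multi_word_inj]; sets that are no shapes get the
   value 0. *)
pose pk S := [pick la in multipartitions l d | fin (beads l M d) (multi_word la) == S].
pose vs S := if pk S is Some la then psi p.@[gpoint la] else 0.
have hvs la : is_multipartition la -> vs (fin (beads l M d) (multi_word la)) = psi p.@[gpoint la].
  move=> h; rewrite /vs /pk; case: pickP => [mu /andP[]|/(_ la)]; last by rewrite inE h eqxx.
  by rewrite inE => hmu /eqP/(multi_word_inj hmu h) ->.
exists vs; split=> //; congr diag_mx; apply/rowP => i; rewrite !mxE.
have [la + e] := every_shape gcharge_generic hd0 HD Wadj i.
by rewrite inE => h; rewrite e hvs // (sym_eval_shape sp h e).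
Qed.
End Generic.

(** The shift by d in the position of a box cancels against the one in [gcont]; the subtraction of
    natural numbers is exact, as there are at most d rows. *)
Lemma multiresiduesE (F : fieldType) (l n : nat) (R : comNzRingType) (phi : {rmorphism R -> F})
    (xi : 'I_l -> R) (q : l.-tuple F) (la : multiseq l n.+1) : (forall r, phi (xi r) = tnth q r) ->
  multiresidues q la = [seq phi (gcont xi c) | c <- multi_word la].
Proof.
move=> phi_xi; rewrite /multiresidues /multi_word map_flatten -map_comp; congr flatten.
apply: eq_map => r /=; rewrite /part_word map_allpairs /residues.
have [sz bd] := component_bounds la r; set s := component la r in sz bd *.
congr flatten; apply/eq_in_map => i; rewrite mem_iota => /= si.
apply/eq_in_map => j; rewrite mem_iota => /= sj.
have jn : (nth 0 s i <= n.+1)%N := bd _ (mem_nth 0 si).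
rewrite /gcont /= pos_inord ?rmorphB ?rmorphD ?rmorph_nat /= ?phi_xi; last by lia.
rewrite natrB ?natrD; last by lia.
by ring.
Qed.

(** * Irreducible modules and central idempotents *)

Section PrincipalIdeal.
Variables (A : nzRingType) (w : A).

(** A left ideal as a boolean predicate, by excluded middle, so that it can carry the structure of a
    module. *)
Definition in_principal : {pred A^o} :=
  fun a => if excluded_middle_informative (exists c, a = c * w) then true else false.

Lemma in_principalP a : reflect (exists c, a = c * w) (a \in in_principal).
Proof.
by rewrite /in_mem /= /in_principal; case: excluded_middle_informative => h; constructor.
Qed.

Lemma in_principal_closed : submod_closed in_principal.
Proof.
split=> [|a x y /in_principalP[c ->] /in_principalP[c' ->]]; apply/in_principalP.
  by exists 0; rewrite mul0r.
by exists (a * c + c'); rewrite mulrDl -mulrA.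
Qed.

HB.instance Definition _ := GRing.isSubmodClosed.Build A A^o in_principal in_principal_closed.

Record principal := Principal { pval : A^o; pvalP : pval \in in_principal }.
HB.instance Definition _ := [isSub for pval].
HB.instance Definition _ := [Choice of principal by <:].
HB.instance Definition _ := [SubChoice_isSubLmodule of principal by <:].

Lemma principal_irreducible : w <> 0 -> (forall c, c * w <> 0 -> exists c', c' * (c * w) = w) ->
  irreducible_module principal.
Proof.
move=> w0 hw.
have wP : w \in in_principal by apply/in_principalP; exists 1; rewrite mul1r.
split; first by exists (Principal wP) => /(congr1 pval).
move=> S [S0 SM]; have [h|h] := classic (exists2 v, S v & v <> 0); last first.
  by left=> v Sv; have [//|v0] := classic (v = 0); case: h; exists v.
right=> v; have [x Sx x0] := h; have [c ec] := in_principalP _ (pvalP x).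
have [|c' hc'] := hw c.
  by rewrite -ec => e; apply: x0; apply: val_inj.
have [a ea] := in_principalP _ (pvalP v).
have -> : v = (a * c') *: x + 0.
  rewrite addr0; apply: val_inj; rewrite linearZ /=.
  by rewrite ea ec -[in LHS]hc'; rewrite -[RHS]/((a * c') * (c * w)) mulrA.
exact: SM.
Qed.
End PrincipalIdeal.

Section Idempotents.
Variables (F : fieldType) (A : algType F) (N : nat) (e : 'I_N -> A).
Local Notation lc v := (\sum_j v 0 j *: e j).
Hypotheses (lc_surj : forall a, exists v : 'rV[F]_N, a = lc v)
  (lc_inj : forall v : 'rV[F]_N, lc v = 0 -> v = 0).

Lemma lc_eq_rv (u v : 'rV[F]_N) : lc u = lc v -> u = v.
Proof.
move=> h; apply/eqP; rewrite -subr_eq0; apply/eqP/lc_inj.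
rewrite -[RHS](subrr (lc v)) -{1}h -sumrB; apply: eq_bigr => j _.
by rewrite !mxE scalerBl.
Qed.

Definition mulr_matrix (w : A) (X : 'M[F]_N) : Prop := forall v : 'rV_N, lc v * w = lc (v *m X).

Lemma mulr_matrix_exists w : exists X, mulr_matrix w X.
Proof.
have /fin_all_exists[f hf] : forall j, exists v : 'rV[F]_N, e j * w = lc v by [].
exists (\matrix_j f j) => v; rewrite mulr_suml.
under eq_bigr => j _ do rewrite -scalerAl hf scaler_sumr.
rewrite exchange_big; apply: eq_bigr => k _ /=; rewrite mxE scaler_suml.
by apply: eq_bigr => j _; rewrite scalerA mxE.
Qed.

(** Descent on the rank of right multiplication by [w], that is on the dimension of A w: if some
    nonzero x w does not generate [w], its left ideal is properly smaller. *)
Lemma minimal_ideal (w : A) : w <> 0 -> exists c : A, c * w <> 0 /\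
  forall x : A, x * (c * w) <> 0 -> exists y : A, y * (x * (c * w)) = c * w.
Proof.
have [X hX] := mulr_matrix_exists w.
move: {2}(\rank X) (leqnn (\rank X)) => k; elim: k w X hX => [|k IH] w X hX rk w0.
  case: w0; have [u hu] := lc_surj 1; rewrite -[w]mul1r hu hX.
  move: rk; rewrite leqn0 mxrank_eq0 => /eqP ->; rewrite mulmx0 big1 // => j _.
  by rewrite mxE scale0r.
have [h|h] := classic (exists2 x : A, x * w <> 0 & forall y : A, y * (x * w) <> w); last first.
  exists 1; rewrite mul1r; split=> // x xw; apply: NNPP => ny; case: h; exists x => // y yw.
  by apply: ny; exists y.
have [x xw nxw] := h; have [Y hY] := mulr_matrix_exists (x * w).
have sub : (Y <= X)%MS.
  apply/row_subP => j; have [u hu] := lc_surj (lc (delta_mx 0 j : 'rV_N) * x).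
  suff -> : row j Y = u *m X by rewrite submxMl.
  by apply: lc_eq_rv; rewrite -hX -hu rowE -hY mulrA.
have nsub : ~~ (X <= Y)%MS.
  apply/negP => XY; have [u hu] := lc_surj 1.
  have /submxP[v hv] : (u *m X <= Y)%MS by exact: submx_trans (submxMl _ _) XY.
  by apply: (nxw (lc v)); rewrite hY -hv -hX -hu mul1r.
have lt : (\rank Y < \rank X)%N by rewrite (ltn_leqif (mxrank_leqif_sup sub)).
have [|c [h1 h2]] := IH _ Y hY _ xw; first by rewrite -ltnS (leq_trans lt).
by exists (c * x); rewrite -mulrA.
Qed.

(** A minimal left ideal inside A f has the required properties. *)
Lemma idempotent_irreducible (f : A) : central_idempotent f -> f <> 0 ->
  exists V : lmodType A, irreducible_module V /\ forall v : V, f *: v = v.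
Proof.
move=> [cf ff] f0; have [c [cf0 hc]] := minimal_ideal f0.
exists (principal (c * f)); split; first exact: principal_irreducible.
move=> v; apply: val_inj; rewrite linearZ /=; have [a ->] := in_principalP _ _ (pvalP v).
by rewrite -[LHS]/(f * (a * (c * f))) cf -!mulrA ff.
Qed.
End Idempotents.

(** The kernel of a central element is a submodule. If it were zero, all powers of [c] would be
    injective. *)
Lemma irreducible_nilpotent (F : fieldType) (A : algType F) (V : lmodType A) (c : A) (k : nat) :
  irreducible_module V -> central c -> (forall v : V, c ^+ k *: v = 0) -> forall v : V, c *: v = 0.
Proof.
move=> [[v0 v0n] irr] cc ck.
have [|inj|//] := irr (fun v => c *: v = 0).
  split=> [|a v u hv hu]; first by rewrite scaler0.
  by rewrite scalerDr hu addr0 scalerA cc -scalerA hv scaler0.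
case: v0n; elim: k ck => [|k IH] ck; first by rewrite -[v0]scale1r -(expr0 c).
by apply: IH => v; apply: inj; rewrite scalerA -exprS.
Qed.

Section CentralElements.
Variables (F : fieldType) (A : algType F).
Implicit Types (x y z : A) (c : F).

Lemma central_scalar c : central (c%:A : A).
Proof. by move=> a; rewrite mulr_algl mulr_algr. Qed.

Lemma centralB x y : central x -> central y -> central (x - y).
Proof. by move=> hx hy a; rewrite mulrBl mulrBr hx hy. Qed.

Lemma centralM x y : central x -> central y -> central (x * y).
Proof. by move=> hx hy a; rewrite -mulrA hy !mulrA hx. Qed.

Lemma centralZ c x : central x -> central (c *: x).
Proof. by move=> hx; rewrite -mulr_algl; apply: centralM => //; apply: central_scalar. Qed.

Lemma centralX x k : central x -> central (x ^+ k).
Proof.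
move=> hx; elim: k => [|k IH]; first by move=> a; rewrite expr0 mul1r mulr1.
by rewrite exprS; exact: centralM.
Qed.

Lemma central_idempotentM x y : central_idempotent x -> central_idempotent y ->
  central_idempotent (x * y).
Proof.
move=> [cx xx] [cy yy]; split; first exact: centralM.
by rewrite mulrA -(mulrA x) cy mulrA xx -mulrA yy.
Qed.

Lemma central_idempotentC x : central_idempotent x -> central_idempotent (1 - x).
Proof.
move=> [cx xx]; split; first by apply: centralB => // a; rewrite mul1r mulr1.
by rewrite mulrBr mulr1 mulrBl mul1r xx subrr subr0.
Qed.

Lemma scaler_alg_eq0 c (V : lmodType A) (v : V) : c != 0 -> c%:A *: v = 0 -> v = 0.
Proof.
move=> c0 h; have e : (c^-1)%:A * c%:A = 1 :> A by rewrite mulr_algl scalerA mulVf // scale1r.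
by rewrite -[v]scale1r -e -scalerA h scaler0.
Qed.

Lemma in_block_centerE b z : central_idempotent b ->
  in_block_center b z <-> central z /\ b * z = z.
Proof.
move=> [cb bb]; split=> [[[h ->] hz]|[cz bz]]; last by split=> [|a _]; [exists z|rewrite cz].
split=> [a|]; last by rewrite mulrA bb.
have e := hz (b * a) (ex_intro _ a erefl); have := mulrA b b h; rewrite bb.
by move: (b * h) e => y e yb; rewrite -{1}yb (cb y) -mulrA e (cb a) -mulrA yb.
Qed.
End CentralElements.

(** * The block of a central character *)

(** A finite system of linear equations for a central element annihilated by [g], stated for any
    ring, to be read over F, over K and in the product. *)
Definition center_eqn (R : comNzRingType) (E : pzRingType) (d : nat) (P : {mpoly R[d]} -> E)
    (W : 'S_d -> E) (g : E) (i : option ('I_d + 'S_d)) (x : E) : E :=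
  match i with
  | None => g * x
  | Some (inl k) => P 'X_k * x - x * P 'X_k
  | Some (inr w) => W w * x - x * W w
  end.

Section Quotient.
Variables (F : fieldType) (n l : nat) (R : comNzRingType) (K : fieldType).
Variables (phi : {rmorphism R -> F}) (psi : {rmorphism R -> K}) (xi : 'I_l -> R).
Local Notation d := n.+1.
Local Notation M := (d + d)%N.
Local Notation C := (letter l M).
Local Notation B := (basis_index d l).
Local Notation N := #|B|.
Local Notation t := (gcharge n psi xi).
Variables (hd : (0 < d)%N) (hl : (0 < l)%N) (q : l.-tuple F).
Hypotheses (psi_inj : injective psi) (xi_generic : forall r s (p p' : nat),
  xi r + p%:R = xi s + p'%:R -> r = s /\ p = p') (phi_xi : forall r, phi (xi r) = tnth q r).
Variables (H : algType F) (HH : dAHA d H) (A : algType F) (pi : {lrmorphism H -> A}).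
Hypothesis hpi : is_cyclotomic_quotient hd q HH pi.
Local Notation PA := (qpol HH pi).
Local Notation WA := (qperm HH pi).
Variable c0 : C.
Variable W : 'S_d -> 'M[K]_(size (std_words l n)).
Local Notation P := (sn_pol t c0).
Hypotheses (HD : hecke_datum P W)
  (Wadj : forall k, (k < n)%N -> W (adj n k) = sn_swap t c0 k).
Local Notation mps := (multipartitions l d).

Let HDA := quotient_datum hpi.

Let gen := gcharge_generic (n := n) psi_inj xi_generic.

Let indK (c : {ffun B -> K}) : lincomb P W c = 0 -> c = 0.
Proof. exact: (sn_independent gen hd HD Wadj). Qed.

Let Pq : P (cyclo hd (fun r => psi (xi r))) = 0 := gcyclo psi xi hd c0.

Let cyclo_xi : cyclo hd (tnth q) = cyclo hd (fun r => phi (xi r)).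
Proof. by rewrite /cyclo; apply: eq_bigr => r _; rewrite phi_xi. Qed.

Let PAq : PA (cyclo hd (fun r => phi (xi r))) = 0.
Proof. by rewrite -cyclo_xi; exact: quotient_cyclo hpi. Qed.

(** Independence over K holds over R as well. The regular representation over R, specialized along
    [phi], supplies the matrices required by [quotient_independent]. *)
Lemma quotient_free (c : {ffun B -> F}) : lincomb PA WA c = 0 -> c = 0.
Proof.
have HDR := map_datum psi HD.
have PR : (P \o map_mpoly psi) (cyclo hd xi) = 0 by rewrite /= map_cyclo Pq.
have indR (c' : {ffun B -> R}) : lincomb (P \o map_mpoly psi) W c' = 0 -> c' = 0.
  move=> h; have /indK/ffunP e : lincomb P W [ffun b => psi (c' b)] = 0.
    rewrite -[RHS]h; apply: eq_bigr => b _; rewrite ffunE /= map_mpolyC; congr (_ * _).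
    by rewrite /bas /= map_mpolyX.
  by apply/ffunP => b; have := e b; rewrite !ffunE -(rmorph0 psi) => /psi_inj.
have bcq := bc_cyclo HDR PR indR phi; rewrite -cyclo_xi in bcq.
apply: (quotient_independent hpi (bc_datum HDR PR indR phi) bcq).
  exact: PR.
by move=> PR' c'; exact: (bc_lincomb_inj (HD := HDR) (Pq := PR') (lc_inj := indR) hl).
Qed.

Lemma sym_vanish (p : {mpoly R[d]}) : p \is symmetric ->
  (forall la, la \in mps -> p.@[gpoint xi la] = 0) -> PA (map_mpoly phi p) = 0.
Proof.
move=> sp h; apply: (pol_vanish psi_inj HDA HD PAq Pq indK).
apply/matrixP => i j; rewrite !mxE.
have [la lam e] := every_shape gen hd HD Wadj i.
have hla : is_multipartition la by rewrite inE in lam.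
by rewrite (sym_eval_shape psi xi c0 sp hla e) h // rmorph0 mul0rn.
Qed.

Local Notation PP := (PE phi psi PA P).
Local Notation WW := (WE WA W).
Let HDP := HDE phi psi HDA HD.
Let PPq := PEq PAq Pq.

Lemma quotient_central (z : A) : (forall k, PA 'X_k * z = z * PA 'X_k) ->
  (forall w, WA w * z = z * WA w) -> central z.
Proof.
move=> hX hW a; have [c ->] := quotient_reducible hpi a.
rewrite mulr_suml mulr_sumr; apply: eq_bigr => b _.
have hP p : z * PA p = PA p * z.
  elim/mpolyind: p => [|c' m p _ _ IH]; first by rewrite rmorph0 mulr0 mul0r.
  rewrite rmorphD mulrDr mulrDl IH; congr (_ + _).
  rewrite -mul_mpolyC rmorphM mulrA -(hd_central HDA) -!mulrA; congr (_ * _).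
  rewrite mpolyXE_id rmorph_prod; elim/big_rec: _ => [|i x _ IHx]; first by rewrite mulr1 mul1r.
  rewrite mulrA -[RHS]mulrA -IHx !mulrA; congr (_ * _); rewrite rmorphXn.
  elim: (m i) => [|k IHk]; first by rewrite !expr0 mulr1 mul1r.
  by rewrite exprS mulrA -hX -!mulrA IHk.
by rewrite /bas !mulrA hP -!mulrA; congr (_ * _); rewrite !mulrA hP -!mulrA hW.
Qed.

(** Over K the element is constant on every shape and hence central; [pair_vanish] transfers the
    vanishing of the commutators. *)
Lemma sym_central (p : {mpoly R[d]}) : p \is symmetric -> central (PA (map_mpoly phi p)).
Proof.
move=> sp; apply: quotient_central => [k|w]; first by rewrite -!rmorphM mulrC.
apply/eqP; rewrite -subr_eq0; apply/eqP.
apply: (pair_vanish (phi := phi) (PA := PA) (WA := WA) (WK := W) psi_inj indK).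
have [vs [e _]] := sym_block psi_inj xi_generic hd HD Wadj sp.
have -> : (WA w * PA (map_mpoly phi p) - PA (map_mpoly phi p) * WA w, 0) =
    WW w * PP p - PP p * WW w.
  by congr (_, _) => /=; rewrite e (block_commW hd HD Wadj) subrr.
by apply: reducibleB; apply: (reducibleM HDP PPq);
  (exact: (reducible_perm HDP PPq) || exact: (reducible_pol HDP PPq)).
Qed.

(** Over K the indicator matrices of the shapes in [Z] solve the equations, and [common_kernel]
    carries their number over to F. *)
Lemma kernel_bound (p : {mpoly R[d]}) (Z : {set multiseq l d}) : p \is symmetric ->
  Z \subset mps -> (forall la, la \in Z -> p.@[gpoint xi la] = 0) ->
  exists kap : 'M[F]_N, (#|Z| <= \rank kap)%N /\ forall v : 'rV_N,
    (v <= kap)%MS <-> central (vlc PA WA v) /\ PA (map_mpoly phi p) * vlc PA WA v = 0.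
Proof.
move=> sp /subsetP Zm pZ.
have lin (S : comNzRingType) (E : pzRingType) (P' : {rmorphism {mpoly S[d]} -> E}) W' g i :
    hecke_datum P' W' -> linear_op P' (center_eqn P' W' g i).
  move=> h; case: i => [[k|w]|]; [exact: (comm_linear_op h)|exact: (comm_linear_op h)|].
  exact: (mul_linear_op h).
pose TA := center_eqn PA WA (PA (map_mpoly phi p)).
pose TK := center_eqn P W (P (map_mpoly psi p)).
have red i (b : B) : reducible l PP WW (TA i (bas PA WA b), TK i (bas P W b)).
  have rb := reducible_bas PP WW b.
  have rP x := reducible_pol HDP PPq x; have rW x := reducible_perm HDP PPq x.
  have rM := reducibleM HDP PPq.
  have -> : (TA i (bas PA WA b), TK i (bas P W b)) = center_eqn PP WW (PP p) i (bas PP WW b).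
    by rewrite bas_pair /TA /TK /PE /pairm; case: i => [[k|w]|] //=; rewrite !map_mpolyX.
  case: i => [[k|w]|]; last exact: rM (rP _) rb.
    by apply: reducibleB; [exact: rM (rP _) rb|exact: rM rb (rP _)].
  by apply: reducibleB; [exact: rM (rW _) rb|exact: rM rb (rW _)].
have [kap [hkap rk]] := common_kernel psi_inj quotient_free indK
  (fun i => lin _ _ _ _ _ i HDA) (fun i => lin _ _ _ _ _ i HD) red.
exists kap; split.
  pose Y := [set fin (beads l M d) (multi_word la) | la in Z].
  have cY : #|Y| = #|Z|.
    apply: card_in_imset => la mu /Zm + /Zm; rewrite !inE; exact: multi_word_inj.
  have hY S : S \in Y -> exists i, shape i = S.
    move=> /imsetP[la /Zm lam ->]; have [i hi] := multi_word_shape hd lam.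
    by exists i; rewrite /shape hi.
  rewrite -cY; have [U [Ufree hU]] := shape_rows gen hd HD hY.
  apply: (rk _ U Ufree) => v i; have [vs [e vs0]] := hU v; rewrite e.
  case: i => [[k|w]|] /=.
  - by apply/eqP; rewrite subr_eq0 block_commP.
  - by apply/eqP; rewrite subr_eq0 (block_commW hd HD Wadj).
  have [us [-> hus]] := sym_block psi_inj xi_generic hd HD Wadj sp.
  rewrite -mulmxE mulmx_diag -[RHS](linear0 (@diag_mx K _)); congr diag_mx.
  apply/rowP => j; rewrite !mxE; have [/imsetP[la laZ ej]|/vs0 ->] := boolP (shape j \in Y).
    rewrite ej hus ?pZ ?rmorph0 ?mul0r //.
    by have := Zm _ laZ; rewrite inE.
  by rewrite mulr0.
move=> v; split=> [/hkap h|[cz pz]].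
  split; last exact: (h None).
  apply: quotient_central => [k|w].
    by apply/eqP; rewrite -subr_eq0; apply/eqP; exact: (h (Some (inl k))).
  by apply/eqP; rewrite -subr_eq0; apply/eqP; exact: (h (Some (inr w))).
apply/hkap => -[[k|w]|] //=; by rewrite cz subrr.
Qed.

Lemma center_rank (kap : 'M[F]_N) :
  (forall v : 'rV_N, (v <= kap)%MS -> central (vlc PA WA v)) -> (\rank kap <= #|mps|)%N.
Proof.
move=> h; apply: (center_bound HDA (quotient_cyclo hpi) quotient_free (row_base_free kap)).
move=> v; have sub : (v *m row_base kap <= kap)%MS.
  by rewrite (submx_trans (submxMl _ _)) // eq_row_base.
by have c := h _ sub; split=> [k|w]; rewrite -/(vlc PA WA _) c.
Qed.
Section Block.
Variable i : d.-tuple F.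
Local Notation cls := (multipartitions_in_class q i).
Local Notation s k := (mesym d R k).
Local Notation sv k := ((mesym d F k).@[tnth i]).

Lemma qpolC c : PA c%:MP = c%:A.
Proof. by rewrite /qpol /= dA_polC linearZ /= rmorph1. Qed.

Lemma specialize_eval (p : {mpoly R[d]}) la : is_multipartition la ->
  phi p.@[gpoint xi la] = (map_mpoly phi p).@[fun j => nth 0 (multiresidues q la) j].
Proof.
move=> h; rewrite -meval_map_mpoly; apply: meval_eq => j; rewrite (multiresiduesE _ phi_xi) /gpoint.
by rewrite !(nth_map c0) ?size_multi_word.
Qed.

Lemma class_eval (p : {mpoly R[d]}) la : p \is symmetric -> la \in cls ->
  phi p.@[gpoint xi la] = (map_mpoly phi p).@[tnth i].
Proof.
rewrite inE => sp /andP[h e]; rewrite specialize_eval //.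
have sz : size (multiresidues q la) = d by rewrite (perm_size e) size_tuple.
rewrite (meval_sym_seq 0 0 (map_mpoly_sym phi sp) sz e).
by apply: meval_eq => j; rewrite -tnth_nth.
Qed.

Lemma class_separate la : exists k : 'I_d.+1,
  la \in mps :\: cls -> phi (s k).@[gpoint xi la] != sv k.
Proof.
(* The value [ord0] is arbitrary; it makes the choice total, as finite choice requires. *)
have [|h] := boolP (la \in mps :\: cls); last by exists ord0.
rewrite !inE => /andP[ncl h].
suff /existsP[k hk] : [exists k : 'I_d.+1, phi (s k).@[gpoint xi la] != sv k] by exists k.
apply: contraNT ncl; rewrite negb_exists h /= => /forallP hk; have sz : size (multiresidues q la) == d.
  by rewrite (multiresiduesE _ phi_xi) size_map size_multi_word.
apply: (mesym_separate (s := Tuple sz)) => k; have := hk k; rewrite negbK => /eqP <-.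
rewrite specialize_eval // map_mesym; apply: meval_eq => j; exact: tnth_nth.
Qed.

(** One factor for each multipartition outside the class: an elementary symmetric polynomial that
    tells its specialized residues from [i], minus its value over R at that multipartition. *)
Lemma exists_separator : exists g : {mpoly R[d]}, [/\ g \is symmetric,
  forall la, la \in mps :\: cls -> g.@[gpoint xi la] = 0 & (map_mpoly phi g).@[tnth i] != 0].
Proof.
have [kf hk] := fin_all_exists class_separate.
have sf mu : s (kf mu) - ((s (kf mu)).@[gpoint xi mu])%:MP \is symmetric.
  by rewrite rpredB ?mesym_sym // -[_%:MP]mulr1 mul_mpolyC rpredZ ?rpred1.
exists (\prod_(mu in mps :\: cls) (s (kf mu) - ((s (kf mu)).@[gpoint xi mu])%:MP)); split.
- by apply: rpred_prod => mu _; exact: sf.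
- by move=> la h; rewrite rmorph_prod (bigD1 la) //= rmorphB /= mevalC subrr mul0r.
rewrite !rmorph_prod; apply/prodf_neq0 => mu h.
by rewrite !rmorphB /= map_mesym map_mpolyC mevalC subr_eq0 eq_sym hk.
Qed.

Definition class_poly (p : {mpoly R[d]}) : {mpoly R[d]} :=
  \prod_(la in cls) (p - (p.@[gpoint xi la])%:MP).

Lemma class_poly_sym p : p \is symmetric -> class_poly p \is symmetric.
Proof.
move=> sp; apply: rpred_prod => la _.
by rewrite rpredB // -[_%:MP]mulr1 mul_mpolyC rpredZ ?rpred1.
Qed.

Lemma class_poly_eval p la : la \in cls -> (class_poly p).@[gpoint xi la] = 0.
Proof. by move=> h; rewrite rmorph_prod (bigD1 la) //= rmorphB /= mevalC subrr mul0r. Qed.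

Lemma class_polyE p : p \is symmetric ->
  PA (map_mpoly phi (class_poly p)) =
    (PA (map_mpoly phi p) - ((map_mpoly phi p).@[tnth i])%:A) ^+ #|cls|.
Proof.
move=> sp; rewrite -[in RHS]qpolC -rmorphB -rmorphXn; congr (PA _).
rewrite rmorph_prod -prodr_const; apply: eq_bigr => la h.
rewrite rmorphB /= map_mpolyC; congr (_ - _%:MP); exact: class_eval.
Qed.

Section Separator.
Variable g : {mpoly R[d]}.
Hypotheses (gsym : g \is symmetric) (g0 : forall la, la \in mps :\: cls -> g.@[gpoint xi la] = 0)
  (gn0 : (map_mpoly phi g).@[tnth i] != 0).
Local Notation gam := ((map_mpoly phi g).@[tnth i]).
Local Notation G := (PA (map_mpoly phi g)).
Local Notation D := (G - gam%:A).
Local Notation eps := ((- gam) ^- #|cls| *: D ^+ #|cls|).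

Lemma separator_vanish p : p \is symmetric ->
  G * (PA (map_mpoly phi p) - ((map_mpoly phi p).@[tnth i])%:A) ^+ #|cls| = 0.
Proof.
move=> sp; rewrite -class_polyE // -!rmorphM.
apply: sym_vanish => [|la lam]; first by rewrite rpredM // class_poly_sym.
rewrite rmorphM /=; have [h|h] := boolP (la \in cls); first by rewrite class_poly_eval ?mulr0.
by rewrite g0 ?mul0r // in_setD h.
Qed.

Lemma G_central : central G. Proof. exact: sym_central. Qed.

Lemma D_central : central D.
Proof. by apply: centralB; [exact: G_central|exact: central_scalar]. Qed.

Lemma powD_ker k (x : A) : G * x = 0 -> D ^+ k * x = (- gam) ^+ k *: x.
Proof.
move=> h; elim: k => [|k IH]; first by rewrite !expr0 mul1r scale1r.
by rewrite exprS -mulrA IH -scalerAr mulrBl h sub0r mulr_algl exprSr -scalerA scaleNr scalerN.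
Qed.

Lemma G_eps : G * eps = 0.
Proof. by rewrite -scalerAr separator_vanish ?scaler0. Qed.

(** Since G annihilates [eps], the factor G - gam acts on it as - gam; the power of - gam in the
    definition makes it idempotent. *)
Lemma eps_idempotent : central_idempotent eps.
Proof.
split; first by apply: centralZ; apply: centralX; exact: D_central.
rewrite -{1}scalerAl powD_ker ?G_eps // scalerA mulVf ?scale1r //.
by rewrite expf_neq0 // oppr_eq0.
Qed.

Lemma eps_ker z : eps * z = 0 <-> D ^+ #|cls| * z = 0.
Proof.
rewrite -scalerAl; split=> [h|->]; last by rewrite scaler0.
apply: (scalerI (a := (- gam) ^- #|cls|)); last by rewrite scaler0.
by rewrite invr_eq0 expf_neq0 // oppr_eq0.
Qed.

Lemma vlc_scale (v : 'rV[F]_N) : vlc PA WA v = \sum_j v 0 j *: bas PA WA (enum_val j).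
Proof. by rewrite vlcE; apply: eq_bigr => j _; rewrite -mulr_algl; congr (_ * _); exact: qpolC. Qed.

Lemma vlcZD c (u v : 'rV[F]_N) :
  vlc (l := l) PA WA (c *: u + v) = c *: vlc PA WA u + vlc PA WA v.
Proof.
rewrite !vlc_scale scaler_sumr -big_split; apply: eq_bigr => j _.
by rewrite !mxE scalerDl scalerA.
Qed.

Lemma kernel_rank : exists kap : 'M[F]_N, \rank kap = #|cls| /\
  forall v : 'rV_N, (v <= kap)%MS <->
    central (vlc PA WA v) /\ D ^+ #|cls| * vlc PA WA v = 0.
Proof.
have sub : cls \subset mps by apply/subsetP => la; rewrite !inE => /andP[].
have [k1 [rk1 hk1]] := kernel_bound (class_poly_sym gsym) sub
  (fun la => @class_poly_eval g la).
have [k0 [rk0 hk0]] := kernel_bound gsym (subsetDl mps cls) g0.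
rewrite class_polyE // in hk1.
exists k1; split=> //; apply/eqP; rewrite eqn_leq rk1 andbT.
(* Where G vanishes, the n-th power of G - gam is a nonzero scalar. *)
have cap0 : (k1 :&: k0 = 0)%MS.
  apply/eqP/rowV0P => v; rewrite sub_capmx => /andP[/hk1[_ h1] /hk0[_ h0]].
  apply: (vlc_inj quotient_free); move: h1; rewrite powD_ker // => h1.
  apply: (scalerI (a := (- gam) ^+ #|cls|)); last by rewrite scaler0.
  by rewrite expf_neq0 // oppr_eq0.
have le : (\rank (k1 + k0)%MS <= #|mps|)%N.
  apply: (center_rank) => v /sub_addsmxP[[a b] ->] /= z.
  have [h1 _] := (hk1 _).1 (submxMl a k1); have [h0 _] := (hk0 _).1 (submxMl b k0).
  by rewrite -[a *m k1]scale1r vlcZD scale1r mulrDl mulrDr h1 h0.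
move: le rk0; rewrite mxrank_disjoint_sum // cardsDS //.
by have := subset_leq_card sub; lia.
Qed.

Lemma kernel_has_dim : has_dim (fun z : A => central z /\ eps * z = 0) #|cls|.
Proof.
have [kap [rk hk]] := kernel_rank.
have [U Ufree Ueq] : exists2 U : 'M[F]_(#|cls|, N), row_free U & (U :=: kap)%MS.
  by rewrite -rk; exists (row_base kap); [exact: row_base_free|exact: eq_row_base].
have lin (c : {ffun 'I_#|cls| -> F}) :
    \sum_k c k *: vlc PA WA (row k U) = vlc PA WA ((\row_k c k) *m U).
  rewrite mulmx_sum_row; under [in RHS]eq_bigr => k _ do rewrite mxE.
  elim/big_rec2: _ => [|k u v _ ->]; last by rewrite vlcZD.
  by rewrite vlc0.
exists (fun k => vlc PA WA (row k U)); split=> [c|z [cz dz]].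
  rewrite lin; have /hk[h1 /eps_ker h2] : ((\row_k c k) *m U <= kap)%MS by rewrite -Ueq submxMl.
  by split.
have [v ev] := vlc_exists (quotient_reducible hpi z); rewrite ev in cz dz *.
have /submxP[a ha] : (v <= U)%MS by rewrite Ueq; apply/hk; split=> //; apply/eps_ker.
exists [ffun k => a 0 k]; split=> [|c'].
  by rewrite lin; congr vlc; rewrite ha; congr (_ *m _); apply/rowP => k; rewrite mxE ffunE.
rewrite lin ha => e; have {}e : (a - \row_k c' k) *m U = 0.
  by apply: (vlc_inj quotient_free); rewrite mulmxBl addrC -scaleN1r vlcZD -e scaleN1r addNr.
move/eqP: e; rewrite mulmx_free_eq0 // subr_eq0 => /eqP ->.
by apply/ffunP => k; rewrite ffunE mxE.
Qed.

Lemma idempotent_zero (f : A) : central_idempotent f ->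
  (forall V : lmodType A, irreducible_module V -> (forall v : V, f *: v = v) -> False) -> f = 0.
Proof.
move=> hf nV; apply: NNPP => f0.
have surj (a : A) : exists v : 'rV[F]_N, a = \sum_j v 0 j *: bas PA WA (enum_val j : B).
  by have [v ->] := vlc_exists (quotient_reducible hpi a); exists v; exact: vlc_scale.
have inj (v : 'rV[F]_N) : \sum_j v 0 j *: bas PA WA (enum_val j : B) = 0 -> v = 0.
  by rewrite -vlc_scale; exact: (vlc_inj quotient_free).
by have [V [irr hV]] := idempotent_irreducible surj inj hf f0; exact: nV irr hV.
Qed.

(** G acts as gam because G - gam is nilpotent on V. Cancelling this scalar in [separator_vanish]
    makes each s_k - s_k(i) nilpotent too. The elementary symmetric polynomials come from R, and
    they generate the symmetric polynomials over F. *)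
Lemma eps_central_character (V : lmodType A) : irreducible_module V ->
  (forall v : V, eps *: v = 0) -> has_central_character HH pi i V.
Proof.
move=> irr h.
have Gv (v : V) : G *: v = gam%:A *: v.
  apply/eqP; rewrite -subr_eq0 -scalerBl; apply/eqP.
  apply: (irreducible_nilpotent (k := #|cls|) irr D_central) => u.
  have -> : D ^+ #|cls| = ((- gam) ^+ #|cls|)%:A * eps.
    by rewrite mulr_algl scalerA divff ?scale1r // expf_neq0 // oppr_eq0.
  by rewrite -scalerA h scaler0.
pose good r := forall v : V, PA r *: v = (r.@[tnth i])%:A *: v.
have goodC c : good c%:MP by move=> v; rewrite qpolC mevalC.
have goodD r r' : good r -> good r' -> good (r + r').
  by move=> hr hr' v; rewrite rmorphD scalerDl hr hr' mevalD scalerDl scalerDl.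
have goodM r r' : good r -> good r' -> good (r * r').
  move=> hr hr' v; rewrite rmorphM -scalerA hr hr' mevalM scalerA.
  by rewrite mulr_algl scalerA.
have sk k : good (mesym d F k).
  move=> v; apply/eqP; rewrite -subr_eq0 -scalerBl -(map_mesym phi); apply/eqP.
  apply: (irreducible_nilpotent (k := #|cls|) irr) => [|u].
    apply: centralB; last exact: central_scalar.
    by apply: sym_central; exact: mesym_sym.
  have := separator_vanish (mesym_sym d R k).
  move: (_ ^+ _) => x /(congr1 (fun a => a *: u)); rewrite -scalerA Gv scale0r.
  exact: scaler_alg_eq0.
move=> p sp; change (good p); have [u [<- _]] := sym_fundamental sp.
rewrite comp_mpolyE; elim/big_ind: _ => [||m _]; [by have := goodC 0; rewrite mpolyC0|exact: goodD|].
rewrite -mul_mpolyC; apply: (goodM) => //; elim/big_ind: _ => [||j _]; [exact: (goodC 1)|exact: goodM|].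
rewrite tnth_mktuple; elim: (m j) => [|k IH]; first exact: (goodC 1).
by rewrite exprS; apply: goodM.
Qed.

Lemma character_eps (V : lmodType A) : has_central_character HH pi i V ->
  forall v : V, eps *: v = 0.
Proof.
move=> h v; have Gv (u : V) : G *: u = gam%:A *: u by exact: (h _ (map_mpoly_sym phi gsym)).
suff Dv : D ^+ #|cls| *: v = 0 by rewrite -[eps]mulr_algl -scalerA Dv scaler0.
have := separator_vanish gsym; case: #|cls| => [|k] e.
  have := Gv v; rewrite -[G]mulr1 e scale0r => /esym/(scaler_alg_eq0 gn0) ->.
  by rewrite scaler0.
by rewrite exprSr -scalerA scalerBl Gv subrr scaler0.
Qed.

(** Both b eps and (1 - eps)(1 - b) are central idempotents that act as the identity on no
    irreducible module, hence are zero. *)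
Lemma block_idempotentE b : is_block_idempotent HH pi i b -> b = 1 - eps.
Proof.
move=> [[hb _ _] h1 h0]; have he := eps_idempotent.
have [hb' he'] := (central_idempotentC hb, central_idempotentC he).
have e1 : b * eps = 0.
  apply: idempotent_zero (central_idempotentM hb he) _ => V irr hV.
  have [[v0 v0n] _] := irr; apply: v0n; rewrite -[v0]hV.
  have [ch|nch] := classic (has_central_character HH pi i V).
    by rewrite -scalerA (character_eps ch) scaler0.
  by rewrite hb.1 -scalerA (h0 _ irr nch) scaler0.
have e2 : (1 - eps) * (1 - b) = 0.
  apply: idempotent_zero (central_idempotentM he' hb') _ => V irr hV.
  have [[v0 v0n] _] := irr; apply: v0n.
  have ch : has_central_character HH pi i V.
    apply: eps_central_character => // v.
    have z : eps * (1 - eps) = 0 by rewrite mulrBr mulr1 he.2 subrr.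
    by rewrite -[v]hV scalerA mulrA z mul0r scale0r.
  have z : (1 - b) *: v0 = 0 by rewrite scalerBl scale1r (h1 _ irr ch) subrr.
  by rewrite -[v0]hV -scalerA z scaler0.
move/eqP: e2; rewrite mulrBr mulr1 mulrBl mul1r -hb.1 e1 subr0 subr_eq0 => /eqP <-.
by [].
Qed.

Lemma block_has_dim b : is_block_idempotent HH pi i b -> has_dim (in_block_center b) #|cls|.
Proof.
move=> hb; have be := block_idempotentE hb; have [[ib _ _] _ _] := hb.
have [v [hv1 hv2]] := kernel_has_dim.
have E z : in_block_center b z <-> central z /\ eps * z = 0.
  rewrite in_block_centerE // be mulrBl mul1r; split=> -[cz h]; split=> //.
    by rewrite -[LHS](subKr z) h subrr.
  by rewrite h subr0.
by exists v; split=> [c|z /E/hv2 //]; apply/E.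
Qed.
End Separator.
End Block.
End Quotient.

Theorem theorem4p3 (F : fieldType) (d l : nat) (hd : (0 < d)%N) (hl : (0 < l)%N)
    (q : l.-tuple F)
    (H : algType F) (HH : dAHA d H)
    (A : algType F) (pi : {lrmorphism H -> A})
    (hpi : is_cyclotomic_quotient hd q HH pi)
    (i : d.-tuple F) (hi : factors_through HH pi i)
    (b : A) (hb : is_block_idempotent HH pi i b) :
  has_dim (in_block_center b) #|multipartitions_in_class q i|.
Proof.
case: d hd HH hpi i hi hb => [//|n] hd HH hpi i _ hb.
pose phi : {rmorphism {mpoly int[l]} -> F} := mmap intr (tnth q).
pose psi : {rmorphism {mpoly int[l]} -> {fraction {mpoly int[l]}}} := @tofrac {mpoly int[l]}.
pose xi (r : 'I_l) : {mpoly int[l]} := 'X_r.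
have psi_inj : injective psi by move=> x y /eqP; rewrite tofrac_eq => /eqP.
have phi_xi r : phi (xi r) = tnth q r by rewrite /phi /= mmapX mmap1U.
have gen : forall r s (p p' : nat), xi r + p%:R = xi s + p'%:R -> r = s /\ p = p'.
  exact: mpolyX_generic.
(* The concrete maps are forgotten here; injectivity, specialization and genericity are all that
   remains of them. *)
move: phi psi xi psi_inj phi_xi gen => phi psi xi psi_inj phi_xi gen.
pose c0 : letter l (n.+1 + n.+1) := (Ordinal hl, ord0).
have [W [HD Wadj]] := exists_sn_datum c0 (gcharge_generic (n := n) psi_inj gen) hd.
have [g [gs g0 gn0]] := exists_separator (xi := xi) hd phi_xi c0 i.
exact: (block_has_dim hl psi_inj gen phi_xi hpi HD Wadj gs g0 gn0 hb).
Qed.
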